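(* Let $f:\mathbb R^2\to\mathbb C$ be a source function with compact support $\Omega=\bigcup_{m=1}^M\Omega_m$ such that $(f,\Omega)$ satisfies the source assumption stated in the context, and let $0<k_{\min}<k_{\max}$. If every $\Omega_m$ is a simply connected polygon and all the corners $P_1,\dots,P_N$ of $\partial\Omega$ are known, then one can choose finitely many observation directions $\hat x_i\in\mathbb S^1$, $1\le i\le T$, such that all the edges $e_1,\dots,e_N$ of $\partial\Omega$ as well as the values $f(P_1),\dots,f(P_N)$ can be determined by the far field patterns $\{u^\infty(\pm\hat x_i,k):1\le i\le T,\ k\in(k_{\min},k_{\max})\}$.
   Context: Notation. $\mathbb S^1=\{x\in\mathbb R^2:|x|=1\}$; for $\hat x\in\mathbb S^1$, $\hat x^\perp$ is $\hat x$ rotated anticlockwise by $\pi/2$; $l_{\hat x,s}:=\{y\in\mathbb R^2:\hat x\cdot y=s\}$. A point $y\in\partial\Omega$ is a corner if the unit normal to $\partial\Omega$ is not continuous at $y$. Source assumption on $(f,\Omega)$, where $\Omega=\operatorname{supp} f$ is compact: (i) $\Omega=\bigcup_{m=1}^M\Omega_m$ where the $\Omega_m$ are compact and pairwise disjoint; each boundary $\partial\Omega_m$ is piecewise $C^1$ with finitely many corners, and the interior of each $\Omega_m$ is a connected domain. (ii) For any $\hat x\in\mathbb S^1$ and any $s\in\mathbb R$ there exist $J(s)<\infty$ and numbers $\alpha_j(s),\beta_j(s)$ with $\beta_j(s)\le\alpha_j(s)$ for $j=1,\dots,J(s)$, $\alpha_j(s)\le\beta_{j+1}(s)$ for $j=1,\dots,J(s)-1$,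 and $l_{\hat x,s}\cap\Omega=\bigcup_{j=1}^{J(s)}\{s\hat x+\tau\hat x^\perp:\beta_j(s)\le\tau\le\alpha_j(s)\}$. (iii) $f|_{\Omega_m}\in C^1(\Omega_m)$ for $m=1,\dots,M$, and $f(y)\ne0$ for all $y\in\partial\Omega$. Far field pattern: $u^\infty(\hat x,k)=\int_{\mathbb R^2}e^{-ik\hat x\cdot y}f(y)\,dy$ for $\hat x\in\mathbb S^1$, $k>0$ (the far field pattern of the radiating solution of $\Delta u+k^2u=-f$ in $\mathbb R^2$). Meaning of ''can be determined'': for each such source $f$ there exist $T<\infty$ and directions $\hat x_1,\dots,\hat x_T$ (which may be chosen adaptively, i.e. may depend on the known corners and on the source through its far field data) such that any source $g$ that also satisfies the hypotheses, has the same set of corners $\{P_1,\dots,P_N\}$, and has the same far field patterns as $f$ at the directions $\pm\hat x_i$, $1\le i\le T$, for all $k\in(k_{\min},k_{\max})$, has the same set of edges as $f$ and satisfies $g(P_n)=f(P_n)$ for $n=1,\dots,N$. *)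

(* Defs.v *)
From HB Require Import structures.
From mathcomp Require Export all_boot all_order all_algebra.
From mathcomp Require Export all_classical all_reals all_analysis.
From mathcomp Require Export complex.
Import Order.TTheory GRing.Theory Num.Theory.
Export numFieldNormedType.Exports.

Set Implicit Arguments.
Unset Strict Implicit.
Unset Printing Implicit Defensive.

Local Open Scope classical_set_scope.
Local Open Scope ring_scope.
Local Open Scope complex_scope.

Section Plane.
Variable R : realType.
Local Notation plane := (R * R)%type.
Implicit Types (x y z n : plane) (A : set plane).

Definition dot x y : R := x.1 * y.1 + x.2 * y.2.

(* The library norm on [R * R] is the maximum norm, hence a separate name. *)
Definition enorm x : R := Num.sqrt (dot x x).

Definition circle : set plane := [set x | enorm x = 1].

Definition perp x : plane := (- x.2, x.1).

Definition line x (s : R) : set plane := [set y | dot x y = s].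

Definition segment x y : set plane :=
  [set x + t *: (y - x) | t in `[0, 1]%classic].

Definition open_segment x y : set plane :=
  [set x + t *: (y - x) | t in `]0, 1[%classic].

Definition boundary A : set plane := closure A `\` interior A.

(* [n] is the exterior unit normal to [boundary A] at [y]: near [y], and up to
   angles that are arbitrarily close to the tangent line, [A] is the half-plane
   of the [z] with [dot (z - y) n < 0]. *)
Definition exterior_normal A y n : Prop :=
  enorm n = 1 /\
  forall e : R, 0 < e -> \forall z \near y,
    (dot (z - y) n < - (e * enorm (z - y)) -> A z) /\
    (e * enorm (z - y) < dot (z - y) n -> ~ A z).

Definition normal_continuous_at A y : Prop :=
  exists2 n, exterior_normal A y n &
    forall e : R, 0 < e -> \forall z \near y, boundary A z ->
      exists2 n', exterior_normal A z n' & enorm (n' - n) < e.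

Definition corners A : set plane :=
  [set y | boundary A y /\ ~ normal_continuous_at A y].

Definition edges A : set (set plane) :=
  [set e | exists x y, e = segment x y /\
     [/\ x <> y, corners A x, corners A y, segment x y `<=` boundary A &
         open_segment x y `&` corners A = set0]].

Definition C1_arc (gamma : R -> plane) : Prop :=
  [/\ {within `[0, 1]%classic, continuous gamma},
      set_inj `[0, 1]%classic gamma &
      exists2 dgamma : R -> plane,
        {within `[0, 1]%classic, continuous dgamma} &
        (forall t : R, t \in `[0, 1] -> dgamma t <> 0) /\
        (forall t : R, t \in `]0, 1[ -> is_derive t 1 gamma (dgamma t))].

Definition piecewise_C1 A : Prop :=
  exists (p : nat) (gamma : 'I_p -> R -> plane),
    [/\ forall i, C1_arc (gamma i),
        forall i j, i != j ->
          gamma i @` `[0, 1]%classic `&` gamma j @` `]0, 1[%classic = set0 &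
        A = \bigcup_i (gamma i @` `[0, 1]%classic)].

(* Continuously differentiable up to the boundary: the partial derivatives in
   the interior of [A] extend continuously to [A]. *)
Definition C1_on A (h : plane -> R) : Prop :=
  {within A, continuous h} /\
  forall v : plane, v = (1, 0) \/ v = (0, 1) ->
    exists2 dh : plane -> R, {within A, continuous dh} &
      forall y, interior A y -> is_derive y v h (dh y).

Definition C1_on_complex A (f : plane -> R[i]) : Prop :=
  C1_on A (fun y => complex.Re (f y)) /\ C1_on A (fun y => complex.Im (f y)).

Definition supp (f : plane -> R[i]) : set plane := closure [set y | f y != 0].

Definition source_assumption (f : plane -> R[i]) (M : nat)
    (Om : 'I_M -> set plane) : Prop :=
  [/\ compact (supp f) /\ (0 < M)%N,
      supp f = \bigcup_m Om m /\ trivIset setT Om,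
      forall m, [/\ compact (Om m),
        piecewise_C1 (boundary (Om m)), finite_set (corners (Om m)),
        interior (Om m) !=set0 & connected (interior (Om m))],
      forall x (s : R), circle x ->
        exists (J : nat) (alpha beta : nat -> R),
          [/\ forall j, (j < J)%N -> beta j <= alpha j,
              forall j, (j.+1 < J)%N -> alpha j <= beta j.+1 &
              line x s `&` supp f = \bigcup_(j in [set j | (j < J)%N])
                [set s *: x + t *: perp x | t in `[beta j, alpha j]%classic]] &
      (forall m, C1_on_complex (Om m) f) /\
      (forall y, boundary (supp f) y -> f y != 0)].

(* The vertices are listed cyclically ([ordS] is the cyclic successor).  Sides
   meet only at the common vertex of two consecutive ones, and no vertex has
   an angle of [pi]. *)
Definition simple_closed_polyline A : Prop :=
  exists (p : nat) (v : 'I_p.+3 -> plane),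
    [/\ injective v,
        forall i j, i != j ->
          segment (v i) (v (ordS i)) `&` segment (v j) (v (ordS j)) `<=`
          [set v i; v (ordS i)] `&` [set v j; v (ordS j)],
        forall i, dot (perp (v (ordS i) - v i))
                      (v (ordS (ordS i)) - v (ordS i)) != 0 &
        A = \bigcup_i segment (v i) (v (ordS i))].

(* A closed polygonal region; holes are allowed, whence several polylines. *)
Definition polygon A : Prop :=
  [/\ compact A, A = closure (interior A) &
      exists (p : nat) (C : 'I_p -> set plane),
        [/\ trivIset setT C, forall i, simple_closed_polyline (C i) &
            boundary A = \bigcup_i C i]].

Definition path_in A (gamma : R -> plane) : Prop :=
  {within `[0, 1]%classic, continuous gamma} /\
  gamma @` `[0, 1]%classic `<=` A.

Definition null_homotopic_in A (gamma : R -> plane) : Prop :=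
  exists H : R * R -> plane,
    [/\ {within `[0, 1]%classic `*` `[0, 1]%classic, continuous H},
        H @` (`[0, 1]%classic `*` `[0, 1]%classic) `<=` A,
        forall t : R, t \in `[0, 1] -> H (0, t) = gamma t,
        forall t : R, t \in `[0, 1] -> H (1, t) = gamma 0 &
        forall s : R, s \in `[0, 1] -> H (s, 0) = gamma 0 /\ H (s, 1) = gamma 0].

Definition simply_connected A : Prop :=
  [/\ A !=set0,
      forall x y, A x -> A y ->
        exists gamma, [/\ path_in A gamma, gamma 0 = x & gamma 1 = y] &
      forall gamma, path_in A gamma -> gamma 0 = gamma 1 ->
        null_homotopic_in A gamma].

Definition polygonal_source (f : plane -> R[i]) (M : nat)
    (Om : 'I_M -> set plane) : Prop :=
  source_assumption f Om /\
  forall m, polygon (Om m) /\ simply_connected (Om m).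

Definition lebesgue2 := (@lebesgue_measure R \x @lebesgue_measure R)%E.

Definition complex_integral (g : plane -> R[i]) : R[i] :=
  Rintegral lebesgue2 setT (fun y => complex.Re (g y)) +i*
  Rintegral lebesgue2 setT (fun y => complex.Im (g y)).

Definition expi (t : R) : R[i] := cos t +i* sin t.

Definition far_field (f : plane -> R[i]) x (k : R) : R[i] :=
  complex_integral (fun y => expi (- (k * dot x y)) * f y).

End Plane.

(* Main.v *)
Require Import Defs.
From mathcomp Require Import ring lra measurable_realfun.
Import Order.TTheory GRing.Theory Num.Theory.

(** Three directions proportional to [(1, m)], with [m] larger than a bound that
depends on the corners only, suffice.  In such a direction distinct corners have
distinct projections and no segment between corners is orthogonal to the
direction.

The far field pattern on an interval of frequencies determines all the moments
of the function that integrates the source over the lines orthogonal to the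
direction, hence this function itself.  Its second difference at the projection
of a corner [z] has the limit [f z * (+/- |d1 x d2|) / (p d1 * p d2)], where [d1]
and [d2] are the sides issued from [z], [p] is the projection, and the sign tells
whether the convex or the reflex wedge lies in the support.  Three values of [m]
turn this into an identity between quadratic forms, which yields the two lines
that carry the sides at [z], while [f z] is so far only known up to sign.

On each line the sides match the corners consecutively, so that the sides are
determined.  Finally, membership in the support switches at each transversal
crossing of the boundary, so that the boundary determines the support up to
boundary points, hence the sign. *)

Set Implicit Arguments.
Unset Strict Implicit.
Unset Printing Implicit Defensive.

Local Open Scope classical_set_scope.
Local Open Scope ring_scope.
Local Open Scope complex_scope.

(** * Lebesgue measure on the line and on the plane *)

(** Near a corner the support is a cone, so a difference step [e] sees a picture that is homogeneous
    in [e]: divided by [e], the second difference tends to the second difference of the lengths in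
    which the lines at levels [1], [-1] and [0] cut the cone. An open side contributes nothing,
    because the end of its section is linear in the level. Away from the boundary the quotient is
    the difference of a forward and a backward difference quotient, so that first derivatives are
    enough. The obstacle is that a corner value and the convex or reflex type of the corner enter
    the limit only through their product. Values can therefore be read off only after the support is
    known, and the sides must be found without them. Up to this unknown factor, the products of
    projections of the two sides are quadratic forms evaluated at [(1, m)]; such a form has three
    coefficients, whence three directions. Real and imaginary parts are treated as two real
    functions with the same discontinuity set; since the source does not vanish at a corner, at
    least one of them detects the sides there. *)

Section Lebesgue.
Context {R : realType}.
Local Notation mu := (@lebesgue_measure R).
Local Notation affine a c := (fun x : measurableTypeR R => a * x + c : measurableTypeR R).

Lemma measurable_affine (a c : R) : measurable_fun setT (affine a c).
Proof. by apply: measurable_funD => //; exact: measurable_funM. Qed.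

(** Lebesgue measure is determined by half-open intervals, and the preimage of such an interval
    under the affine map is an interval shorter by the factor [a]. *)
Lemma lebesgue_measure_affine (a c : R) (A : set R) : 0 < a -> measurable A ->
  (a%:E * pushforward mu (affine a c) A)%E = mu A.
Proof.
move=> a0 mA; have ma := measurable_affine a c.
pose phi : {mfun measurableTypeR R >-> measurableTypeR R} :=
  MeasurableFun.Pack (MeasurableFun.Class (isMeasurableFun.Build _ _ _ _ _ ma)).
pose k : {nonneg R} := NngNum (ltW a0).
suff H B : measurable B -> mu B = mscale k (pushforward mu phi) B.
  by rewrite (H ma A mA).
apply: lebesgue_measure_unique => _ [[b d]] _ <-.
change (mu `]b, d]%classic = a%:E * mu (affine a c @^-1` `]b, d]%classic))%E.
rewrite (_ : _ @^-1` _ = `](b - c) / a, (d - c) / a]%classic); last first.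
  apply/seteqP; split=> x/=; rewrite !in_itv/= ltr_pdivrMr// ler_pdivlMr//;
  by rewrite ltrBlDr lerBrDr mulrC.
rewrite !lebesgue_measure_itv/= !lte_fin ltr_pM2r ?invr_gt0// ltrD2r.
case: ifP => _; last by rewrite mule0.
by rewrite -!EFinB -EFinM; congr EFin; field; rewrite gt_eqF.
Qed.

Lemma ge0_integral_affine (a c : R) (f : R -> \bar R) : 0 < a ->
  measurable_fun setT f -> (forall x, 0 <= f x)%E ->
  (\int[mu]_x f (a * x + c)%R = a^-1%:E * \int[mu]_x f x)%E.
Proof.
move=> a0 mf f0; have ma := measurable_affine a c.
pose phi : {mfun measurableTypeR R >-> measurableTypeR R} :=
  MeasurableFun.Pack (MeasurableFun.Class (isMeasurableFun.Build _ _ _ _ _ ma)).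
have a0' : 0 <= a^-1 by rewrite invr_ge0 ltW.
pose k : {nonneg R} := NngNum a0'.
have <- := ge0_integral_mscale mu measurableT k mf (fun x _ => f0 x).
have -> : (\int[mu]_x f (a * x + c)%R = \int[pushforward mu phi]_x f x)%E.
  by rewrite ge0_integral_pushforward.
apply: eq_measure_integral => /= A mA _.
rewrite /mscale/= -(lebesgue_measure_affine c a0 mA) muleA -EFinM mulVf ?mul1e//.
by rewrite gt_eqF.
Qed.

(** Used with [a = 1] as translation invariance, and with a small [a] to blow up a window around a
    point. *)
Lemma Rintegral_affine (a c : R) (f : R -> R) : 0 < a ->
  mu.-integrable setT (EFin \o f) ->
  \int[mu]_x f (a * x + c) = a^-1 * \int[mu]_x f x.
Proof.
move=> a0 fi; rewrite /Rintegral; have mf := measurable_int mu fi.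
have fifin := integrable_fin_num measurableT fi.
have ip := integrable_pos_fin_num measurableT fi.
have ineg := integrable_neg_fin_num measurableT fi.
rewrite -[a^-1]/(fine a^-1%:E) -fineM//; congr fine.
rewrite integralE [in RHS]integralE muleBr//; last first.
  by rewrite fin_num_adde_defl// fin_numN.
congr (_ - _)%E.
  rewrite -(ge0_integral_affine c)//; first by apply: eq_integral => x _; rewrite !funeposE.
  exact: measurable_funepos.
rewrite -(ge0_integral_affine c)//; first by apply: eq_integral => x _; rewrite !funenegE.
exact: measurable_funeneg.
Qed.

End Lebesgue.

Section IntegrableBounded.
Context d (T : measurableType d) (R : realType) (nu : {measure set T -> \bar R}).

Lemma integrable_bounded_supp (D : set T) (f : T -> R) (B : R) :
  measurable D -> (nu D < +oo)%E -> measurable_fun setT f ->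
  (forall x, `|f x| <= B) -> (forall x, ~ D x -> f x = 0) ->
  nu.-integrable setT (EFin \o f).
Proof.
move=> mD D_fin mf fB fD.
have -> : (EFin \o f) = ((EFin \o f) \_ D)%E.
  apply/funext => x; rewrite patchE; case: ifPn => //= /negP.
  by rewrite inE => /fD ->.
apply/(integrable_mkcond _ mD).
apply: measurable_bounded_integrable => //; first exact: measurable_funS mf.
exists B; split; first exact: num_real.
by move=> x Bx y _; apply: le_trans (fB y) (ltW Bx).
Qed.

End IntegrableBounded.

Section PlaneMeasure.
Context {R : realType}.
Local Notation mu := (@lebesgue_measure R).
Local Notation plane := (R * R)%type.

(** The measurable structure of the plane is the product one, generated by rectangles; an open set
    is the countable union of the rational boxes that it contains. *)
Lemma open_measurable2 (U : set plane) : open U -> measurable U.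
Proof.
move=> oU.
pose box (q : rat * rat * (rat * rat)) : set plane :=
  `]ratr q.1.1, ratr q.1.2[%classic `*` `]ratr q.2.1, ratr q.2.2[%classic.
(* Boxes that leave [U] are replaced by the empty set, so that the union runs over a whole countable
   type. *)
pose F q := if `[< box q `<=` U >] then box q else set0.
have -> : U = \bigcup_q F q.
  apply/seteqP; split => [z Uz|z [q _]]; last first.
    by rewrite /F; case: asboolP => // qU /qU.
  have /nbhs_ballP[e /= e0 zU] := open_nbhs_nbhs (conj oU Uz).
  have lt1 (x : R) : x - e < x by rewrite ltrBlDr ltrDl.
  have lt2 (x : R) : x < x + e by rewrite ltrDl.
  have [q1 /[!in_itv]/= /andP[q1l q1u]] := rat_in_itvoo (lt1 z.1).
  have [q2 /[!in_itv]/= /andP[q2l q2u]] := rat_in_itvoo (lt2 z.1).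
  have [q3 /[!in_itv]/= /andP[q3l q3u]] := rat_in_itvoo (lt1 z.2).
  have [q4 /[!in_itv]/= /andP[q4l q4u]] := rat_in_itvoo (lt2 z.2).
  exists ((q1, q2), (q3, q4)) => //; rewrite /F; case: asboolP => [_|[]].
    by split; rewrite /= in_itv/= ?q1u ?q2l ?q3u ?q4l.
  move=> w [/=]; rewrite !in_itv/= => /andP[w1 w2] /andP[w3 w4].
  by apply: zU; split; rewrite /ball/= ltr_norml; apply/andP; split; lra.
apply: countable_bigcupT_measurable => // q.
rewrite /F; case: asboolP => // _; exact: measurableX.
Qed.

Lemma closed_measurable2 (A : set plane) : closed A -> measurable A.
Proof.
by move=> cA; rewrite -(setCK A); apply: measurableC; apply: open_measurable2;
  exact: closed_openC.
Qed.

Lemma within_continuous_measurable (A : set plane) (h : plane -> R) :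
  measurable A -> {within A, continuous h} -> measurable_fun A h.
Proof.
move=> mA /continuousP ch; apply: (measurability _ (RGenOpens.measurableE R)).
move=> _ [_ [a [b ->] <-]].
have /open_subspaceP[V oV VD] := ch _ (@interval_open R (BRight a) (BLeft b) isT isT).
rewrite setIC -VD; apply: measurableI => //; exact: open_measurable2.
Qed.

Lemma measurable_supp_continuous (A : set plane) (h : plane -> R) :
  closed A -> {within A, continuous h} -> (forall z, ~ A z -> h z = 0) ->
  measurable_fun setT h.
Proof.
move=> cA ch hA; have mA := closed_measurable2 cA.
rewrite -(setUv A); apply/measurable_funU => //; first exact: measurableC.
split; first exact: within_continuous_measurable.
have : measurable_fun (~` A) (cst 0 : plane -> R) by [].
by apply: eq_measurable_fun => z; rewrite inE => /hA ->.
Qed.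

End PlaneMeasure.

(** * Uniqueness for Fourier integrals with compact support *)

Section Trigonometry.
Context {R : realType}.

Lemma MVT_increment (f df : R -> R) (x h : R) :
  (forall y : R, is_derive y 1 f (df y)) ->
  exists2 c, `|c - x| <= `|h| & f (x + h) - f x = df c * h.
Proof.
move=> fdf.
have cf (i : interval R) : {within [set` i], continuous f}.
  by apply: derivable_within_continuous => y _; case: (fdf y).
have [h0|/ltW h0] := leP 0 h.
- have xh : x <= x + h by rewrite lerDl.
  have [c /[!in_itv]/= /andP[c1 c2] E] := MVT_segment xh (fun y _ => fdf y) (cf _).
  exists c; first by rewrite !ger0_norm ?subr_ge0// lerBlDl.
  by rewrite E; congr (_ * _); ring.
- have xh : x + h <= x by rewrite gerDl.
  have [c /[!in_itv]/= /andP[c1 c2] E] := MVT_segment xh (fun y _ => fdf y) (cf _).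
  exists c; first by rewrite !ler0_norm ?subr_le0//; lra.
  by rewrite -opprB E; ring.
Qed.

Lemma sin_lipschitz (x y : R) : `|sin y - sin x| <= `|y - x|.
Proof.
have [c _] := MVT_increment x (y - x) (@is_derive_sin R).
rewrite [x + _]addrC subrK => ->; rewrite normrM ler_piMl//; exact: cos_max.
Qed.

Lemma cos_lipschitz (x y : R) : `|cos y - cos x| <= `|y - x|.
Proof.
have [c _] := MVT_increment x (y - x) (@is_derive_cos R).
rewrite [x + _]addrC subrK => ->; rewrite normrM normrN ler_piMl//; exact: sin_max.
Qed.

(** One mean value step followed by the Lipschitz bound for [sin]. This loses a factor [2] against
    Taylor's formula, but only the order in [h] matters. *)
Lemma cos_expansion (x h : R) : `|cos (x + h) - cos x + h * sin x| <= h ^+ 2.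
Proof.
have [c cx ->] := MVT_increment x h (@is_derive_cos R).
have -> : - sin c * h + h * sin x = - (h * (sin c - sin x)) by ring.
have -> : h ^+ 2 = `|h| * `|h| by rewrite -expr2 real_normK// num_real.
rewrite normrN normrM.
by apply: ler_pM => //; exact: le_trans (sin_lipschitz _ _) cx.
Qed.

Lemma sin_expansion (x h : R) : `|sin (x + h) - sin x - h * cos x| <= h ^+ 2.
Proof.
have [c cx ->] := MVT_increment x h (@is_derive_sin R).
have -> : cos c * h - h * cos x = h * (cos c - cos x) by ring.
have -> : h ^+ 2 = `|h| * `|h| by rewrite -expr2 real_normK// num_real.
rewrite normrM.
by apply: ler_pM => //; exact: le_trans (cos_lipschitz _ _) cx.
Qed.

End Trigonometry.

(** * Vanishing moments from Fourier integrals that vanish on an interval *)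

Section BoundedSupport.
Context {R : realType}.
Local Notation mu := (@lebesgue_measure R).
Implicit Types f g : R -> R.

(** A class of integrable functions that is stable under sums and under products with continuous
    functions, in particular powers and trigonometric functions; it settles all integrability
    conditions on the line. *)
Definition bounded_supp f := measurable_fun setT f /\
  exists B S : R, forall x, `|f x| <= B /\ (S < `|x| -> f x = 0).

Lemma integrable_bounded_supp1 f : bounded_supp f ->
  mu.-integrable setT (EFin \o f).
Proof.
move=> [mf [B [S fBS]]].
apply: (@integrable_bounded_supp _ _ _ mu `[- S, S]%classic _ B) => //.
- by rewrite /= lebesgue_measure_itv/=; case: ifP => _; rewrite ?ltry// ltey.
- by move=> x; case: (fBS x).
- move=> x /negP; rewrite /= in_itv/= -ler_norml -ltNge => xS.
  by case: (fBS x) => _; apply.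
Qed.

Lemma bounded_suppN f : bounded_supp f -> bounded_supp (fun x => - f x).
Proof.
move=> [mf [B [S fBS]]]; split; first exact: measurableT_comp.
by exists B, S => x; have [? fS] := fBS x; split; [rewrite normrN|move/fS->; rewrite oppr0].
Qed.

Lemma bounded_supp_norm f : bounded_supp f -> bounded_supp (fun x => `|f x|).
Proof.
move=> [mf [B [S fBS]]]; split; first exact: measurableT_comp.
by exists B, S => x; have [? fS] := fBS x; split; [rewrite normr_id|move/fS->; rewrite normr0].
Qed.

Lemma bounded_suppD f g : bounded_supp f -> bounded_supp g ->
  bounded_supp (fun x => f x + g x).
Proof.
move=> [mf [B [S fBS]]] [mg [B' [S' gBS]]]; split; first exact: measurable_funD.
exists (B + B'), (Num.max S S') => x.
have [fB fS] := fBS x; have [gB gS] := gBS x; split.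
  by apply: le_trans (ler_normD _ _) _; exact: lerD.
by rewrite gt_max => /andP[/fS-> /gS->]; rewrite addr0.
Qed.

Lemma continuous_locally_bounded f : continuous f ->
  forall S, exists B, forall x, `|x| <= S -> `|f x| <= B.
Proof.
move=> cf S.
have /compact_bounded[B [_ HB]] : compact (f @` `[- S, S]%classic).
  by apply: continuous_compact; [exact: continuous_subspaceT|exact: segment_compact].
exists (B + 1) => x xS; apply: HB; first by rewrite ltrDl.
by exists x => //=; rewrite in_itv/= -ler_norml.
Qed.

Lemma bounded_suppM f g : continuous g -> bounded_supp f ->
  bounded_supp (fun x => g x * f x).
Proof.
move=> cg [mf [B [S fBS]]]; split.
  by apply: measurable_funM => //; exact: continuous_measurable_fun.
have [C gC] := continuous_locally_bounded cg S.
exists (Num.max (C * B) 0), S => x; have [fB fS] := fBS x; split; last first.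
  by move=> /fS ->; rewrite mulr0.
rewrite le_max; have [xS|/fS->] := leP `|x| S.
  by rewrite normrM ler_pM// gC.
by rewrite mulr0 normr0 lexx orbT.
Qed.

Lemma continuous_cosM (k : R) : continuous (fun x : R => cos (k * x)).
Proof.
move=> x; apply: continuous_comp; last exact: continuous_cos.
by apply: continuousM; [exact: cst_continuous|].
Qed.

Lemma continuous_sinM (k : R) : continuous (fun x : R => sin (k * x)).
Proof.
move=> x; apply: continuous_comp; last exact: continuous_sin.
by apply: continuousM; [exact: cst_continuous|].
Qed.

Lemma continuous_idX n : continuous (fun x : R => x ^+ n).
Proof. exact: exprn_continuous. Qed.

(** The real part of the Fourier integral of [f + i g] with kernel [exp (- i k x)]; the imaginary
    part is [trig_integral k g (fun x => - f x)]. *)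
Definition trig_integral (k : R) f g : R :=
  \int[mu]_x (cos (k * x) * f x + sin (k * x) * g x).

Lemma bounded_supp_trig (k : R) f g : bounded_supp f -> bounded_supp g ->
  bounded_supp (fun x => cos (k * x) * f x + sin (k * x) * g x).
Proof.
move=> bf bg; apply: bounded_suppD; apply: bounded_suppM => //.
  exact: continuous_cosM.
exact: continuous_sinM.
Qed.

(* Differentiation under the integral sign in [k], by a second-order bound on
   the difference quotient. *)
Lemma trig_integral_derive (a b : R) f g :
  bounded_supp f -> bounded_supp g ->
  (forall k, a < k -> k < b -> trig_integral k f g = 0) ->
  forall k, a < k -> k < b ->
  trig_integral k (fun x => x * g x) (fun x => - (x * f x)) = 0.
Proof.
move=> bf bg H k ak kb.
have cid : continuous (fun x : R => x) by move=> x; exact: cvg_id.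
have bxf : bounded_supp (fun x => x * f x) by exact: bounded_suppM.
have bxg : bounded_supp (fun x => x * g x) by exact: bounded_suppM.
have bd := bounded_supp_trig k bxg (bounded_suppN bxf).
pose w x := x ^+ 2 * (`|f x| + `|g x|).
have bw : bounded_supp w.
  apply: bounded_suppM; first exact: continuous_idX.
  by apply: bounded_suppD; exact: bounded_supp_norm.
pose C := \int[mu]_x w x.
set D := trig_integral _ _ _.
(* The integral vanishes at [k] and at [k + e], so that [e * D] is, up to sign, the integral of the
   second-order remainder alone. That remainder is at most [e ^+ 2 * w x], and one factor [e]
   cancels. *)
have key (e : R) : 0 < e -> k + e < b -> `|D| <= e * C.
  move=> e0 ke.
  have bk := bounded_supp_trig k bf bg.
  have bke := bounded_supp_trig (k + e) bf bg.
  have E : e * D = - \int[mu]_x ((cos ((k + e) * x) * f x + sin ((k + e) * x) * g x)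
     - (cos (k * x) * f x + sin (k * x) * g x)
     - e * (cos (k * x) * (x * g x) + sin (k * x) * - (x * f x))).
    rewrite RintegralB//; first last.
    - by apply: integrable_bounded_supp1; apply: bounded_suppM => //; exact: cst_continuous.
    - by apply: integrable_bounded_supp1; apply: bounded_suppD => //; exact: bounded_suppN.
    rewrite RintegralB//; try exact: integrable_bounded_supp1.
    rewrite RintegralZl//; last exact: integrable_bounded_supp1.
    rewrite -/(trig_integral _ _ _) -/(trig_integral k f g).
    rewrite -/(trig_integral k _ _) !H//; last by rewrite (lt_trans ak)// ltrDl.
    by rewrite subrr sub0r opprK.
  rewrite -(ler_pM2l e0) -[X in X * `|D|](gtr0_norm e0) -normrM E normrN mulrA -expr2.
  have bdiff : bounded_supp (fun x => (cos ((k + e) * x) * f x + sin ((k + e) * x) * g x)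
     - (cos (k * x) * f x + sin (k * x) * g x)
     - e * (cos (k * x) * (x * g x) + sin (k * x) * - (x * f x))).
    apply: bounded_suppD; first by apply: bounded_suppD => //; exact: bounded_suppN.
    by apply: bounded_suppN; apply: bounded_suppM => //; exact: cst_continuous.
  apply: (le_trans (le_normr_Rintegral measurableT (integrable_bounded_supp1 bdiff))).
  rewrite /C -RintegralZl//; last exact: integrable_bounded_supp1.
  apply: le_Rintegral => //.
  - by apply: integrable_bounded_supp1; exact: bounded_supp_norm.
  - by apply: integrable_bounded_supp1; apply: bounded_suppM => //; exact: cst_continuous.
  move=> x _; rewrite /w [leRHS]mulrA -exprMn [leRHS]mulrDr.
  set y := k * x; have -> : (k + e) * x = y + e * x by rewrite mulrDl.
  rewrite [leLHS](_ : _ = `|(cos (y + e * x) - cos y + e * x * sin y) * f x +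
    (sin (y + e * x) - sin y - e * x * cos y) * g x|); last by congr `|_|; ring.
  apply: (le_trans (ler_normD _ _)); rewrite !normrM.
  apply: lerD; apply: ler_wpM2r => //; first exact: cos_expansion.
  exact: sin_expansion.
apply/eqP; rewrite -normr_le0; apply/ler_addgt0Pr => e e0; rewrite add0r.
pose e' := Num.min ((b - k) / 2) (e / (`|C| + 1)).
have C0 : 0 < `|C| + 1 by rewrite ltr_wpDl.
have e'0 : 0 < e' by rewrite lt_min !divr_gt0// subr_gt0.
have ke : k + e' < b.
  have e'1 : e' <= (b - k) / 2 by rewrite ge_min lexx.
  clear - e'1 kb; lra.
apply: (le_trans (key _ e'0 ke)).
apply: (@le_trans _ _ (e / (`|C| + 1) * (`|C| + 1))); last by rewrite divfK// gt_eqF.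
apply: (@le_trans _ _ (e' * (`|C| + 1))).
  by rewrite ler_pM2l// (le_trans (ler_norm _))// lerDl.
by rewrite ler_pM2r// ge_min lexx orbT.
Qed.

(** Differentiation in [k] turns the pair [(f, g)] into [(x g, - x f)]. Thus the vanishing of the
    real part for [(f, g)] gives that of the imaginary part for [(x f, x g)], and conversely: both
    hypotheses are needed to carry the induction. *)
Lemma trig_moments (a b : R) n : forall f g,
  bounded_supp f -> bounded_supp g ->
  (forall k, a < k -> k < b -> trig_integral k f g = 0) ->
  (forall k, a < k -> k < b -> trig_integral k g (fun x => - f x) = 0) ->
  forall k, a < k -> k < b ->
  trig_integral k (fun x => x ^+ n * f x) (fun x => x ^+ n * g x) = 0.
Proof.
elim: n => [|n IH] f g bf bg Hfg Hgf k ak kb.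
  rewrite -(Hfg k ak kb); apply: eq_Rintegral => x _.
  by rewrite !expr0 !mul1r.
have cid : continuous (fun x : R => x) by move=> x; exact: cvg_id.
have bxf : bounded_supp (fun x => x * f x) by exact: bounded_suppM.
have bxg : bounded_supp (fun x => x * g x) by exact: bounded_suppM.
rewrite -(IH _ _ bxf bxg _ _ k ak kb).
- by apply: eq_Rintegral => x _; rewrite !exprSr !mulrA.
- move=> {ak kb}k ak kb.
  have := trig_integral_derive bg (bounded_suppN bf) Hgf ak kb.
  rewrite /trig_integral => /eqP; rewrite -oppr_eq0 => /eqP E.
  rewrite -[RHS]E -mulN1r -RintegralZl//.
    by apply: eq_Rintegral => x _; ring.
  apply: integrable_bounded_supp1; apply: bounded_supp_trig.
    by apply: bounded_suppM => //; exact: bounded_suppN.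
  exact: bounded_suppN.
- exact: trig_integral_derive.
Qed.

Lemma poly_integral_eq0 (p : {poly R}) : forall f, bounded_supp f ->
  (forall n, \int[mu]_x (x ^+ n * f x) = 0) -> \int[mu]_x (p.[x] * f x) = 0.
Proof.
elim/poly_ind: p => [|p c IH] f bf mf.
  rewrite -[RHS](Rintegral_set0 mu (fun=> 0)) [RHS]Rintegral_mkcond.
  by apply: eq_Rintegral => x _; rewrite horner0 mul0r patchE in_set0.
have cid : continuous (fun x : R => x) by move=> x; exact: cvg_id.
have bxf : bounded_supp (fun x => x * f x) by exact: bounded_suppM.
transitivity (\int[mu]_x (p.[x] * (x * f x) + c * f x)).
  by apply: eq_Rintegral => x _; rewrite hornerMXaddC mulrDl mulrA.
rewrite RintegralD//; last 2 first.
- by apply: integrable_bounded_supp1; apply: bounded_suppM => //; exact: continuous_horner.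
- by apply: integrable_bounded_supp1; apply: bounded_suppM => //; exact: cst_continuous.
rewrite IH// => [|n].
  rewrite RintegralZl//; last exact: integrable_bounded_supp1.
  have := mf 0%N; under eq_Rintegral do rewrite expr0 mul1r.
  by move=> ->; rewrite mulr0 addr0.
by rewrite -[RHS](mf n.+1); apply: eq_Rintegral => x _; rewrite exprSr mulrA.
Qed.

Lemma continuous_bounded_supp f S : continuous f ->
  (forall x, S < `|x| -> f x = 0) -> bounded_supp f.
Proof.
move=> cf fS; split; first exact: continuous_measurable_fun.
have [B fB] := continuous_locally_bounded cf S.
exists (Num.max B 0), S => x; split; last exact: fS.
rewrite le_max; have [/fB-> //|/fS->] := leP `|x| S.
by rewrite normr0 lexx orbT.
Qed.

Lemma Rintegral_indic_itv (a b : R) : a <= b ->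
  \int[mu]_x \1_(`[a, b]%classic : set R) x = b - a.
Proof.
move=> ab; rewrite /Rintegral integral_indic//= setIT lebesgue_measure_itv/=.
rewrite lte_fin; case: ltgtP ab => //= -> _; by rewrite subrr.
Qed.

End BoundedSupport.

(** * Continuous functions of compact support with vanishing moments *)

Section Landau.
Context {R : realType}.
Local Notation mu := (@lebesgue_measure R).
Implicit Types (f g : R -> R) (S x : R).

Lemma bounded_supp_indic (a b : R) : bounded_supp (\1_(`[a, b]%classic : set R)).
Proof.
split; first exact: measurable_indic.
exists 1, (Num.max (- a) b) => x; split.
  by rewrite indicE; case: (_ \in _); rewrite ?normr1 ?normr0.
rewrite indicE gt_max => /andP[xa xb]; rewrite memNset//= in_itv/=.
move=> /andP[ax bx]; have [x0|x0] := leP 0 x.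
  by move: xb; rewrite ger0_norm// ltNge bx.
by move: xa; rewrite ltr0_norm// ltrN2 ltNge ax.
Qed.

(** With the lemma that follows it, this compares the base of the Landau kernel inside and outside
    the distance [e] from its peak. *)
Lemma landau_bound (T x0 x e : R) : 0 < T -> 0 <= e -> `|x - x0| <= e ->
  1 - (e / T) ^+ 2 <= 1 - ((x - x0) / T) ^+ 2.
Proof.
move=> T0 e0 xe; rewrite lerD2l lerN2 -(real_normK (num_real (_ / T))).
rewrite ler_pXn2r ?nnegrE ?divr_ge0// ?(ltW T0)//.
by rewrite normrM normfV (gtr0_norm T0) ler_pM2r ?invr_gt0.
Qed.

Lemma landau_bound_le (T x0 x e : R) : 0 < T -> 0 <= e -> e <= `|x - x0| ->
  1 - ((x - x0) / T) ^+ 2 <= 1 - (e / T) ^+ 2.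
Proof.
move=> T0 e0 xe; rewrite lerD2l lerN2 -(real_normK (num_real ((x - x0) / T))).
rewrite ler_pXn2r ?nnegrE ?divr_ge0// ?(ltW T0)//.
by rewrite normrM normfV (gtr0_norm T0) ler_pM2r ?invr_gt0.
Qed.

Lemma pos_near f (x0 : R) : continuous f -> 0 < f x0 ->
  exists2 e : R, 0 < e & forall x, `|x - x0| < e -> f x0 / 2 <= f x.
Proof.
move=> cf fx0; have fx02 : 0 < f x0 / 2 by rewrite divr_gt0.
have /cvgr_dist_lt /(_ _ fx02) := cf x0.
move=> /nbhs_ballP[e /= e0 he]; exists e => // x xe.
have := he x; rewrite /ball/= distrC => /(_ xe).
by rewrite ltr_norml => /andP[_]; lra.
Qed.

(* Test against [(1 - ((x - x0) / T) ^+ 2) ^+ n], which concentrates at [x0]. *)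
Lemma moments_le0 f S : continuous f -> (forall x, S < `|x| -> f x = 0) ->
  (forall n, \int[mu]_x (x ^+ n * f x) = 0) -> forall x, f x <= 0.
Proof.
move=> cf fS mf x0; rewrite leNgt; apply/negP => fx0.
have bf := continuous_bounded_supp cf fS.
have [B fB] : exists B : R, forall x, `|f x| <= B.
  by case: bf => _ [B [S' H]]; exists B => x; case: (H x).
have B0 : 0 <= B by apply: le_trans (fB 0).
have x0S : `|x0| <= S by rewrite leNgt; apply/negP => /fS H; rewrite H ltxx in fx0.
have S0 : 0 <= S by exact: le_trans x0S.
(* Points with absolute value at most [S] lie within [2 * S < T] of [x0], so that the kernel base
   [q] is nonnegative on the support. *)
pose T : R := 2 * S + 1; have T0 : 0 < T by rewrite /T; lra.
have [e e0 fe] := pos_near cf fx0.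
pose d : R := Num.min e (T / 2).
have d0 : 0 < d by rewrite lt_min e0 divr_gt0.
have dT : d < T by rewrite gt_min; apply/orP; right; lra.
have fd x : `|x - x0| < d -> f x0 / 2 <= f x.
  by rewrite lt_min => /andP[/fe].
clearbody d; clear e e0 fe.
pose q (x : R) : R := 1 - ((x - x0) / T) ^+ 2.
pose r1 : R := 1 - (d / 2 / T) ^+ 2; pose r2 : R := 1 - (d / T) ^+ 2.
have r20 : 0 < r2.
  rewrite /r2 subr_gt0 exprn_ilt1 ?divr_ge0 ?ltW//.
  by rewrite ltr_pdivrMr// mul1r.
have r12 : r2 < r1.
  rewrite /r1 /r2 ltrD2l ltrN2 ltr_pXn2r ?nnegrE ?divr_ge0 ?ltW//.
  by rewrite ltr_pM2r ?invr_gt0// ltr_pdivrMr// ltr_pMr// ltr1n.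
have r10 := lt_trans r20 r12.
pose I1 : set R := `[x0 - d / 2, x0 + d / 2]%classic.
pose I2 : set R := `[- S, S]%classic.
have bI1 : bounded_supp \1_I1 by exact: bounded_supp_indic.
have bI2 : bounded_supp \1_I2 by exact: bounded_supp_indic.
have bsZ (c : R) g : bounded_supp g -> bounded_supp (fun x => c * g x).
  by apply: bounded_suppM; exact: cst_continuous.
pose P n : {poly R} := (1 - (T^-1 *: ('X - x0%:P)) ^+ 2) ^+ n.
have PE n x : (P n).[x] = q x ^+ n by rewrite /q !hornerE /= mulrC.
(* The values of [q] at distances [d / 2] and [d] are [r1] and [r2]. Within [d / 2] both the kernel
   and [f] are large; between [d / 2] and [d] the integrand is nonnegative; beyond [d] it is at
   least [- B * r2 ^+ n] on the support. The first contribution wins because [r2 < r1]. *)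
have pointwise n x :
    f x0 / 2 * r1 ^+ n * \1_I1 x - B * r2 ^+ n * \1_I2 x <= (P n).[x] * f x.
  rewrite PE; set i2 := \1_I2 x.
  have i20 : 0 <= i2 by exact: ler0n.
  have Br0 : 0 <= B * r2 ^+ n by rewrite mulr_ge0// exprn_ge0// ltW.
  have [xd|xd] := leP `|x - x0| (d / 2).
    have fx : f x0 / 2 <= f x by apply: fd; apply: le_lt_trans xd _; lra.
    have r1q : r1 <= q x by apply: landau_bound => //; rewrite divr_ge0// ltW.
    have -> : \1_I1 x = 1.
      rewrite /indic mem_set//= /I1 /= in_itv/=.
      by move: xd; rewrite ler_norml; lra.
    rewrite mulr1 lerBlDr (@le_trans _ _ (q x ^+ n * f x))//; last first.
      by rewrite lerDl mulr_ge0.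
    have r1n0 : 0 <= r1 ^+ n by rewrite exprn_ge0// ltW.
    have f0 : 0 <= f x0 / 2 by rewrite divr_ge0// ltW.
    rewrite mulrC; apply: ler_pM => //.
    by apply: lerXn2r; rewrite ?nnegrE// ltW// (lt_le_trans r10).
  have -> : \1_I1 x = 0.
    rewrite /indic memNset//= /I1 /= in_itv/=.
    by move: xd; rewrite ltNge ler_norml => /negP + ?; apply; lra.
  rewrite mulr0 sub0r; have [xd'|xd'] := ltP `|x - x0| d.
    apply: (@le_trans _ _ 0); first by rewrite oppr_le0 mulr_ge0.
    have r2q : r2 <= q x by apply: landau_bound => //; rewrite ltW.
    rewrite mulr_ge0 ?exprn_ge0//; first by rewrite ltW// (lt_le_trans r20).
    by rewrite (le_trans _ (fd _ xd'))// divr_ge0// ltW.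
  have [xS|xS] := leP `|x| S; last first.
    by rewrite (fS _ xS) mulr0 oppr_le0 mulr_ge0.
  have -> : i2 = 1.
    by rewrite /i2 /indic mem_set//= /I2 /= in_itv/= -ler_norml.
  have qr2 : q x <= r2 by apply: landau_bound_le => //; exact: ltW.
  have q0 : 0 <= q x.
    have -> : 0 = 1 - (T / T) ^+ 2 :> R by rewrite divff ?gt_eqF// expr1n subrr.
    apply: landau_bound => //; first exact: ltW.
    by apply: le_trans (ler_normB _ _) _; rewrite /T; lra.
  have qn0 : 0 <= q x ^+ n by rewrite exprn_ge0.
  rewrite mulr1 lerNl -mulrN.
  apply: (@le_trans _ _ (q x ^+ n * B)).
    by rewrite ler_wpM2l// (le_trans (ler_norm _))// normrN.
  by rewrite mulrC ler_wpM2l//; apply: lerXn2r; rewrite ?nnegrE// ltW.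
have key n : f x0 / 2 * r1 ^+ n * d - B * r2 ^+ n * (2 * S) <= 0.
  rewrite -[leRHS](poly_integral_eq0 (P n) bf mf).
  have <- : \int[mu]_x \1_I1 x = d.
    by rewrite Rintegral_indic_itv; [field|lra].
  have <- : \int[mu]_x \1_I2 x = 2 * S.
    by rewrite Rintegral_indic_itv; [ring|lra].
  rewrite -!RintegralZl//; try exact: integrable_bounded_supp1.
  rewrite -RintegralB//; try by apply: integrable_bounded_supp1; exact: bsZ.
  apply: le_Rintegral => //.
    apply: integrable_bounded_supp1; apply: bounded_suppD; first exact: bsZ.
    by apply: bounded_suppN; exact: bsZ.
  apply: integrable_bounded_supp1; apply: bounded_suppM => //.
  exact: continuous_horner.
have rlt1 : `|r2 / r1| < 1.
  by rewrite ger0_norm ?divr_ge0 ?ltW// ltr_pdivrMr// mul1r.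
(* Once [(r2 / r1) ^+ n] is below this threshold the inequality [key] fails; the [+ 1] keeps the
   denominator positive. *)
have c0 : 0 < f x0 / 2 * d / (B * (2 * S) + 1).
  rewrite !divr_gt0// ?mulr_gt0// ltr_wpDl// !mulr_ge0//.
have /cvgr_dist_lt /(_ _ c0) := cvg_expr rlt1.
move=> [n _ /(_ n (leqnn n))] /=.
rewrite sub0r normrN normrX ger0_norm ?divr_ge0 ?ltW// => H.
have := key n; rewrite leNgt => /negP; apply.
have r1n : 0 < r1 ^+ n by rewrite exprn_gt0.
have BS0 : 0 <= B * (2 * S) by rewrite !mulr_ge0.
have r2n : 0 <= r2 ^+ n by rewrite exprn_ge0// ltW.
have D0 : 0 < B * (2 * S) + 1 by rewrite ltr_wpDl.
move: H; rewrite expr_div_n ltr_pdivrMr// mulrAC ltr_pdivlMr// => H.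
rewrite subr_gt0; apply: (@le_lt_trans _ _ (r2 ^+ n * (B * (2 * S) + 1))).
  have -> : B * r2 ^+ n * (2 * S) = r2 ^+ n * (B * (2 * S)) by ring.
  by rewrite ler_wpM2l// lerDl.
by rewrite [ltRHS]mulrAC.
Qed.

Lemma moments_eq0 f S : continuous f -> (forall x, S < `|x| -> f x = 0) ->
  (forall n, \int[mu]_x (x ^+ n * f x) = 0) -> forall x, f x = 0.
Proof.
move=> cf fS mf x; apply/eqP; rewrite eq_le (moments_le0 cf fS mf)/=.
rewrite -oppr_le0 (@moments_le0 (fun x => - f x) S)//.
- by move=> y; apply: continuousN; exact: cf.
- by move=> y /fS ->; rewrite oppr0.
move=> n; rewrite -[RHS]oppr0 -(mf n) -mulN1r -RintegralZl//.
  by apply: eq_Rintegral => y _; ring.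
apply: integrable_bounded_supp1; apply: bounded_suppM; first exact: continuous_idX.
exact: continuous_bounded_supp fS.
Qed.

(** At a single frequency [k], the midpoint, all moments of the real and of the imaginary part of
    [exp (- i k x) (f + i g)] vanish, hence so do these two functions; multiplying back by
    [exp (i k x)] isolates [f] and [g]. *)
Lemma trig_integral_unique (a b S : R) f g : a < b ->
  continuous f -> continuous g ->
  (forall x, S < `|x| -> f x = 0) -> (forall x, S < `|x| -> g x = 0) ->
  (forall k, a < k -> k < b -> trig_integral k f g = 0) ->
  (forall k, a < k -> k < b -> trig_integral k g (fun x => - f x) = 0) ->
  forall x, f x = 0 /\ g x = 0.
Proof.
move=> ab cf cg fS gS Hfg Hgf x.
have bf := continuous_bounded_supp cf fS.
have bg := continuous_bounded_supp cg gS.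
pose k := (a + b) / 2; have ak : a < k by rewrite /k; lra.
have kb : k < b by rewrite /k; lra.
have cNf : continuous (fun x => - f x) by move=> y; apply: continuousN; exact: cf.
have trig_continuous u v : continuous u -> continuous v ->
    continuous (fun x => cos (k * x) * u x + sin (k * x) * v x).
  move=> cu cv y; apply: cvgD.
    by apply: cvgM; [exact: continuous_cosM|exact: cu].
  by apply: cvgM; [exact: continuous_sinM|exact: cv].
have trig_moment0 u v : continuous u -> continuous v ->
    (forall n, trig_integral k (fun x => x ^+ n * u x) (fun x => x ^+ n * v x) = 0) ->
    (forall x, S < `|x| -> u x = 0) -> (forall x, S < `|x| -> v x = 0) ->
    cos (k * x) * u x + sin (k * x) * v x = 0.
  move=> cu cv H uS vS.
  apply: (@moments_eq0 (fun x => cos (k * x) * u x + sin (k * x) * v x) S).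
  - exact: trig_continuous.
  - by move=> y yS; rewrite uS// vS// !mulr0 addr0.
  by move=> n; rewrite -[RHS](H n); apply: eq_Rintegral => y _; ring.
have E1 := trig_moment0 f g cf cg (fun n => trig_moments n bf bg Hfg Hgf ak kb) fS gS.
have E2 : cos (k * x) * g x + sin (k * x) * - f x = 0.
  apply: (trig_moment0 g (fun y => - f y)) => //; last by move=> y /fS ->; rewrite oppr0.
  move=> n; apply: (trig_moments n bg (bounded_suppN bf) Hgf _ ak kb).
  move=> k' ak' kb'; rewrite -[RHS]oppr0 -(Hfg k' ak' kb') -mulN1r -RintegralZl//.
    by apply: eq_Rintegral => y _; ring.
  by apply: integrable_bounded_supp1; exact: bounded_supp_trig.
have cs := cos2Dsin2 (k * x).
split.
  rewrite -[LHS]mul1r -cs; transitivity (cos (k * x) *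
     (cos (k * x) * f x + sin (k * x) * g x) -
     sin (k * x) * (cos (k * x) * g x + sin (k * x) * - f x)); first by ring.
  by rewrite E1 E2 !mulr0 subrr.
rewrite -[LHS]mul1r -cs; transitivity (sin (k * x) *
   (cos (k * x) * f x + sin (k * x) * g x) +
   cos (k * x) * (cos (k * x) * g x + sin (k * x) * - f x)); first by ring.
by rewrite E1 E2 !mulr0 addr0.
Qed.
End Landau.

(** * Integrals over parallel lines *)

Section Projection.
Context {R : realType}.
Local Notation mu := (@lebesgue_measure R).
Local Notation plane := (R * R)%type.
Implicit Types (h : plane -> R) (m s t : R).

Definition bounded_supp2 h := measurable_fun setT h /\
  exists B S : R, forall z, `|h z| <= B /\ (h z <> 0 -> `|z.1| <= S /\ `|z.2| <= S).

(** The line of the points with scalar product [s] against [(1, m)], parametrized by the second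
    coordinate. The arc length factor, constant for fixed [m], is left out. *)
Definition line_integral h m s : R := \int[mu]_t h (s - m * t, t).

Lemma integrable_bounded_supp2 h : bounded_supp2 h ->
  (@lebesgue2 R).-integrable setT (EFin \o h).
Proof.
move=> [mh [B [S hBS]]].
apply: (@integrable_bounded_supp _ _ _ (@lebesgue2 R)
  (`[- S, S]%classic `*` `[- S, S]%classic) _ B) => //.
- exact: measurableX.
- pose I : set R := `[- S, S]%classic.
  have mI : measurable I by exact: measurable_itv.
  suff : (mu I * mu I < +oo)%E.
    by rewrite -(product_measure1E mu mu mI mI).
  rewrite /I lebesgue_measure_itv/=.
  by case: ifP => _; rewrite ?mule0// -!EFinB -EFinM ltry.
- by move=> z; case: (hBS z).
- move=> z zS; apply: contrapT => /(proj2 (hBS z)) [z1 z2]; apply: zS.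
  by split; rewrite /= in_itv/= -ler_norml.
Qed.

Lemma measurable_line m s :
  measurable_fun setT (fun t : R => (s - m * t, t) : plane).
Proof.
apply/measurable_fun_pairP; split => /=; last exact: measurable_id.
apply: measurable_funB => //; exact: measurable_funM.
Qed.

Lemma bounded_supp_line h m s : bounded_supp2 h ->
  bounded_supp (fun t => h (s - m * t, t)).
Proof.
move=> [mh [B [S hBS]]]; split.
  exact: (measurableT_comp mh (measurable_line m s)).
exists B, S => t; have [hB hS] := hBS (s - m * t, t); split => // St.
by apply: contrapT => /hS [_] /=; rewrite leNgt St.
Qed.

Lemma line_integral_eq0 h m : bounded_supp2 h ->
  exists S : R, forall s, S < `|s| -> line_integral h m s = 0.
Proof.
move=> [mh [B [S hBS]]]; exists (S + `|m| * S) => s sS.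
rewrite -[RHS](Rintegral_set0 mu (fun=> 0)) [RHS]Rintegral_mkcond.
apply: eq_Rintegral => t _; rewrite patchE in_set0.
apply: contrapT => /(proj2 (hBS _)) /= [h1 h2].
suff : `|s| <= S + `|m| * S by rewrite leNgt sS.
rewrite -[s](subrK (m * t)); apply: le_trans (ler_normD _ _) _.
by apply: lerD => //; rewrite normrM ler_wpM2l.
Qed.

Lemma measurable_shear m :
  measurable_fun setT (fun z : plane => (z.1 - m * z.2, z.2) : plane).
Proof.
apply/measurable_fun_pairP; split => /=; last exact: measurable_snd.
apply: measurable_funB; first exact: measurable_fst.
by apply: measurable_funM => //; exact: measurable_snd.
Qed.

Lemma bounded_suppM2 h (g : plane -> R) : measurable_fun setT g ->
  (forall z, `|g z| <= 1) -> bounded_supp2 h -> bounded_supp2 (fun z => g z * h z).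
Proof.
move=> mg g1 [mh [B [S hBS]]]; split; first exact: measurable_funM.
exists B, S => z; have [hB hS] := hBS z; split.
  by rewrite normrM (le_trans (ler_piMl _ (g1 z))).
by move=> gh0; apply: hS => h0; apply: gh0; rewrite h0 mulr0.
Qed.

Lemma bounded_supp_shear h m : bounded_supp2 h ->
  bounded_supp2 (fun z => h (z.1 - m * z.2, z.2)).
Proof.
move=> [mh [B [S hBS]]]; split.
  exact: (measurableT_comp mh (measurable_shear m)).
exists B, (Num.max (S + `|m| * S) S) => z.
have [hB hS] := hBS (z.1 - m * z.2, z.2); split => // /hS /= [h1 h2].
split; rewrite le_max; last by rewrite h2 orbT.
apply/orP; left.
rewrite -[z.1](subrK (m * z.2)); apply: le_trans (ler_normD _ _) _.
by apply: lerD => //; rewrite normrM ler_wpM2l.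
Qed.

Lemma bounded_supp_section h t : bounded_supp2 h ->
  bounded_supp (fun s => h (s, t)).
Proof.
move=> [mh [B [S hBS]]]; split.
  apply: (measurableT_comp mh); apply: measurable_fun_pair.
    exact: measurable_id.
  exact: measurable_cst.
exists B, S => s; have [hB hS] := hBS (s, t); split => // Ss.
by apply: contrapT => /hS [] /=; rewrite leNgt Ss.
Qed.

(** The shear that sends [y] to [(y.1 + m * y.2, y.2)] preserves area and straightens the family of
    lines. The area is preserved because, for a fixed second coordinate, the shear is a
    translation. *)
Lemma line_integral_shear h m (phi : R -> R) :
  measurable_fun setT phi -> (forall s, `|phi s| <= 1) -> bounded_supp2 h ->
  \int[@lebesgue2 R]_y (phi (y.1 + m * y.2) * h y) =
  \int[mu]_s (phi s * line_integral h m s).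
Proof.
move=> mphi phi1 bh.
pose k (y : plane) := phi (y.1 + m * y.2) * h y.
pose k' (y : plane) := phi y.1 * h (y.1 - m * y.2, y.2).
have bk : bounded_supp2 k.
  apply: bounded_suppM2 => //.
  apply: (measurableT_comp mphi); apply: measurable_funD; first exact: measurable_fst.
  by apply: measurable_funM => //; exact: measurable_snd.
have bk' : bounded_supp2 k'.
  apply: (@bounded_suppM2 (fun z => h (z.1 - m * z.2, z.2)) (fun z => phi z.1)) => //.
    by apply: (measurableT_comp mphi); exact: measurable_fst.
  exact: bounded_supp_shear.
have ik := integrable_bounded_supp2 bk; have ik' := integrable_bounded_supp2 bk'.
rewrite /Rintegral; congr fine.
rewrite /lebesgue2 -(integral21_prod_meas1 ik).
transitivity (\int[mu]_s \int[mu]_t (k' (s, t))%:E)%E; last first.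
  apply: eq_integral => s _.
  have bl := bounded_supp_line m s bh.
  rewrite /k' /=; under eq_integral do rewrite EFinM.
  rewrite integralZl//; last exact: integrable_bounded_supp1.
  rewrite EFinM /line_integral /Rintegral fineK//.
  exact: integrable_fin_num (integrable_bounded_supp1 bl).
(* The order of integration is exchanged only on the sheared side, so that the outer variable is [t]
   on both sides and the inner integrals differ by a translation. *)
rewrite (Fubini ik').
apply: eq_integral => t _; rewrite /fubini_G/=.
have is1 := integrable_bounded_supp1 (bounded_supp_section t bk).
have E := Rintegral_affine (- (m * t)) ltr01 is1.
rewrite invr1 mul1r in E.
have H (s : R) : k (1 * s - m * t, t) = k' (s, t).
  by rewrite /k /k' /= mul1r subrK.
rewrite -[LHS]fineK; last exact: integrable_fin_num.
rewrite -[RHS]fineK; last first.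
  exact: integrable_fin_num (integrable_bounded_supp1 (bounded_supp_section t bk')).
congr EFin; rewrite -/(Rintegral _ _ _) -E.
by apply: eq_Rintegral => s _; rewrite H.
Qed.
(** The phase [k * dot (c, c * m) y] depends only on [y.1 + m * y.2], so that integrating over the
    lines first leaves a one-dimensional Fourier integral at frequency [k * c]. *)
Lemma far_field_line (f : plane -> R[i]) (c k m : R) :
  bounded_supp2 (fun y => complex.Re (f y)) ->
  bounded_supp2 (fun y => complex.Im (f y)) ->
  bounded_supp (line_integral (fun y => complex.Re (f y)) m) ->
  bounded_supp (line_integral (fun y => complex.Im (f y)) m) ->
  let a := line_integral (fun y => complex.Re (f y)) m in
  let b := line_integral (fun y => complex.Im (f y)) m in
  far_field f (c, c * m) k =
    trig_integral (k * c) a b +i* trig_integral (k * c) b (fun s => - a s).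
Proof.
move=> ba bb bla blb a b.
have mcos : measurable_fun setT (fun s : R => cos (k * c * s)).
  by apply: continuous_measurable_fun; exact: continuous_cosM.
have msin : measurable_fun setT (fun s : R => sin (k * c * s)).
  by apply: continuous_measurable_fun; exact: continuous_sinM.
have mline : measurable_fun setT (fun y : plane => y.1 + m * y.2).
  apply: measurable_funD; first exact: measurable_fst.
  by apply: measurable_funM => //; exact: measurable_snd.
have iM (g : plane -> R) (u : R -> R) : bounded_supp2 g -> measurable_fun setT u ->
    (forall s, `|u s| <= 1) ->
    (@lebesgue2 R).-integrable setT (EFin \o (fun y => u (y.1 + m * y.2) * g y)).
  move=> bg mu1 u1; apply: integrable_bounded_supp2; apply: bounded_suppM2 => //.
  exact: (measurableT_comp mu1 mline).
have dotE (y : plane) : k * dot (c, c * m) y = k * c * (y.1 + m * y.2).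
  by rewrite /dot /=; ring.
have cmax s : `|cos (k * c * s)| <= 1 by exact: cos_max.
have smax s : `|sin (k * c * s)| <= 1 by exact: sin_max.
rewrite /far_field /complex_integral; congr (_ +i* _).
- transitivity (\int[@lebesgue2 R]_y
    (cos (k * c * (y.1 + m * y.2)) * complex.Re (f y) +
     sin (k * c * (y.1 + m * y.2)) * complex.Im (f y))).
    apply: eq_Rintegral => y _; rewrite dotE; case: (f y) => u v /=.
    by rewrite cosN sinN; ring.
  rewrite RintegralD//; [|exact: (iM _ _ ba mcos)|exact: (iM _ _ bb msin)].
  rewrite (line_integral_shear m mcos)// (line_integral_shear m msin)//.
  rewrite -RintegralD//; apply: integrable_bounded_supp1; apply: bounded_suppM => //.
    exact: continuous_cosM.
  exact: continuous_sinM.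
- transitivity (\int[@lebesgue2 R]_y
    (cos (k * c * (y.1 + m * y.2)) * complex.Im (f y) -
     sin (k * c * (y.1 + m * y.2)) * complex.Re (f y))).
    apply: eq_Rintegral => y _; rewrite dotE; case: (f y) => u v /=.
    by rewrite cosN sinN; ring.
  rewrite RintegralB//; [|exact: (iM _ _ bb mcos)|exact: (iM _ _ ba msin)].
  rewrite (line_integral_shear m mcos)// (line_integral_shear m msin)//.
  rewrite -RintegralB//; try (apply: integrable_bounded_supp1; apply: bounded_suppM => //).
  - by apply: eq_Rintegral => s _; rewrite mulrN.
  - exact: continuous_cosM.
  - exact: continuous_sinM.
Qed.

Lemma trig_integralB (k : R) (a b a' b' : R -> R) : bounded_supp a -> bounded_supp b ->
  bounded_supp a' -> bounded_supp b' ->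
  trig_integral k (fun s => a s - a' s) (fun s => b s - b' s) =
  trig_integral k a b - trig_integral k a' b'.
Proof.
move=> ba bb ba' bb'; rewrite /trig_integral -RintegralB//.
- by apply: eq_Rintegral => s _; ring.
- by apply: integrable_bounded_supp1; exact: bounded_supp_trig.
- by apply: integrable_bounded_supp1; exact: bounded_supp_trig.
Qed.

Lemma line_integral_unique (f g : plane -> R[i]) (c m kmin kmax : R) :
  0 < c -> kmin < kmax ->
  bounded_supp2 (fun y => complex.Re (f y)) ->
  bounded_supp2 (fun y => complex.Im (f y)) ->
  bounded_supp2 (fun y => complex.Re (g y)) ->
  bounded_supp2 (fun y => complex.Im (g y)) ->
  continuous (line_integral (fun y => complex.Re (f y)) m) ->
  continuous (line_integral (fun y => complex.Im (f y)) m) ->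
  continuous (line_integral (fun y => complex.Re (g y)) m) ->
  continuous (line_integral (fun y => complex.Im (g y)) m) ->
  (forall k, kmin < k -> k < kmax ->
     far_field g (c, c * m) k = far_field f (c, c * m) k) ->
  forall s,
  line_integral (fun y => complex.Re (f y)) m s =
    line_integral (fun y => complex.Re (g y)) m s /\
  line_integral (fun y => complex.Im (f y)) m s =
    line_integral (fun y => complex.Im (g y)) m s.
Proof.
move=> c0 kk bfr bfi bgr bgi cfr cfi cgr cgi H s.
have [S1 S1P] := line_integral_eq0 m bfr.
have [S2 S2P] := line_integral_eq0 m bfi.
have [S3 S3P] := line_integral_eq0 m bgr.
have [S4 S4P] := line_integral_eq0 m bgi.
have b1 := continuous_bounded_supp cfr S1P.
have b2 := continuous_bounded_supp cfi S2P.
have b3 := continuous_bounded_supp cgr S3P.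
have b4 := continuous_bounded_supp cgi S4P.
set a := line_integral _ m in cfr S1P b1 *.
set b := line_integral (fun y => complex.Im (f y)) m in cfi S2P b2 *.
set a' := line_integral (fun y => complex.Re (g y)) m in cgr S3P b3 *.
set b' := line_integral (fun y => complex.Im (g y)) m in cgi S4P b4 *.
pose S := Num.max (Num.max S1 S2) (Num.max S3 S4).
have HS x : S < `|x| -> [/\ S1 < `|x|, S2 < `|x|, S3 < `|x| & S4 < `|x|].
  by rewrite !gt_max => /andP[/andP[-> ->] /andP[-> ->]].
have H' k : kmin * c < k -> k < kmax * c ->
    trig_integral k a b = trig_integral k a' b' /\
    trig_integral k b (fun s => - a s) = trig_integral k b' (fun s => - a' s).
  move=> k1 k2.
  have ck : k / c * c = k by rewrite divfK ?gt_eqF.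
  have K1 : kmin < k / c by rewrite ltr_pdivlMr; [exact: k1|exact: c0].
  have K2 : k / c < kmax by rewrite ltr_pdivrMr; [exact: k2|exact: c0].
  have := H (k / c) K1 K2.
  rewrite (far_field_line c (k / c) bfr bfi b1 b2).
  rewrite (far_field_line c (k / c) bgr bgi b3 b4) ck.
  by case=> E1 E2; split; [exact: esym E1|exact: esym E2].
have kkc : kmin * c < kmax * c by rewrite ltr_pM2r.
have [] := @trig_integral_unique R _ _ S (fun s => a s - a' s) (fun s => b s - b' s)
  kkc _ _ _ _ _ _ s.
- by move=> x; apply: cvgB; [exact: cfr|exact: cgr].
- by move=> x; apply: cvgB; [exact: cfi|exact: cgi].
- by move=> x /HS[x1 x2 x3 x4]; rewrite S1P// S3P// subrr.
- by move=> x /HS[x1 x2 x3 x4]; rewrite S2P// S4P// subrr.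
- move=> k k1 k2; rewrite trig_integralB//.
  by have [-> _] := H' k k1 k2; rewrite subrr.
- move=> k k1 k2.
  transitivity (trig_integral k (fun s => b s - b' s) (fun s => - a s - - a' s)).
    by apply: eq_Rintegral => x _; ring.
  rewrite trig_integralB//; try exact: bounded_suppN.
  by have [_ ->] := H' k k1 k2; rewrite subrr.
by move=> /eqP; rewrite subr_eq0 => /eqP-> /eqP; rewrite subr_eq0 => /eqP->.
Qed.

End Projection.

(** * Polygonal sets near a boundary point *)

Section PlaneGeometry.
Context {R : realType}.
Local Notation plane := (R * R)%type.
Implicit Types (A : set plane) (a b d n u w x y z P : plane) (r s t e : R).

Definition cross a b : R := a.1 * b.2 - a.2 * b.1.

(** The ball of the maximum norm around the origin. Local statements at [P] are written for the
    displacement [w] from [P], on which the cones and half-planes act. *)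
Definition box r : set plane := [set w | `|w.1| < r /\ `|w.2| < r].

Lemma cross_perp a b : dot (perp a) b = cross a b.
Proof. by rewrite /dot /perp /cross /=; ring. Qed.

Lemma planeP a b : a.1 = b.1 -> a.2 = b.2 -> a = b.
Proof. by case: a => a1 a2; case: b => b1 b2 /= -> ->. Qed.

Let fstD a b : (a + b).1 = a.1 + b.1. Proof. by []. Qed.
Let sndD a b : (a + b).2 = a.2 + b.2. Proof. by []. Qed.
Let fstN a : (- a).1 = - a.1. Proof. by []. Qed.
Let sndN a : (- a).2 = - a.2. Proof. by []. Qed.
Let fstZ t a : (t *: a).1 = t * a.1. Proof. by []. Qed.
Let sndZ t a : (t *: a).2 = t * a.2. Proof. by []. Qed.
Definition planeE := (fstD, sndD, fstN, sndN, fstZ, sndZ).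

Lemma box_small u r : 0 < r ->
  exists2 e, 0 < e & forall t, 0 <= t < e -> box r (t *: u).
Proof.
move=> r0; pose U : R := `|u.1| + `|u.2| + 1.
have U0 : 0 < U by rewrite /U ltr_wpDl// addr_ge0.
exists (r / U); first by rewrite divr_gt0.
move=> t /andP[t0 tk]; have tU : t * U < r by rewrite -ltr_pdivlMr.
split; rewrite planeE normrM (ger0_norm t0); apply: le_lt_trans tU; apply: ler_wpM2l => //.
  by rewrite /U -addrA lerDl addr_ge0.
by rewrite /U addrAC lerDr addr_ge0.
Qed.

Lemma box_open w r : box r w ->
  exists2 q, 0 < q & forall w', box q w' -> box r (w + w').
Proof.
move=> [w1 w2]; exists (Num.min (r - `|w.1|) (r - `|w.2|)).
  by rewrite lt_min !subr_gt0 w1.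
move=> w' []; rewrite !lt_min => /andP[h1 _] /andP[_ h2].
split; rewrite planeE (le_lt_trans (ler_normD _ _))//; first by rewrite -ltrBrDl.
by rewrite -ltrBrDl.
Qed.

Lemma box_le r q w : r <= q -> box r w -> box q w.
Proof. by move=> rq [w1 w2]; split; [exact: lt_le_trans w1 _|exact: lt_le_trans w2 _]. Qed.

Lemma boxN r w : box r w -> box r (- w).
Proof. by move=> [w1 w2]; split; rewrite planeE normrN. Qed.

Lemma nbhs_boxP P (U : set plane) :
  nbhs P U <-> exists2 r : R, 0 < r & forall w, box r w -> U (P + w).
Proof.
split=> [/nbhs_ballP[r /= r0 PU]|[r r0 PU]].
  exists r => // w [w1 w2]; apply: PU; split; rewrite /ball/=.
    by rewrite opprD addNKr normrN.
  by rewrite opprD addNKr normrN.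
apply/nbhs_ballP; exists r => // z [z1 z2].
rewrite -(subrK P z) addrC; apply: PU; split => /=.
  by rewrite distrC.
by rewrite distrC.
Qed.

Lemma boundary_sub A : closed A -> boundary A `<=` A.
Proof. by move=> cA z [/cA]. Qed.

Lemma path_continuous a d : continuous (fun t : R => a + t *: d).
Proof.
move=> t; apply: cvgD; first exact: cvg_cst.
by apply: cvgZr_tmp; exact: cvg_id.
Qed.

Lemma segment_closed a b : closed (segment a b).
Proof.
apply: compact_closed; first exact: norm_hausdorff.
apply: continuous_compact; last exact: segment_compact.
by apply: continuous_subspaceT; exact: path_continuous.
Qed.

(** Off the boundary, [A], its interior and its closure have the same points, so that the parameters
    whose point lies in [A] form a relatively open and closed part of the unit interval. *)
Lemma same_side A a d :
  (forall t, 0 <= t <= 1 -> ~ boundary A (a + t *: d)) ->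
  A a -> A (a + d).
Proof.
move=> nb Aa.
pose g t := a + t *: d.
have cg : continuous g by exact: path_continuous.
pose B : set R := `[0, 1]%classic `&` (g @^-1` A).
suff BE : B = `[0, 1]%classic.
  have : B 1 by rewrite BE /= in_itv/= ler01 lexx.
  by move=> [_]; rewrite /g /= scale1r.
apply: (@segment_connected R 0 1).
- by exists 0; split; rewrite /= ?in_itv/= ?lexx ?ler01// /g scale0r addr0.
- exists (g @^-1` (interior A)).
    by apply: open_comp => [t _|]; [exact: cg|exact: open_interior].
  apply/seteqP; split => t [t01 At]; split => //=; last exact: interior_subset.
  apply: contrapT => iA; apply: (nb t); first by move: t01; rewrite /= in_itv.
  by split => //; exact: subset_closure.
- exists (g @^-1` (closure A)).
    by apply: closed_comp => [t _|]; [exact: cg|exact: closed_closure].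
  apply/seteqP; split => t [t01 At]; split => //=; first exact: subset_closure.
  apply: interior_subset; apply: contrapT => iA.
  by apply: (nb t); first by move: t01; rewrite /= in_itv.
Qed.

Lemma same_sideP A a b :
  (forall t, 0 <= t <= 1 -> ~ boundary A (a + t *: (b - a))) -> A a <-> A b.
Proof.
move=> nb; split => [Aa|Ab].
  by rewrite -(subrK a b) addrC; exact: same_side Aa.
rewrite -(subrK b a) addrC; apply: same_side Ab => t /andP[t0 t1].
have -> : b + t *: (a - b) = a + (1 - t) *: (b - a).
  by apply: planeP; rewrite !planeE; ring.
by apply: nb; rewrite subr_ge0 t1 lerBlDr lerDl.
Qed.

(* Both cells cannot lie in [A], because [P] would be an interior point, nor
   both outside of [A], because [A] is regular closed. *)
Lemma two_cells A P r (K1 K2 : set plane) u w1 w2 :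
  closed A -> A `<=` closure (interior A) -> boundary A P -> 0 < r ->
  box r w1 -> box r w2 ->
  (forall w, box r w -> K1 w -> (A (P + w1) <-> A (P + w))) ->
  (forall w, box r w -> K2 w -> (A (P + w2) <-> A (P + w))) ->
  (forall w e, ~ K1 w -> ~ K2 w -> 0 < e -> K1 (w + e *: u)) ->
  exists sg : bool, forall w, box r w ->
    (K1 w -> (A (P + w) <-> sg)) /\ (K2 w -> (A (P + w) <-> ~~ sg)).
Proof.
move=> cA AiA bP r0 w1r w2r HK1 HK2 HK.
have shrink w : box r w -> exists2 e : R, 0 < e & forall t, 0 <= t < e -> box r (w + t *: u).
  move=> /box_open[q q0 wq]; have [e e0 he] := box_small u q0.
  by exists e => // t /he /wq.
have [A1|A1] := pselect (A (P + w1)); have [A2|A2] := pselect (A (P + w2)).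
- exfalso; have [_ iP] := bP; apply: iP; apply/nbhs_boxP; exists r => // w wr.
  have [|nK1] := pselect (K1 w); first by move/(HK1 _ wr) => <-.
  have [|nK2] := pselect (K2 w); first by move/(HK2 _ wr) => <-.
  (* Here [w] lies in neither cell; small shifts along [u] bring it into [K1], thus into [A], and
     [A] is closed. *)
  apply: cA => U /nbhs_boxP[q q0 PU].
  have [e e0 he] := shrink w wr.
  have [e' e'0 he'] := box_small u q0.
  pose t := Num.min e e' / 2.
  have m0 : 0 < Num.min e e' by rewrite lt_min e0.
  have t0 : 0 < t by rewrite /t divr_gt0.
  have tm : t < Num.min e e' by rewrite /t; lra.
  move: (tm); rewrite lt_min => /andP[te te'].
  exists (P + (w + t *: u)); split; last first.
    by rewrite addrA; apply: PU; apply: he'; rewrite ltW.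
  by apply/(HK1 (w + t *: u)) => //; [apply: he; rewrite ltW|exact: HK].
- exists true => w wr; split => [/(HK1 _ wr) <-|/(HK2 _ wr) <-] //.
- exists false => w wr; split => [/(HK1 _ wr) <-|/(HK2 _ wr) <-] //.
- exfalso; have : closure (interior A) P by apply: AiA; exact: boundary_sub bP.
  have nP : nbhs P [set z | box r (z - P)].
    by apply/nbhs_boxP; exists r => // w wr; rewrite /= addrC addKr.
  move=> /(_ _ nP) [z [iz zr]].
  set w := z - P in zr; have zE : z = P + w by rewrite /w addrC subrK.
  have Az := interior_subset iz; rewrite zE in Az iz.
  have [|nK1] := pselect (K1 w); first by move/(HK1 _ zr) => [_ /(_ Az)].
  have [|nK2] := pselect (K2 w); first by move/(HK2 _ zr) => [_ /(_ Az)].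
  have /nbhs_boxP[q q0 PU] := open_nbhs_nbhs (conj (@open_interior _ A) iz).
  have [e e0 he] := shrink w zr; have [e' e'0 he'] := box_small u q0.
  pose t := Num.min e e' / 2.
  have m0 : 0 < Num.min e e' by rewrite lt_min e0.
  have t0 : 0 < t by rewrite /t divr_gt0.
  have tm : t < Num.min e e' by rewrite /t; lra.
  move: (tm); rewrite lt_min => /andP[te te'].
  (* An interior point in neither cell can be moved into [K1] without leaving [A], although [K1]
     misses [A]. *)
  apply: A1; apply/(HK1 (w + t *: u)); [by apply: he; rewrite ltW|exact: HK|].
  rewrite addrA; apply: interior_subset; apply: PU; apply: he'.
  by rewrite ltW.
Qed.

End PlaneGeometry.

Section Polygonal.
Context {R : realType}.
Local Notation plane := (R * R)%type.
Implicit Types (A : set plane) (a b d n u w y z P : plane) (r s t e : R).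

(** The permutation [nx] may have several cycles, so that one vertex type describes all polylines of
    all components, holes included. *)
Definition polygonal (V : finType) (v : V -> plane) (nx : V -> V) A : Prop :=
  [/\ closed A, A = closure (interior A),
      injective v /\ injective nx,
      forall i, cross (v (nx i) - v i) (v (nx (nx i)) - v (nx i)) != 0 &
      (forall i j, i != j ->
         segment (v i) (v (nx i)) `&` segment (v j) (v (nx j)) `<=`
         [set v i; v (nx i)] `&` [set v j; v (nx j)]) /\
      boundary A = \bigcup_i segment (v i) (v (nx i))].

Lemma segment_l a b : segment a b a.
Proof. by exists 0; rewrite /= ?in_itv/= ?lexx ?ler01// scale0r addr0. Qed.

Lemma segmentC a b : segment a b = segment b a.
Proof.
suff H c d : segment c d `<=` segment d c by apply/seteqP; split; exact: H.
move=> _ [t /= /[!in_itv]/= /andP[t0 t1] <-]; exists (1 - t).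
  by rewrite /= in_itv/= subr_ge0 t1 lerBlDr lerDl.
by apply: planeP; rewrite !planeE; ring.
Qed.

Lemma crossC a b : cross a b = - cross b a.
Proof. by rewrite /cross; ring. Qed.

(** With [coord2], the coordinates of [w] in the basis [d1], [d2], by Cramer's rule. *)
Definition coord1 d1 d2 w : R := cross w d2 / cross d1 d2.
Definition coord2 d1 d2 w : R := cross d1 w / cross d1 d2.

Definition wedge d1 d2 : set plane :=
  [set w | 0 < coord1 d1 d2 w /\ 0 < coord2 d1 d2 w].

(** The complement of the closed convex sector: the two bounding rays belong neither to [wedge] nor
    to [cowedge]. *)
Definition cowedge d1 d2 : set plane :=
  [set w | coord1 d1 d2 w < 0 \/ coord2 d1 d2 w < 0].

Lemma coord1_lin d1 d2 w w' t :
  coord1 d1 d2 (w + t *: w') = coord1 d1 d2 w + t * coord1 d1 d2 w'.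
Proof. by rewrite /coord1 /cross !planeE; ring. Qed.

Lemma coord2_lin d1 d2 w w' t :
  coord2 d1 d2 (w + t *: w') = coord2 d1 d2 w + t * coord2 d1 d2 w'.
Proof. by rewrite /coord2 /cross !planeE; ring. Qed.

Lemma coord1_diag d1 d2 : cross d1 d2 != 0 -> coord1 d1 d2 (d1 + d2) = 1.
Proof.
move=> c0; rewrite /coord1 (_ : cross (d1 + d2) d2 = cross d1 d2) ?divff//.
by rewrite /cross !planeE; ring.
Qed.

Lemma coord2_diag d1 d2 : cross d1 d2 != 0 -> coord2 d1 d2 (d1 + d2) = 1.
Proof.
move=> c0; rewrite /coord2 (_ : cross d1 (d1 + d2) = cross d1 d2) ?divff//.
by rewrite /cross !planeE; ring.
Qed.

Lemma box_convex r w w' t : box r w -> box r w' -> 0 <= t <= 1 ->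
  box r (w + t *: (w' - w)).
Proof.
move=> [h1 h2] [h1' h2'] /andP[t0 t1].
have H (x x' : R) : `|x| < r -> `|x'| < r -> `|x + t * (x' - x)| < r.
  rewrite !ltr_norml => /andP[a1 a2] /andP[b1 b2].
  have -> : x + t * (x' - x) = (1 - t) * x + t * x' by ring.
  have [->|tn0] := eqVneq t 0; first by rewrite subr0 mul1r mul0r addr0 a1.
  have tp : 0 < t by rewrite lt_def tn0.
  have t1' : 0 <= 1 - t by rewrite subr_ge0.
  have e1 : (1 - t) * - r <= (1 - t) * x by rewrite ler_wpM2l// ltW.
  have e2 : t * - r < t * x' by rewrite ltr_pM2l.
  have e3 : (1 - t) * x <= (1 - t) * r by rewrite ler_wpM2l// ltW.
  have e4 : t * x' < t * r by rewrite ltr_pM2l.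
  by apply/andP; split; lra.
by split; rewrite !planeE; exact: H.
Qed.

Lemma pos_convex (x x' t : R) : 0 < x -> 0 < x' -> 0 <= t <= 1 ->
  0 < x + t * (x' - x).
Proof.
move=> x0 x'0 /andP[t0 t1].
have -> : x + t * (x' - x) = (1 - t) * x + t * x' by ring.
have [->|tn0] := eqVneq t 0; first by rewrite subr0 mul1r mul0r addr0.
by rewrite ltr_wpDl ?mulr_ge0 ?subr_ge0 ?(ltW x0)// mulr_gt0// lt_def tn0.
Qed.

Lemma cell_same A P r (K : set plane) :
  (forall w, box r w -> K w -> ~ boundary A (P + w)) ->
  (forall w w' t, K w -> K w' -> 0 <= t <= 1 -> K (w + t *: (w' - w))) ->
  forall w w', box r w -> box r w' -> K w -> K w' -> A (P + w) <-> A (P + w').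
Proof.
move=> nb cK w w' wr wr' Kw Kw'; apply: same_sideP => t t01.
have -> : P + w + t *: (P + w' - (P + w)) = P + (w + t *: (w' - w)).
  by apply: planeP; rewrite !planeE; ring.
by apply: nb; [exact: box_convex|exact: cK].
Qed.

Lemma wedge_cells A P r d1 d2 : cross d1 d2 != 0 ->
  closed A -> A `<=` closure (interior A) -> boundary A P -> 0 < r ->
  (forall w, box r w -> boundary A (P + w) ->
     exists2 t, 0 <= t & w = t *: d1 \/ w = t *: d2) ->
  exists sg : bool, forall w, box r w ->
    (wedge d1 d2 w -> (A (P + w) <-> sg)) /\
    (cowedge d1 d2 w -> (A (P + w) <-> ~~ sg)).
Proof.
move=> c0 cA AiA bP r0 bdr; pose u := d1 + d2.
have [e e0 he] := box_small u r0.
have [e' e'0 he'] := box_small (- u) r0.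
have eh (q : R) : 0 < q -> 0 <= q / 2 < q by move=> q0; apply/andP; split; lra.
have u1 : coord1 d1 d2 u = 1 by exact: coord1_diag.
have u2 : coord2 d1 d2 u = 1 by exact: coord2_diag.
have c1N w : coord1 d1 d2 (- w) = - coord1 d1 d2 w.
  by rewrite /coord1 /cross !planeE; ring.
have c2N w : coord2 d1 d2 (- w) = - coord2 d1 d2 w.
  by rewrite /coord2 /cross !planeE; ring.
have c1Z w t : coord1 d1 d2 (t *: w) = t * coord1 d1 d2 w.
  by rewrite /coord1 /cross !planeE; ring.
have c2Z w t : coord2 d1 d2 (t *: w) = t * coord2 d1 d2 w.
  by rewrite /coord2 /cross !planeE; ring.
have off w : box r w -> (coord1 d1 d2 w != 0 /\ coord2 d1 d2 w != 0) \/
    (coord1 d1 d2 w < 0) \/ (coord2 d1 d2 w < 0) -> ~ boundary A (P + w).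
  move=> wr H /(bdr w wr)[t t0 wE].
  have [[E1 E2]|[E1 E2]] : (coord1 d1 d2 w = t /\ coord2 d1 d2 w = 0) \/
      (coord1 d1 d2 w = 0 /\ coord2 d1 d2 w = t).
    case: wE => ->; [left|right]; rewrite c1Z c2Z /coord1 /coord2.
      rewrite divff// mulr1; split => //.
      by rewrite (_ : cross d1 d1 = 0) ?mul0r ?mulr0// /cross; ring.
    rewrite divff// mulr1; split => //.
    by rewrite (_ : cross d2 d2 = 0) ?mul0r ?mulr0// /cross; ring.
  - move: H; rewrite E1 E2 eqxx ltxx; case=> [[]//|[]//]; by rewrite ltNge t0.
  - move: H; rewrite E1 E2 eqxx ltxx; case=> [[]//|[]//]; by rewrite ltNge t0.
have H1 (w w' : plane) : box r w -> box r w' -> coord1 d1 d2 w < 0 ->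
    coord1 d1 d2 w' < 0 -> A (P + w) <-> A (P + w').
  move=> wr wr' h h'; apply: (@cell_same A P r (fun w => coord1 d1 d2 w < 0)) => //.
    by move=> x xr xK; apply: off => //; right; left.
  move=> x x' t; rewrite -!oppr_gt0 -!c1N => hx hx' t01.
  have -> : - (x + t *: (x' - x)) = - x + t *: (- x' - - x).
    by apply: planeP; rewrite !planeE; ring.
  rewrite coord1_lin; have -> : coord1 d1 d2 (- x' - - x) = coord1 d1 d2 (- x') - coord1 d1 d2 (- x).
    by rewrite /coord1 /cross !planeE; ring.
  exact: pos_convex.
have H2 (w w' : plane) : box r w -> box r w' -> coord2 d1 d2 w < 0 ->
    coord2 d1 d2 w' < 0 -> A (P + w) <-> A (P + w').
  move=> wr wr' h h'; apply: (@cell_same A P r (fun w => coord2 d1 d2 w < 0)) => //.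
    by move=> x xr xK; apply: off => //; right; right.
  move=> x x' t; rewrite -!oppr_gt0 -!c2N => hx hx' t01.
  have -> : - (x + t *: (x' - x)) = - x + t *: (- x' - - x).
    by apply: planeP; rewrite !planeE; ring.
  rewrite coord2_lin; have -> : coord2 d1 d2 (- x' - - x) = coord2 d1 d2 (- x') - coord2 d1 d2 (- x).
    by rewrite /coord2 /cross !planeE; ring.
  exact: pos_convex.
have w1r : box r ((e / 2) *: u) by apply: he; exact: eh.
(* The cowedge is not convex, but it is the union of two half-planes; this reference point lies in
   both and links them. *)
have w2r : box r ((e' / 2) *: - u) by apply: he'; exact: eh.
have e20 : 0 < e / 2 by rewrite divr_gt0.
have e'20 : 0 < e' / 2 by rewrite divr_gt0.
apply: (@two_cells _ A P r (wedge d1 d2) (cowedge d1 d2) u _ _ cA AiA bP r0 w1r w2r).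
- move=> w wr Kw; apply: (@cell_same A P r (wedge d1 d2)) => //.
  + move=> x xr [x1 x2]; apply: off => //; left; split; exact: lt0r_neq0.
  + move=> x x' t [x1 x2] [x1' x2'] t01; split; rewrite ?coord1_lin ?coord2_lin.
      have -> : coord1 d1 d2 (x' - x) = coord1 d1 d2 x' - coord1 d1 d2 x.
        by rewrite /coord1 /cross !planeE; ring.
      exact: pos_convex.
    have -> : coord2 d1 d2 (x' - x) = coord2 d1 d2 x' - coord2 d1 d2 x.
      by rewrite /coord2 /cross !planeE; ring.
    exact: pos_convex.
  + by split; rewrite ?c1Z ?c2Z ?u1 ?u2 mulr1.
- move=> w wr [Kw|Kw]; [apply: H1 => //|apply: H2 => //].
    by rewrite c1Z c1N u1 mulrN1 oppr_lt0.
  by rewrite c2Z c2N u2 mulrN1 oppr_lt0.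
- move=> w t nK1 nK2 t0; split; rewrite ?coord1_lin ?coord2_lin ?u1 ?u2 mulr1.
    rewrite ltr_wpDl// leNgt; apply/negP => h; by apply: nK2; left.
  by rewrite ltr_wpDl// leNgt; apply/negP => h; apply: nK2; right.
Qed.

Lemma side_cells A P r d : d != 0 ->
  closed A -> A `<=` closure (interior A) -> boundary A P -> 0 < r ->
  (forall w, box r w -> boundary A (P + w) -> cross d w = 0) ->
  exists sg : bool, forall w, box r w ->
    (0 < cross d w -> (A (P + w) <-> sg)) /\
    (cross d w < 0 -> (A (P + w) <-> ~~ sg)).
Proof.
move=> d0 cA AiA bP r0 bdr; pose u := perp d.
have [e e0 he] := box_small u r0.
have [e' e'0 he'] := box_small (- u) r0.
have eh (q : R) : 0 < q -> 0 <= q / 2 < q by move=> q0; apply/andP; split; lra.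
have uP : 0 < cross d u.
  rewrite /u /cross /perp/= mulrN opprK -!expr2.
  rewrite lt_def addr_ge0 ?sqr_ge0// andbT paddr_eq0 ?sqr_ge0// !sqrf_eq0.
  apply/negP => /andP[/eqP h1 /eqP h2]; move/eqP: d0; apply.
  exact: planeP.
have cZ w t : cross d (t *: w) = t * cross d w by rewrite /cross !planeE; ring.
have cN w : cross d (- w) = - cross d w by rewrite /cross !planeE; ring.
have cD w w' t : cross d (w + t *: w') = cross d w + t * cross d w'.
  by rewrite /cross !planeE; ring.
have cB w w' : cross d (w - w') = cross d w - cross d w'.
  by rewrite /cross !planeE; ring.
have w1r : box r ((e / 2) *: u) by apply: he; exact: eh.
have w2r : box r ((e' / 2) *: - u) by apply: he'; exact: eh.
have e20 : 0 < e / 2 by rewrite divr_gt0.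
have e'20 : 0 < e' / 2 by rewrite divr_gt0.
apply: (@two_cells _ A P r (fun w => 0 < cross d w) (fun w => cross d w < 0)
   u _ _ cA AiA bP r0 w1r w2r).
- move=> w wr Kw; apply: (@cell_same A P r (fun w => 0 < cross d w)) => //.
  + by move=> x xr h /(bdr _ xr) E; rewrite E ltxx in h.
  + by move=> x x' t hx hx' t01; rewrite cD cB; exact: pos_convex.
  + by rewrite cZ mulr_gt0.
- move=> w wr Kw; apply: (@cell_same A P r (fun w => cross d w < 0)) => //.
  + by move=> x xr h /(bdr _ xr) E; rewrite E ltxx in h.
  + move=> x x' t; rewrite -!oppr_gt0 -!cN => hx hx' t01.
    have -> : - (x + t *: (x' - x)) = - x + t *: (- x' - - x).
      by apply: planeP; rewrite !planeE; ring.
    by rewrite cD [cross d (- x' - _)]cB; exact: pos_convex.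
  + by rewrite cZ cN mulrN oppr_lt0 mulr_gt0.
- move=> w t /negP; rewrite -leNgt => h1 /negP; rewrite -leNgt => h2 t0.
  by rewrite cD ltr_wpDl// mulr_gt0.
Qed.

End Polygonal.

Section PolygonalLocal.
Context {R : realType} (V : finType) (v : V -> R * R) (nx : V -> V) (A : set (R * R)).
Local Notation plane := (R * R)%type.
Implicit Types (a b d n u w y z P : plane) (r s t e : R) (i j k : V).
Hypothesis pA : polygonal v nx A.

Let cA : closed A. Proof. by case: pA. Qed.
Let AE : A = closure (interior A). Proof. by case: pA. Qed.
Let AiA : A `<=` closure (interior A). Proof. by rewrite -AE. Qed.
Let v_inj : injective v. Proof. by case: pA => _ _ []. Qed.
Let nx_inj : injective nx. Proof. by case: pA => _ _ []. Qed.
Let turn i : cross (v (nx i) - v i) (v (nx (nx i)) - v (nx i)) != 0.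
Proof. by case: pA. Qed.
Local Notation side i := (segment (v i) (v (nx i))).
Let bE : boundary A = \bigcup_i side i. Proof. by case: pA => _ _ _ _ []. Qed.

Lemma nx_surj i : exists j, nx j = i.
Proof. by have [p _ nxK] := injF_bij nx_inj; exists (p i); rewrite nxK. Qed.

Lemma side_neq i : v (nx i) - v i != 0.
Proof.
apply: contraNneq (turn i) => ->.
by rewrite /cross /= !mul0r subrr.
Qed.

Lemma side_boundary i : side i `<=` boundary A.
Proof. by rewrite bE => z zi; exists i. Qed.

Lemma vertex_side i j : side j (v i) -> j = i \/ nx j = i.
Proof.
move=> ij; have [->|ji] := eqVneq j i; first by left.
have [_ _ _ _ [H _]] := pA.
have [+ _] := H _ _ ji (v i) (conj ij (segment_l _ _)).
by case=> /v_inj ->; [left|right].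
Qed.

(** The sides are closed and finite in number, so that those which miss [P] also miss a
    neighbourhood of it. *)
Lemma boundary_near P : exists2 r : R, 0 < r & forall w, box r w ->
  boundary A (P + w) -> exists2 i, side i P & side i (P + w).
Proof.
have : \forall z \near P, forall i, ~ side i P -> ~ side i z.
  apply: (@filter_forall _ V (fun i z => ~ side i P -> ~ side i z) (nbhs P)) => i.
  have [Pi|nPi] := pselect (side i P).
    by near=> z.
  have h := open_nbhs_nbhs (conj (closed_openC (@segment_closed R (v i) (v (nx i)))) nPi).
  by near=> z => _; near: z; exact: h.
move=> /nbhs_boxP[r r0 H]; exists r => // w wr.
rewrite bE => -[i _ iw]; exists i => //; apply: contrapT => nPi.
exact: H nPi iw.
Unshelve. all: by end_near. Qed.

Lemma vertex_cross i j : nx j = i -> cross (v (nx i) - v i) (v j - v i) != 0.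
Proof.
move=> <-; have := turn j; apply: contraNneq => <-.
by apply/eqP; rewrite /cross !planeE; ring.
Qed.

(** The bit [sg] is true at a vertex with interior angle below [pi], and false at a reflex one. *)
Lemma vertex_cells i j : nx j = i ->
  exists sg : bool, exists2 r : R, 0 < r & forall w, box r w ->
    (wedge (v (nx i) - v i) (v j - v i) w -> (A (v i + w) <-> sg)) /\
    (cowedge (v (nx i) - v i) (v j - v i) w -> (A (v i + w) <-> ~~ sg)).
Proof.
move=> ji; have [r r0 H] := boundary_near (v i).
have bi : boundary A (v i) by apply: (@side_boundary i); exact: segment_l.
have [|sg Hsg] := wedge_cells (vertex_cross ji) cA AiA bi r0; last first.
  by exists sg, r.
move=> w wr /(H _ wr) [k /vertex_side ki [t /= /[!in_itv]/= /andP[t0 t1] E]].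
have {}E : w = v k + t *: (v (nx k) - v k) - v i by rewrite E addrC addKr.
case: ki => ki.
  by exists t => //; left; rewrite E ki addrC addKr.
have {ki} kj : k = j by apply: nx_inj; rewrite ki ji.
exists (1 - t); first by rewrite subr_ge0.
by right; rewrite E kj ji; apply: planeP; rewrite !planeE; ring.
Qed.

Lemma open_side_cells i t : 0 < t < 1 ->
  let d := v (nx i) - v i in let P := v i + t *: d in
  exists sg : bool, exists2 r : R, 0 < r & forall w, box r w ->
    (boundary A (P + w) -> cross d w = 0) /\
    ((0 < cross d w -> (A (P + w) <-> sg)) /\
    (cross d w < 0 -> (A (P + w) <-> ~~ sg))).
Proof.
move=> /andP[t0 t1] d P; have [r r0 H] := boundary_near P.
have Pi : side i P by exists t => //; rewrite /= in_itv/= !ltW.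
have bP : boundary A P by exact: side_boundary Pi.
have dn0 : d != 0 by exact: side_neq.
have bdr w : box r w -> boundary A (P + w) -> cross d w = 0.
  move=> wr /(H _ wr) [k Pk kw].
  have ki : k = i.
    apply/eqP/negPn/negP => ki; have [_ _ _ _ [H' _]] := pA.
    have [_ []] := H' _ _ ki P (conj Pk Pi).
      rewrite /P => /eqP; rewrite -subr_eq0 addrAC subrr add0r scaler_eq0.
      by rewrite (negPf dn0) orbF gt_eqF.
    move=> /eqP; rewrite -subr_eq0.
    have -> : P - v (nx i) = (t - 1) *: d.
      by rewrite /P /d; apply: planeP; rewrite !planeE; ring.
    by rewrite scaler_eq0 (negPf dn0) orbF subr_eq0 lt_eqF.
  move: kw; rewrite ki => -[s _ E].
  have -> : w = (s - t) *: d.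
    have -> : w = v i + s *: (v (nx i) - v i) - P by rewrite E addrC addKr.
    by rewrite /P /d; apply: planeP; rewrite !planeE; ring.
  by rewrite /cross !planeE; ring.
have [sg Hsg] := side_cells dn0 cA AiA bP r0 bdr.
by exists sg, r => // w wr; split; [exact: bdr|exact: Hsg].
Qed.

Lemma enorm_unit d (k : R) : d != 0 -> k ^+ 2 = 1 ->
  enorm ((k / enorm d) *: perp d) = 1.
Proof.
move=> d0 k2; have dd : 0 < dot d d.
  rewrite /dot -!expr2 lt_def addr_ge0 ?sqr_ge0// andbT paddr_eq0 ?sqr_ge0//.
  rewrite !sqrf_eq0; apply/negP => /andP[/eqP h1 /eqP h2]; move/eqP: d0; apply.
  exact: planeP.
rewrite {1}/enorm.
have -> : dot ((k / enorm d) *: perp d) ((k / enorm d) *: perp d) =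
    (k / enorm d) ^+ 2 * dot d d.
  by rewrite /dot /perp !planeE /=; ring.
by rewrite expr_div_n k2 sqr_sqrtr ?ltW// mul1r mulVf ?gt_eqF// sqrtr1.
Qed.

(** When [sg] is true the set lies to the left of [d], on the side of [perp d], so that the exterior
    normal points to the right. *)
Definition side_normal (sg : bool) d : plane :=
  ((if sg then -1 else 1) / enorm d) *: perp d.

Lemma flat_normal d (sg : bool) P r : d != 0 -> 0 < r ->
  (forall w, box r w ->
    (0 < cross d w -> (A (P + w) <-> sg)) /\
    (cross d w < 0 -> (A (P + w) <-> ~~ sg))) ->
  exterior_normal A P (side_normal sg d).
Proof.
move=> d0 r0 H; split.
  by apply: enorm_unit => //; case: (sg); rewrite ?sqrrN expr1n.
move=> e e0; apply/nbhs_boxP; exists r => // w wr.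
have -> : P + w - P = w by rewrite addrC addKr.
have ed : 0 < enorm d.
  rewrite sqrtr_gt0 /dot -!expr2 lt_def addr_ge0 ?sqr_ge0// andbT paddr_eq0 ?sqr_ge0//.
  rewrite !sqrf_eq0; apply/negP => /andP[/eqP h1 /eqP h2]; move/eqP: d0; apply.
  exact: planeP.
have ew : 0 <= e * enorm w by rewrite mulr_ge0 ?sqrtr_ge0// ltW.
have -> : dot w (side_normal sg d) = (if sg then -1 else 1) * (cross d w / enorm d).
  rewrite /side_normal; case: (sg); rewrite /dot /cross !planeE /perp;
  by cbn [fst snd]; ring.
have [H1 H2] := H w wr.
case: (sg) H1 H2 => /= H1 H2; rewrite ?mulN1r ?mul1r.
- split=> h.
    by apply/H1 => //; move: h; rewrite ltrN2 => /(le_lt_trans ew); rewrite pmulr_lgt0 ?invr_gt0.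
  move=> Aw; by have := le_lt_trans ew h; rewrite oppr_gt0 pmulr_llt0 ?invr_gt0// => /H2[/(_ Aw)].
- split=> h.
    have : cross d w / enorm d < 0 by apply: (lt_le_trans h); rewrite oppr_le0.
    by rewrite pmulr_llt0 ?invr_gt0// => /H2[_]; apply.
  move=> Aw; have := le_lt_trans ew h.
  by rewrite pmulr_lgt0 ?invr_gt0// => /H1[/(_ Aw)].
Qed.

(** Near such a point the boundary stays on the line of the side, and the same vector is the
    exterior normal at each nearby boundary point. *)
Lemma open_side_not_corner i t : 0 < t < 1 ->
  ~ corners A (v i + t *: (v (nx i) - v i)).
Proof.
move=> t01 [_]; apply; set d := v (nx i) - v i; set P := v i + t *: d.
have [sg [r r0 H]] := open_side_cells i t01.
have d0 : d != 0 by exact: side_neq.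
exists (side_normal sg d).
  by apply: (flat_normal d0 r0) => w /H[].
move=> e e0; apply/nbhs_boxP; exists r => // w wr bw.
exists (side_normal sg d); last first.
  by rewrite subrr /enorm /dot /= !mulr0 addr0 sqrtr0.
have [cw _] := H w wr.
have [q q0 wq] := box_open wr.
apply: (flat_normal d0 q0) => w' /wq /H[_].
rewrite addrA; have -> : cross d (w + w') = cross d w'; last by [].
by rewrite -[RHS]add0r -(cw bw) /cross !planeE; ring.
Qed.

End PolygonalLocal.

(** * Exterior normals are orthogonal to boundary segments *)

Section Tangent.
Context {R : realType}.
Local Notation plane := (R * R)%type.
Implicit Types (A : set plane) (d n w z P : plane) (r t e : R).

Lemma continuous_fst_plane : continuous (fst : plane -> R).
Proof. by move=> [x y]; exact: cvg_fst. Qed.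

Lemma continuous_snd_plane : continuous (snd : plane -> R).
Proof. by move=> [x y]; exact: cvg_snd. Qed.

Lemma continuous_dotl n : continuous (fun w : plane => dot w n).
Proof.
move=> w; apply: cvgD; apply: cvgMr_tmp.
  exact: continuous_fst_plane.
exact: continuous_snd_plane.
Qed.

Lemma continuous_enorm : continuous (@enorm R).
Proof.
move=> w; apply: (@continuous_comp _ _ _ (fun w => dot w w) Num.sqrt).
  apply: cvgD; apply: cvgM; try exact: continuous_fst_plane;
  exact: continuous_snd_plane.
exact: sqrt_continuous.
Qed.

Lemma enormZ t d : 0 <= t -> enorm (t *: d) = t * enorm d.
Proof.
move=> t0; rewrite /enorm.
have -> : dot (t *: d) (t *: d) = t ^+ 2 * dot d d.
  by rewrite /dot !planeE; ring.
by rewrite sqrtrM ?sqr_ge0// sqrtr_sqr ger0_norm.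
Qed.

(** If [dot d n] were not zero, the points [P + t *: d] would for small [t] lie in the open sector
    where the normal prescribes membership or non-membership, and could not be boundary points. *)
Lemma normal_tangent A P n d : exterior_normal A P n ->
  (forall t, 0 < t < 1 -> boundary A (P + t *: d)) -> dot d n = 0.
Proof.
move=> [_ nA] bd.
have ed : 0 <= enorm d by exact: sqrtr_ge0.
have pick e : 0 < e -> exists t r, [/\ 0 < t < 1, 0 < r &
    forall w, box r w ->
    (dot (t *: d + w) n < - (e * enorm (t *: d + w)) -> A (P + t *: d + w)) /\
    (e * enorm (t *: d + w) < dot (t *: d + w) n -> ~ A (P + t *: d + w))].
  move=> /nA /nbhs_boxP[r r0 H].
  have [s s0 hs] := box_small d r0.
  pose t := Num.min s 1 / 2.
  have m0 : 0 < Num.min s 1 by rewrite lt_min s0 ltr01.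
  have t0 : 0 < t by rewrite divr_gt0.
  have : t < Num.min s 1 by rewrite /t; lra.
  rewrite lt_min => /andP[ts t1].
  have /box_open[q q0 hq] : box r (t *: d) by apply: hs; rewrite ltW.
  exists t, q; split; rewrite ?t0// => w /hq /H.
  by rewrite [P + _ - P]addrC addKr addrA.
have negcase n' (K : plane -> Prop) : dot d n' < 0 ->
    (forall e, 0 < e -> exists t r, [/\ 0 < t < 1, 0 < r &
      forall w, box r w ->
      dot (t *: d + w) n' < - (e * enorm (t *: d + w)) -> K (P + t *: d + w)]) ->
    exists2 t, 0 < t < 1 & nbhs (P + t *: d) K.
  (* Chosen so that [dot d n' + e * enorm d] is negative; [negcase] serves for [A] with [n] and for
     the complement with [- n]. *)
  move=> dn H; pose e := - dot d n' / (2 * (enorm d + 1)).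
  have e0 : 0 < e by rewrite divr_gt0 ?oppr_gt0// mulr_gt0// ltr_wpDl.
  have [t [r [t01 r0 HK]]] := H e e0; exists t => //.
  have t0 : 0 < t by case/andP: t01.
  pose G w := dot w n' + e * enorm w.
  have cG : continuous G.
    move=> w; apply: cvgD; first exact: continuous_dotl.
    by apply: cvgMl_tmp; exact: continuous_enorm.
  have Gt : G (t *: d) < 0.
    rewrite /G enormZ ?ltW//.
    have -> : dot (t *: d) n' = t * dot d n' by rewrite /dot !planeE; ring.
    have -> : t * dot d n' + e * (t * enorm d) = t * (dot d n' + e * enorm d) by ring.
    rewrite pmulr_rlt0// /e; rewrite -ltrBrDl sub0r.
    rewrite mulrAC ltr_pdivrMr ?mulr_gt0 ?ltr_wpDl// ltr_pM2l ?oppr_gt0//; lra.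
  have /nbhs_boxP[q q0 hq] : nbhs (t *: d) [set w | G w < 0].
    by apply: open_nbhs_nbhs; split => //; exact: open_comp (fun w _ => cG w) (@open_lt R 0).
  apply/nbhs_boxP; exists (Num.min q r); first by rewrite lt_min q0.
  move=> w wqr; apply: HK; first by apply: box_le wqr; rewrite ge_min lexx orbT.
  rewrite -subr_lt0 opprK; apply: hq; apply: box_le wqr.
  by rewrite ge_min lexx.
have [lt0|gt0|//] := ltgtP (dot d n) 0; exfalso.
- have [|t t01 nb] := negcase n A lt0.
    move=> e /pick[t [r [t01 r0 H]]]; exists t, r; split => // w /H[H1 _]; exact: H1.
  by have [_] := bd t t01; apply.
- have [||t t01 nb] := negcase (- n) (~` A).
  + by rewrite (_ : dot d (- n) = - dot d n) ?oppr_lt0// /dot !planeE; ring.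
  + move=> e /pick[t [r [t01 r0 H]]]; exists t, r; split => // w /H[_ H'].
    rewrite (_ : dot _ (- n) = - dot (t *: d + w) n) ?ltrN2//.
    by rewrite /dot !planeE; ring.
  by have [cl _] := bd t t01; have [z []] := cl _ nb.
Qed.

End Tangent.

(** * Corners and edges of a polygonal set *)

Section PolygonalCorners.
Context {R : realType} (V : finType) (v : V -> R * R) (nx : V -> V) (A : set (R * R)).
Local Notation plane := (R * R)%type.
Hypothesis pA : polygonal v nx A.
Let v_inj : injective v. Proof. by case: pA => _ _ []. Qed.

(** At a vertex no exterior normal exists at all: it would be orthogonal to two independent sides,
    hence zero, whereas it is a unit vector. *)
Lemma polygonal_corners : corners A = range v.
Proof.
apply/seteqP; split.
- move=> y cy; have [by_ _] := cy.
  have [_ _ _ _ [_ bE]] := pA.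
  move: by_; rewrite bE => -[i _ [t /= /[!in_itv]/= /andP[t0 t1] yE]].
  have [t0'|t0'] := eqVneq t 0.
    by exists i => //; rewrite -yE t0' scale0r addr0.
  have [t1'|t1'] := eqVneq t 1.
    by exists (nx i) => //; rewrite -yE t1' scale1r addrC subrK.
  exfalso; rewrite -yE in cy; have t01 : 0 < t < 1 by rewrite !lt_neqAle [0 == t]eq_sym t0' t0 t1'.
  exact: (open_side_not_corner pA t01 cy).
- move=> _ [i _ <-]; split.
    by apply: (side_boundary pA (i := i)); exact: segment_l.
  move=> [n nA _].
  have [j ji] := nx_surj pA i.
  have side_bd a b : (segment a b `<=` boundary A) ->
      forall t : R, 0 < t < 1 -> boundary A (a + t *: (b - a)).
    by move=> ab t /andP[t0 t1]; apply: ab; exists t; rewrite //= in_itv/= !ltW.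
  have E1 := normal_tangent nA (side_bd _ _ (side_boundary pA (i := i))).
  have E2 : dot (v j - v i) n = 0.
    apply: (normal_tangent nA); apply: side_bd; rewrite segmentC -ji.
    exact: (side_boundary pA).
  have c0 := vertex_cross pA ji.
  have [n1 _] := nA.
  have n0 : n = 0.
    apply: planeP; apply: (mulfI c0); rewrite mulr0.
      transitivity (dot (v (nx i) - v i) n * (v j - v i).2 - dot (v j - v i) n * (v (nx i) - v i).2).
        by rewrite /dot /cross; ring.
      by rewrite E1 E2 !mul0r subrr.
    transitivity (dot (v j - v i) n * (v (nx i) - v i).1 - dot (v (nx i) - v i) n * (v j - v i).1).
      by rewrite /dot /cross; ring.
    by rewrite E1 E2 !mul0r subrr.
  move: n1; rewrite n0 /enorm /dot /= !mulr0 addr0 sqrtr0 => /eqP.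
  by rewrite eq_sym oner_eq0.
Qed.

(** An edge in the sense of [edges] is any boundary segment between corners without a corner inside.
    Close to a corner only two sides are available, so that the edge starts along one of them; it
    then ends where that side ends, since neither contains a corner in its interior. *)
Lemma polygonal_edges :
  edges A = [set e | exists i, e = segment (v i) (v (nx i))].
Proof.
apply/seteqP; split => e.
- move=> [x [y [-> [xy cx cy xyb xyo]]]].
  move: (cx) (cy); rewrite polygonal_corners => -[i _ vi] [k _ vk].
  have [j ji] := nx_surj pA i.
  have [r r0 H] := boundary_near pA (v i).
  have [q q0 hq] := box_small (y - x) r0.
  pose t := Num.min q 1 / 2.
  have m0 : 0 < Num.min q 1 by rewrite lt_min q0 ltr01.
  have t0 : 0 < t by rewrite divr_gt0.
  have : t < Num.min q 1 by rewrite /t; lra.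
  rewrite lt_min => /andP[tq t1].
  have tb : box r (t *: (y - x)) by apply: hq; rewrite ltW.
  have tbd : boundary A (v i + t *: (y - x)).
    by rewrite vi; apply: xyb; exists t; rewrite //= in_itv/= !ltW.
  have [l il lt'] := H _ tb tbd.
  (* [y] lies on the ray of the side [v i, b], hence is the end [b] *)
  have concl b m : (forall s : R, 0 < s < 1 -> ~ corners A (v i + s *: (b - v i))) ->
     corners A b -> v i + t *: (y - x) = v i + m *: (b - v i) -> 0 <= m -> b = y.
    move=> nc cb E m0'.
    have {E} E : t *: (y - x) = m *: (b - x) by move: E; rewrite vi => /addrI.
    have mn0 : m != 0.
      apply/eqP => m0e; move/eqP: E; rewrite m0e scale0r scaler_eq0 gt_eqF//= subr_eq0.
      by move/eqP/esym.
    have mp : 0 < m by rewrite lt_def mn0.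
    have Ey : y = x + (m / t) *: (b - x).
      by rewrite [_ / t]mulrC -scalerA -E scalerA mulVf ?gt_eqF// scale1r addrC subrK.
    have Eb : b = x + (t / m) *: (y - x).
      by rewrite [_ / m]mulrC -scalerA E scalerA mulVf// scale1r addrC subrK.
    have [mt|mt|mt] := ltgtP (m / t) 1.
    - exfalso; apply: (nc (m / t)); first by rewrite mt divr_gt0.
      by rewrite vi -Ey.
    - exfalso; suff : (open_segment x y `&` corners A) b by rewrite xyo.
      split => //; exists (t / m) => //=; rewrite in_itv/= divr_gt0//=.
      by rewrite ltr_pdivrMr// mul1r -(mul1r t) -ltr_pdivlMr.
    - by rewrite Ey mt scale1r addrC subrK.
  have cvk k' : corners A (v k') by rewrite polygonal_corners; exists k'.
  have [li|lj] := vertex_side pA il.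
    exists i; rewrite -vi; congr segment; apply/esym.
    move: lt'; rewrite li => -[m /= /[!in_itv]/= /andP[m0' _] E].
    apply: (concl _ m) => //.
    by move=> s s01; exact: (open_side_not_corner pA s01).
  exists l; rewrite lj segmentC -vi; congr segment; apply/esym.
  move: lt'; rewrite segmentC lj => -[m /= /[!in_itv]/= /andP[m0' _] E].
  apply: (concl _ m) => //.
  move=> s /andP[s0 s1].
  have -> : v i + s *: (v l - v i) = v l + (1 - s) *: (v (nx l) - v l).
    by rewrite lj; apply: planeP; rewrite !planeE; ring.
  have s01 : 0 < 1 - s < 1 by rewrite subr_gt0 s1 ltrBlDr ltrDl.
  exact: (open_side_not_corner pA s01).
- move=> [i ->]; exists (v i), (v (nx i)); split => //; split.
  + by move=> E; have := side_neq pA i; rewrite -E subrr eqxx.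
  + by rewrite polygonal_corners; exists i.
  + by rewrite polygonal_corners; exists (nx i).
  + exact: (side_boundary pA).
  + rewrite -subset0 => _ [[t /= /[!in_itv]/= t01 <-] c].
    exact: (open_side_not_corner pA t01 c).
Qed.

End PolygonalCorners.

(** * Components of the support *)

Section Source.
Context {R : realType}.
Local Notation plane := (R * R)%type.

(** Points of neighbouring lines with the same second coordinate differ by a multiple of [(1, 0)]; a
    bounded derivative in this direction is the differentiability that the second differences
    use. *)
Definition regular_on (A : set plane) (h : plane -> R) : Prop :=
  [/\ compact A, forall z, ~ A z -> h z = 0, {within A, continuous h} &
      exists L : R, forall z, interior A z ->
        exists2 d : R, is_derive z ((1, 0) : plane) h d & `|d| <= L].

Section Union.
Context (M : nat) (Om : 'I_M -> set plane) (A : set plane).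
Hypothesis (AE : A = \bigcup_m Om m) (disj : trivIset setT Om).
Hypothesis cpOm : forall m, compact (Om m).

Let clOm m : closed (Om m).
Proof. by apply: compact_closed; [exact: norm_hausdorff|exact: cpOm]. Qed.

(** The other components are closed, finite in number and miss [z]. This makes every local property
    of the union a property of one component. *)
Lemma near_component m z : Om m z -> \forall w \near z, A w -> Om m w.
Proof.
move=> mz.
have : \forall w \near z, forall m', m' != m -> ~ Om m' w.
  apply: (@filter_forall _ 'I_M (fun m' w => m' != m -> ~ Om m' w) (nbhs z)) => m'.
  have [->|mm'] := eqVneq m' m; first by near=> w.
  have nz : ~ Om m' z.
    by move=> mz'; move/eqP: mm'; apply; apply: disj => //; exists z.
  have h := open_nbhs_nbhs (conj (closed_openC (@clOm m')) nz).
  by near=> w => _; near: w; exact: h.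
apply: filterS => w H; rewrite AE => -[m' _ mw'].
by have [<-//|/H] := eqVneq m' m.
Unshelve. all: by end_near. Qed.

Lemma component_sub m : Om m `<=` A.
Proof. by move=> z mz; rewrite AE; exists m. Qed.

Lemma interior_component m z : Om m z -> interior A z -> interior (Om m) z.
Proof.
move=> mz iA; apply: filterS2 (near_component mz) iA => w H; exact: H.
Qed.

Lemma closed_components : closed A.
Proof.
move=> z cz; apply: contrapT => nAz.
have : \forall w \near z, forall m, ~ Om m w.
  apply: (@filter_forall _ 'I_M (fun m w => ~ Om m w) (nbhs z)) => m.
  have nz : ~ Om m z by move=> mz; apply: nAz; exact: component_sub mz.
  exact: (open_nbhs_nbhs (conj (closed_openC (@clOm m)) nz)).
by move=> /cz [w [+ H]]; rewrite AE => -[m _ /H].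
Qed.

Lemma boundary_components : boundary A = \bigcup_m boundary (Om m).
Proof.
apply/seteqP; split => z.
- move=> [/closed_components + iA]; rewrite {1}AE => -[m _ mz].
  exists m => //; split; first exact: subset_closure.
  by move=> im; apply: iA; apply: interiorS im; exact: component_sub.
- move=> [m _ [/clOm mz im]]; split.
    by apply: subset_closure; exact: component_sub mz.
  by move/(interior_component mz).
Qed.

Lemma regular_components : (forall m, Om m = closure (interior (Om m))) ->
  A = closure (interior A).
Proof.
move=> reg; apply/seteqP; split => z.
  rewrite {1}AE => -[m _]; rewrite {1}reg => cz B /cz [w [iw Bw]].
  exists w; split => //; apply: interiorS iw; exact: component_sub.
move=> cz; apply: closed_components; move=> B /cz [w [iw Bw]].
by exists w; split => //; exact: interior_subset.
Qed.

Lemma regular_on_components (h : plane -> R) :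
  compact A -> (forall z, ~ A z -> h z = 0) -> (forall m, C1_on (Om m) h) ->
  regular_on A h.
Proof.
move=> cpA hA C1; split => //.
- apply/subspace_continuousP => z; rewrite {1}AE => -[m _ mz].
  have [/subspace_continuousP/(_ z mz) cm _] := C1 m.
  move=> B /cm hB; have near_m := near_component mz.
  have hB' : \forall w \near z, Om m w -> B (h w) by exact: hB.
  have : \forall w \near z, A w -> B (h w).
    by apply: filterS2 hB' near_m => w h1 h2 /h2; exact: h1.
  by [].
- have bd m : exists L : R, forall z, interior (Om m) z ->
        exists2 d : R, is_derive z ((1, 0) : plane) h d & `|d| <= L.
    have [_ /(_ (1, 0)) [|dh cdh Hdh]] := C1 m; first by left.
    have /compact_bounded[L [_ HL]] := continuous_compact cdh (@cpOm m).
    exists (L + 1) => z iz; exists (dh z); first exact: Hdh.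
    apply: HL; first by rewrite ltrDl.
    by exists z => //; exact: interior_subset.
  have [L HL] := choice bd.
  exists (\sum_m `|L m|) => z iz.
  have : A z by exact: interior_subset.
  rewrite {1}AE => -[m _ mz].
  have [d hd dL] := HL m z (interior_component mz iz).
  exists d => //; apply: (le_trans dL); rewrite (bigD1 m)//=.
  by apply: (le_trans (ler_norm _)); rewrite lerDl sumr_ge0.
Qed.

(** A vertex of the union is a triple of a component, a polyline of it and a position on that
    polyline. Different polylines are disjoint, within a component by [polygon] and across
    components because these are disjoint and closed, so that the conditions on pairs of sides
    reduce to a single polyline. *)
Lemma polygonal_components : (forall m, polygon (Om m)) ->
  exists (V : finType) (v : V -> plane) (nx : V -> V), polygonal v nx A.
Proof.
move=> pOm.
pose polylines m (pc : {p : nat & 'I_p -> set plane}) :=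
  [/\ trivIset setT (projT2 pc), forall i, simple_closed_polyline (projT2 pc i) &
     boundary (Om m) = \bigcup_i projT2 pc i].
have [pC HpC] : {pC & forall m, polylines m (pC m)}.
  apply: choice => m; have [_ _ [p [C HC]]] := pOm m.
  by exists (existT _ p C).
pose W := {m : 'I_M & 'I_(projT1 (pC m))}.
pose C (w : W) : set plane := projT2 (pC (tag w)) (tagged w).
pose vertices (w : W) (q : {q : nat & 'I_q.+3 -> plane}) :=
    let u := projT2 q in
    [/\ injective u,
        forall i j, i != j ->
          segment (u i) (u (ordS i)) `&` segment (u j) (u (ordS j)) `<=`
          [set u i; u (ordS i)] `&` [set u j; u (ordS j)],
        forall i, dot (perp (u (ordS i) - u i))
                      (u (ordS (ordS i)) - u (ordS i)) != 0 &
        C w = \bigcup_i segment (u i) (u (ordS i))].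
have [Q HQ] : {Q & forall w, vertices w (Q w)}.
  apply: choice => w; have [_ /(_ (tagged w)) [q [u Hu]] _] := HpC (tag w).
  by exists (existT _ q u).
pose V := {w : W & 'I_(projT1 (Q w)).+3}.
pose v (x : V) : plane := projT2 (Q (tag x)) (tagged x).
pose nx (x : V) : V := Tagged (fun w => 'I_(projT1 (Q w)).+3) (ordS (tagged x)).
have bE m : boundary (Om m) = \bigcup_i projT2 (pC m) i by case: (HpC m).
have Cdisj w w' z : C w z -> C w' z -> w = w'.
  case: w => m i; case: w' => m' i'; rewrite /C /= => z1 z2.
  have b1 : boundary (Om m) z by rewrite bE; exists i.
  have b2 : boundary (Om m') z by rewrite bE; exists i'.
  have mm' : m = m'.
    apply: disj => //; exists z; split; exact: boundary_sub b1 || exact: boundary_sub b2.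
  subst m'; congr Tagged; have [tC _ _] := HpC m.
  by apply: tC => //; exists z.
have sideC (x : V) : segment (v x) (v (nx x)) `<=` C (tag x).
  move=> z xz; have [_ _ _ ->] := HQ (tag x).
  by exists (tagged x).
have vC (x : V) : C (tag x) (v x) by apply: sideC; exact: segment_l.
exists V, v, nx; split.
- exact: closed_components.
- by apply: regular_components => m; case: (pOm m).
- split.
    move=> [w i] [w' j] E.
    have ww' : w = w'.
      have := vC (existT _ w i); rewrite E => h1.
      exact: Cdisj h1 (vC (existT _ w' j)).
    subst w'; have [u_inj _ _ _] := HQ w.
    by congr Tagged; apply: u_inj.
  move=> [w i] [w' j] E.
  have ww' : w = w' by exact: (congr1 tag E).
  subst w'; congr Tagged; apply: (@ordS_inj _).
  by apply/eqP; move/eqP: E; rewrite eq_Tagged.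
- move=> x; have [_ _ Hu _] := HQ (tag x).
  by rewrite -cross_perp; exact: Hu.
split.
- move=> x y xy z [xz yz].
  have ww' := Cdisj _ _ _ (sideC _ _ xz) (sideC _ _ yz).
  case: x xy xz ww' => w i; case: y yz => w' j yz xy xz /= ww'; subst w'.
  have [_ Hs _ _] := HQ w.
  apply: (Hs i j) => //.
  by apply: contraNneq xy => ->.
- rewrite boundary_components; apply/seteqP; split => z.
    move=> [m _]; rewrite bE => -[i _ iz].
    pose w : W := Tagged _ i.
    have [_ _ _ E] := HQ w.
    have : C w z by [].
    rewrite E => -[k _ kz]; by exists (Tagged _ k : V).
  move=> [x _ /sideC xz]; exists (tag (tag x)) => //.
  by rewrite bE; exists (tagged (tag x)).
Qed.

End Union.

Lemma polygonal_source_supp (f : plane -> R[i]) (M : nat) (Om : 'I_M -> set plane) :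
  polygonal_source f Om ->
  [/\ exists (V : finType) (v : V -> plane) (nx : V -> V), polygonal v nx (supp f),
      regular_on (supp f) (fun z => complex.Re (f z)),
      regular_on (supp f) (fun z => complex.Im (f z)) &
      forall z, boundary (supp f) z -> f z != 0].
Proof.
move=> [[[cp _] [AE disj] Om_reg _ [C1 fb]] pOm].
have cpOm m : compact (Om m) by case: (Om_reg m).
have f0 z : ~ supp f z -> f z = 0.
  move=> nz; apply/eqP/negPn/negP => fz; apply: nz.
  exact: subset_closure.
split => //.
- by apply: (polygonal_components AE disj cpOm) => m; case: (pOm m).
- apply: (regular_on_components AE disj cpOm) => // [z /f0 -> //|m].
  by case: (C1 m).
- apply: (regular_on_components AE disj cpOm) => // [z /f0 -> //|m].
  by case: (C1 m).
Qed.

End Source.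

(** * Second differences of line integrals *)

Section Dominated.
Context {R : realType}.
Local Notation mu := (@lebesgue_measure R).

Lemma dominated_Rintegral (fn : nat -> R -> R) (f g : R -> R) (E : set R) :
  countable E -> (forall n, measurable_fun setT (fn n)) -> measurable_fun setT f ->
  bounded_supp g -> (forall n x, `|fn n x| <= g x) ->
  (forall x, ~ E x -> fn n x @[n --> \oo] --> f x) ->
  \int[mu]_x fn n x @[n --> \oo] --> \int[mu]_x f x.
Proof.
move=> cE mfn mf bg fng cvf.
have mE : measurable E by exact: countable_measurable.
have [|||||fint _ H] := @dominated_convergence _ _ _ mu setT measurableT
  (fun n => EFin \o fn n) (EFin \o f) (EFin \o g).
- by move=> n; apply/measurable_EFinP; exact: mfn.
- by apply/measurable_EFinP.
- exists E; split => //; first exact: countable_lebesgue_measure0.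
  move=> x /= nx; apply: contrapT => xE; apply: nx => _.
  by apply: cvg_EFin; [exact: nearW|exact: cvf].
- exact: integrable_bounded_supp1.
- exists set0; split => // x /= nx; exfalso; apply: nx => n _.
  by rewrite lee_fin.
apply: fine_cvg; rewrite fineK//; exact: integrable_fin_num.
Qed.

End Dominated.

Section Transversal.
Context {R : realType}.
Local Notation plane := (R * R)%type.
Local Notation mu := (@lebesgue_measure R).
Implicit Types (A : set plane) (h : plane -> R) (d w y z P : plane) (m r s t e : R).

(** The scalar product with [(1, m)], constant along the lines of [line_integral]. *)
Definition slope m z : R := z.1 + m * z.2.

Lemma slopeD m z w : slope m (z + w) = slope m z + slope m w.
Proof. by rewrite /slope !planeE; ring. Qed.

Lemma slopeZ m t z : slope m (t *: z) = t * slope m z.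
Proof. by rewrite /slope !planeE; ring. Qed.

Lemma slopeN m z : slope m (- z) = - slope m z.
Proof. by rewrite /slope !planeE; ring. Qed.

Lemma slope_line m s t : slope m (s - m * t, t) = s.
Proof. by rewrite /slope /= subrK. Qed.

Lemma norm_planeP (L : R) z : `|z| <= L -> `|z.1| <= L /\ `|z.2| <= L.
Proof. by rewrite prod_normE /= ge_max => /andP. Qed.

Lemma regular_on_bounded_supp2 A h : regular_on A h -> bounded_supp2 h.
Proof.
move=> [cpA hA ch _].
have clA : closed A by apply: compact_closed => //; exact: norm_hausdorff.
split; first exact: measurable_supp_continuous hA.
have /compact_bounded[B [_ HB]] : compact (h @` A) by exact: continuous_compact.
have /compact_bounded[S [_ HS]] := cpA.
exists (Num.max (B + 1) 0), (S + 1) => z; split.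
  rewrite le_max; have [Az|nAz] := pselect (A z).
    by rewrite HB// ?ltrDl//; exists z.
  by rewrite hA// normr0 lexx orbT.
move=> hz; apply: norm_planeP; apply: HS; first by rewrite ltrDl.
by apply: contrapT => /hA.
Qed.

Lemma regular_on_continuous A h z : regular_on A h -> ~ boundary A z ->
  h w @[w --> z] --> h z.
Proof.
move=> [cpA hA ch _] nb.
have clA : closed A by apply: compact_closed => //; exact: norm_hausdorff.
have [Az|nAz] := pselect (A z).
  have iz : interior A z.
    by apply: contrapT => iz; apply: nb; split => //; exact: subset_closure.
  move: ch => /subspace_continuousP/(_ z Az) H B /H hB.
  have hB' : \forall w \near z, A w -> B (h w) by exact: hB.
  by apply: filterS2 hB' iz => w h1 h2; exact: h1.
rewrite hA//; apply: cvg_near_cst.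
have := open_nbhs_nbhs (conj (closed_openC clA) nAz).
by apply: filterS => w /hA.
Qed.

Section Sides.
Variables (V : finType) (v : V -> plane) (nx : V -> V) (A : set plane) (m : R).
Hypothesis pA : polygonal v nx A.
Hypothesis transv : forall i, slope m (v (nx i) - v i) != 0.

(** The speed at which the crossing with the [i]-th side moves along the line when the level [s]
    grows. *)
Definition side_ratio i : R := (v (nx i) - v i).2 / slope m (v (nx i) - v i).

(* The [t]-coordinate at which the line of the [i]-th side meets the line
   [{(s - m * t, t)}]. *)
Definition height i s : R := (v i).2 + (s - slope m (v i)) * side_ratio i.

Lemma side_height i y : segment (v i) (v (nx i)) y -> y.2 = height i (slope m y).
Proof.
move=> [t _ <-]; set d := v (nx i) - v i.
have -> : slope m (v i + t *: d) = slope m (v i) + t * slope m d.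
  by rewrite slopeD slopeZ.
rewrite /height /side_ratio -/d !planeE; field; exact: transv.
Qed.

Lemma height_sub i s s' : height i s - height i s' = (s - s') * side_ratio i.
Proof. by rewrite /height; ring. Qed.

Lemma boundary_height y : boundary A y -> exists i, y.2 = height i (slope m y).
Proof.
have [_ _ _ _ [_ ->]] := pA.
by move=> [i _ iy]; exists i; exact: side_height.
Qed.

Definition heights s : set R := [set height i s | i in [set: V]].

(** The function [h] may jump at the boundary, but a line transversal to all sides meets it in
    finitely many points, a null set for dominated convergence. *)
Lemma line_integral_continuous h : regular_on A h -> continuous (line_integral h m).
Proof.
move=> rh s; have bh := regular_on_bounded_supp2 rh.
have [mh [B [S hBS]]] := bh.
apply/(@cvg_nbhsP _ R^o) => u us.
apply: (@dominated_Rintegral _ (fun n t => h (u n - m * t, t)) _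
  (fun t => B * \1_(`[- S, S]%classic : set R) t) (heights s)).
- apply: finite_set_countable; exact: finite_image.
- by move=> n; have [] := bounded_supp_line m (u n) bh.
- by have [] := bounded_supp_line m s bh.
- by apply: bounded_suppM; [exact: cst_continuous|exact: bounded_supp_indic].
- move=> n t; have [hB hS] := hBS (u n - m * t, t).
  have B0 : 0 <= B by exact: le_trans hB.
  have [->|/eqP/hS[_ /= tS]] := eqVneq (h (u n - m * t, t)) 0.
    by rewrite normr0 mulr_ge0.
  have -> : \1_(`[- S, S]%classic : set R) t = 1.
    by rewrite /indic mem_set//= in_itv/= -ler_norml.
  by rewrite mulr1.
- move=> t tE; apply: (@cvg_comp _ _ _ (fun n => (u n - m * t, t)) h _ (nbhs ((s - m * t, t) : plane))).
    have h1 : u n - m * t @[n --> \oo] --> s - m * t.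
      by apply: cvgB => //; exact: cvg_cst.
    have h2 : t @[n --> \oo] --> t by exact: cvg_cst.
    exact: (cvg_pair h1 h2).
  apply: (regular_on_continuous rh) => bz.
  have [i ti] : exists i, t = height i s.
    by have [i ti] := boundary_height bz; exists i; rewrite slope_line in ti.
  by apply: tE; exists i.
Qed.

End Sides.

End Transversal.

(** * Blow-up of the second difference at a point *)

Section LocalJump.
Context {R : realType}.
Local Notation plane := (R * R)%type.
Local Notation mu := (@lebesgue_measure R).
Implicit Types (A : set plane) (h : plane -> R) (d w y z P : plane) (m r s t e u : R).

Definition second_diff h m s e t : R :=
  h (s + e - m * t, t) + h (s - e - m * t, t) - 2 * h (s - m * t, t).

(** The displacement with [slope] equal to [s] and second coordinate [u]: coordinates for the
    blown-up picture. *)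
Definition wdir m s u : plane := (s - m * u, u).

Definition local_model A y (K1 K2 : set plane) (sg : bool) : Prop :=
  exists2 r : R, 0 < r & forall w, box r w ->
    (K1 w -> (A (y + w) <-> sg)) /\ (K2 w -> (A (y + w) <-> ~~ sg)).

Definition cone (K : set plane) : Prop := forall t w, 0 < t -> K w -> K (t *: w).

Lemma regular_on_closed A h : regular_on A h -> closed A.
Proof.
by move=> [cpA _ _ _]; apply: compact_closed => //; exact: norm_hausdorff.
Qed.

(** The points stay in [y + K] because [K] is a cone. If they lie in [A], continuity on the closed
    set [A] gives the limit [h y]; otherwise [h] vanishes at them. *)
Lemma model_limit A h y K (b : bool) w (eps : nat -> R) : regular_on A h -> cone K ->
  (exists2 r : R, 0 < r & forall w, box r w -> K w -> (A (y + w) <-> b)) ->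
  (forall n, 0 < eps n) -> eps n @[n --> \oo] --> 0 -> K w ->
  h (y + eps n *: w) @[n --> \oo] --> h y * b%:R.
Proof.
move=> rh cK [r r0 HK] eps0 ceps Kw.
have [e e0 he] := box_small w r0.
have nA : \forall n \near \oo, A (y + eps n *: w) <-> b.
  have /cvgr_lt/(_ _ e0) := ceps; apply: filterS => n ne.
  apply: HK; last exact: cK.
  by apply: he; rewrite ne ltW.
have cy : y + eps n *: w @[n --> \oo] --> y.
  rewrite -[X in _ --> X]addr0 -(scale0r w).
  by apply: cvgD; [exact: cvg_cst|exact: (cvgZr_tmp (a := w) ceps)].
have [_ h0 ch _] := rh.
case: b nA {HK} => nA.
- have Ay : A y.
    apply: (regular_on_closed rh) => B By.
    have : \forall n \near \oo, B (y + eps n *: w) by exact: cy.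
    move=> nB; have := filterI nA nB; move=> [N _ /(_ N (leqnn N))] [H1 H2].
    by exists (y + eps N *: w); split => //; apply/H1.
  rewrite mulr1 => B hB.
  have /subspace_continuousP/(_ y Ay) H := ch.
  have hB' : \forall z \near y, A z -> B (h z) by exact: H.
  have nB : \forall n \near \oo, A (y + eps n *: w) -> B (h (y + eps n *: w)) by exact: (cy _ hB').
  have : \forall n \near \oo, B (h (y + eps n *: w)).
    by apply: filterS2 nA nB => n [_ H1] H2; apply: H2; exact: H1.
  by [].
- rewrite mulr0; apply: cvg_near_cst; apply: filterS nA => n [H1 _].
  by apply: h0 => /H1.
Qed.

Lemma wdir_scale m s u e (s0 tau : R) :
  (s0 - m * tau, tau) + e *: wdir m s u =
  (s0 + e * s - m * (e * u + tau), e * u + tau).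
Proof. by apply: planeP; rewrite !planeE /wdir /=; ring. Qed.

Lemma bounded_supp_second_diff h m s e : bounded_supp2 h ->
  bounded_supp (second_diff h m s e).
Proof.
move=> bh; rewrite /second_diff.
have H s' := bounded_supp_line m s' bh.
apply: bounded_suppD; first by apply: bounded_suppD; exact: H.
by apply: bounded_suppN; apply: bounded_suppM; [exact: cst_continuous|exact: H].
Qed.

Lemma bounded_supp_mul_indic (a b : R) (g : R -> R) : bounded_supp g ->
  bounded_supp (fun t => g t * \1_(`[a, b]%classic : set R) t).
Proof.
move=> [mg [B [S H]]]; split.
  by apply: measurable_funM => //; exact: measurable_indic.
exists B, S => t; have [gB gS] := H t; split; last by move=> /gS ->; rewrite mul0r.
rewrite /indic; case: (_ \in _); rewrite ?mulr1// mulr0 normr0.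
exact: le_trans gB.
Qed.

Lemma indic_itv (a b u : R) : u != a -> u != b ->
  \1_(`[a, b]%classic : set R) u = (a < u < b)%R%:R :> R.
Proof.
move=> ua ub; rewrite /indic; congr (_%:R); congr nat_of_bool.
apply/idP/idP; rewrite inE /= in_itv/=.
  by move=> /andP[au bu]; rewrite !lt_neqAle eq_sym ua ub au bu.
by move=> /andP[au bu]; rewrite !ltW.
Qed.

Lemma indic_itv_sub (a b C u : R) : - C <= a -> b <= C -> C < `|u| ->
  \1_(`[a, b]%classic : set R) u = 0 :> R.
Proof.
move=> aC bC Cu; rewrite /indic memNset//= in_itv/= => /andP[au ub].
have : `|u| <= C by rewrite ler_norml; apply/andP; split; lra.
by rewrite leNgt Cu.
Qed.

(* The window [|t - tau| <= C * e] rescales to [[- C, C]], where the integrand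
   converges to the second difference of the tangent cone of [A] at the point. *)
Lemma local_jump A h m (s0 tau C : R) (K1 K2 : set plane) (sg : bool)
    (xs ys : R -> R) (eps : nat -> R) :
  regular_on A h -> cone K1 -> cone K2 ->
  local_model A (s0 - m * tau, tau) K1 K2 sg ->
  0 <= C ->
  (forall s, s = 1 \/ s = -1 \/ s = 0 ->
     [/\ - C <= xs s, xs s <= ys s, ys s <= C &
      forall u, - C <= u <= C -> u != xs s -> u != ys s ->
        if xs s < u < ys s then K1 (wdir m s u) else K2 (wdir m s u)]) ->
  (forall n, 0 < eps n) -> eps n @[n --> \oo] --> 0 ->
  (eps n)^-1 * \int[mu]_t (second_diff h m s0 (eps n) t *
      \1_(`[tau - C * eps n, tau + C * eps n]%classic : set R) t) @[n --> \oo] -->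
  h (s0 - m * tau, tau) * (if sg then 1 else -1) *
    ((ys 1 - xs 1) + (ys (-1) - xs (-1)) - 2 * (ys 0 - xs 0)).
Proof.
move=> rh cK1 cK2 [r r0 Hr] C0 Hs eps0 ceps.
set y : plane := (s0 - m * tau, tau).
have bh := regular_on_bounded_supp2 rh; have [mh [B [S hBS]]] := bh.
pose D n := second_diff h m s0 (eps n).
pose I n : set R := `[tau - C * eps n, tau + C * eps n]%classic.
pose J s : set R := `[xs s, ys s]%classic.
have bDI n : bounded_supp (fun t => D n t * \1_(I n) t).
  by apply: bounded_supp_mul_indic; exact: bounded_supp_second_diff.
have -> : (fun n => (eps n)^-1 * \int[mu]_t (D n t * \1_(I n) t)) =
    (fun n => \int[mu]_u (D n (eps n * u + tau) * \1_(I n) (eps n * u + tau))).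
  apply/funext => n; rewrite -(@Rintegral_affine R (eps n) tau (fun t => D n t * \1_(I n) t))//.
  exact: integrable_bounded_supp1.
have IE n u : \1_(I n) (eps n * u + tau) = \1_(`[- C, C]%classic : set R) u :> R.
  rewrite /indic; congr (_%:R); congr nat_of_bool.
  apply/idP/idP; rewrite !inE /I /= !in_itv/= => /andP[h1 h2]; apply/andP; split.
  - by rewrite -(ler_pM2l (eps0 n)); lra.
  - by rewrite -(ler_pM2l (eps0 n)); lra.
  - by move: h1; rewrite -(ler_pM2l (eps0 n)); lra.
  - by move: h2; rewrite -(ler_pM2l (eps0 n)); lra.
have DE n u : D n (eps n * u + tau) = h (y + eps n *: wdir m 1 u) +
    h (y + eps n *: wdir m (-1) u) - 2 * h (y + eps n *: wdir m 0 u).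
  by rewrite !wdir_scale mulr1 mulrN1 mulr0 addr0.
(* If [A] looks like [K2], its section has the complementary indicator [1 - \1_(J s)]. The constant
   disappears in the second difference since [1 + 1 - 2 = 0], and only a sign remains. *)
pose c : R := if sg then 1 else -1.
have bJ s : bounded_supp \1_(J s) by exact: bounded_supp_indic.
have bsZ (k : R) g : bounded_supp g -> bounded_supp (fun x => k * g x).
  by apply: bounded_suppM; exact: cst_continuous.
have iJ s : s = 1 \/ s = -1 \/ s = 0 -> \int[mu]_u \1_(J s) u = ys s - xs s.
  by move=> /Hs[_ h2 _ _]; exact: Rintegral_indic_itv.
pose f u : R := h y * c * (\1_(J 1) u + \1_(J (-1)) u - 2 * \1_(J 0) u).
have bsum : bounded_supp (fun u => \1_(J 1) u + \1_(J (-1)) u - 2 * \1_(J 0) u).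
  apply: bounded_suppD; first exact: bounded_suppD.
  by apply: bounded_suppN; exact: bsZ.
have bf : bounded_supp f by exact: bsZ.
have fE : \int[mu]_u f u = h y * c *
    ((ys 1 - xs 1) + (ys (-1) - xs (-1)) - 2 * (ys 0 - xs 0)).
  rewrite /f RintegralZl//; last exact: integrable_bounded_supp1.
  congr (_ * _); rewrite RintegralB//; last 2 first.
  - by apply: integrable_bounded_supp1; exact: bounded_suppD.
  - by apply: integrable_bounded_supp1; exact: bsZ.
  rewrite RintegralD//; try exact: integrable_bounded_supp1.
  rewrite RintegralZl//; last exact: integrable_bounded_supp1.
  by rewrite !iJ//; [right; right|right; left|left].
rewrite -fE.
(* The ends of the three sections, where no convergence is claimed. *)
pose E : set R := [set x | [\/ x = xs 1, x = ys 1 | x = xs (-1)] \/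
                           [\/ x = ys (-1), x = xs 0 | x = ys 0]].
have fE' : finite_set E.
  apply: (@sub_finite_set _ _ [set` [:: xs 1; ys 1; xs (-1); ys (-1); xs 0; ys 0]]).
    move=> x; rewrite /= !inE => -[] [] ->; rewrite eqxx ?orbT//.
  exact: finite_seq.
apply: (@dominated_Rintegral _ _ f (fun u => 4 * B * \1_(`[- C, C]%classic : set R) u) E).
- exact: finite_set_countable.
- move=> n; have [mDI _] := bDI n.
  exact: (measurableT_comp mDI (measurable_affine (eps n) tau)).
- by have [] := bf.
- by apply: bsZ; exact: bounded_supp_indic.
- move=> n u; rewrite IE normrM [X in _ * X]ger0_norm; last by exact: ler0n.
  apply: ler_wpM2r; first exact: ler0n.
  rewrite DE.
  have H z : `|h z| <= B by case: (hBS z).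
  set a := h _; set b := h (y + _ *: wdir m (-1) u); set d := h (y + _ *: wdir m 0 u).
  have : `|a + b - 2 * d| <= `|a| + `|b| + 2 * `|d|.
    apply: (le_trans (ler_normB _ _)); rewrite normrM (ger0_norm (ler0n _ 2)).
    by rewrite lerD2r; exact: ler_normD.
  have := H (y + eps n *: wdir m 1 u); have := H (y + eps n *: wdir m (-1) u).
  have := H (y + eps n *: wdir m 0 u); rewrite -/a -/b -/d; clear; lra.
move=> u uE.
have [uC|Cu] := leP `|u| C; last first.
  have -> : f u = 0.
    have J0 s : s = 1 \/ s = -1 \/ s = 0 -> \1_(J s) u = 0 :> R.
      by move=> /Hs[h1 _ h3 _]; exact: indic_itv_sub Cu.
    rewrite /f !J0 ?mulr0 ?addr0 ?subrr ?mulr0//; by [left|right; left|right; right].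
  have -> : (fun n => D n (eps n * u + tau) * \1_(I n) (eps n * u + tau)) = (fun=> 0).
    by apply/funext => n; rewrite IE (@indic_itv_sub _ _ C) ?mulr0.
  exact: cvg_cst.
have -> : (fun n => D n (eps n * u + tau) * \1_(I n) (eps n * u + tau)) =
    (fun n => h (y + eps n *: wdir m 1 u) +
    h (y + eps n *: wdir m (-1) u) - 2 * h (y + eps n *: wdir m 0 u)).
  apply/funext => n; rewrite IE DE.
  have -> : \1_(`[- C, C]%classic : set R) u = 1 :> R.
    by rewrite /indic mem_set//= in_itv/= -ler_norml.
  by rewrite mulr1.
have lim s : s = 1 \/ s = -1 \/ s = 0 -> u != xs s -> u != ys s ->
    h (y + eps n *: wdir m s u) @[n --> \oo] -->
    h y * (if (xs s < u < ys s)%R then sg else ~~ sg)%:R.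
  move=> /Hs[_ _ _ H] ux uy; have uC' : - C <= u <= C by rewrite -ler_norml.
  have := H u uC' ux uy; case: ifP => _ KW.
    apply: (model_limit rh cK1) => //.
    by exists r => // w /Hr[].
  apply: (model_limit rh cK2) => //.
  by exists r => // w /Hr[].
have x1 : u != xs 1 by apply/eqP => ue; apply: uE; left; constructor 1.
have y1 : u != ys 1 by apply/eqP => ue; apply: uE; left; constructor 2.
have xm : u != xs (-1) by apply/eqP => ue; apply: uE; left; constructor 3.
have ym : u != ys (-1) by apply/eqP => ue; apply: uE; right; constructor 1.
have x0 : u != xs 0 by apply/eqP => ue; apply: uE; right; constructor 2.
have y0 : u != ys 0 by apply/eqP => ue; apply: uE; right; constructor 3.
have l1 := lim 1 (or_introl erefl) x1 y1.
have lm := lim (-1) (or_intror (or_introl erefl)) xm ym.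
have l0 := lim 0 (or_intror (or_intror erefl)) x0 y0.
have fu : f u = h y * (if (xs 1 < u < ys 1)%R then sg else ~~ sg)%:R +
   h y * (if (xs (-1) < u < ys (-1))%R then sg else ~~ sg)%:R -
   2 * (h y * (if (xs 0 < u < ys 0)%R then sg else ~~ sg)%:R).
  rewrite /f /c !indic_itv//; case: (_ && _); case: (_ && _); case: (_ && _);
  by case: (sg); rewrite /=; ring.
by rewrite fu; apply: cvgB; [exact: cvgD|exact: (cvgMl_tmp (a := 2) l0)].
Qed.

End LocalJump.

(** * Second differences away from the boundary *)

Section Horizontal.
Context {R : realType}.
Local Notation plane := (R * R)%type.
Local Notation mu := (@lebesgue_measure R).
Implicit Types (A : set plane) (h : plane -> R) (d w y z P : plane) (m r s t e u x : R).

Lemma is_derive_line h m t x (d : R) :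
  is_derive ((x - m * t, t) : plane) ((1, 0) : plane) h d ->
  is_derive x 1 (fun x => h (x - m * t, t)) d.
Proof.
move=> [dh dE]; set z : plane := (x - m * t, t) in dh dE.
have E : (fun k : R => k^-1 *: (((fun x => h (x - m * t, t)) \o shift x) (k *: 1) -
     h (x - m * t, t))) =
   (fun k : R => k^-1 *: ((h \o shift z) (k *: ((1, 0) : plane)) - h z)).
  apply/funext => k /=; congr (_ *: (h _ - h _)).
  apply: planeP; rewrite !planeE /=.
    by rewrite /GRing.scale /=; ring.
  by rewrite mulr0 add0r.
split; first by rewrite /derivable E.
by rewrite -dE /derive E.
Qed.

Lemma horizontal_sideP A m t (s1 s2 : R) : s1 <= s2 ->
  (forall s, s1 <= s <= s2 -> ~ boundary A (s - m * t, t)) ->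
  forall s, s1 <= s <= s2 -> A (s1 - m * t, t) <-> A (s - m * t, t).
Proof.
move=> s12 nb s /andP[s1s ss2]; apply: same_sideP => k /andP[k0 k1].
have -> : (s1 - m * t, t) + k *: ((s - m * t, t) - (s1 - m * t, t)) =
    ((s1 + k * (s - s1) - m * t, t) : plane).
  by apply: planeP; rewrite !planeE /=; ring.
apply: nb; have ks0 : 0 <= k * (s - s1) by rewrite mulr_ge0// subr_ge0.
have ks1 : k * (s - s1) <= s - s1 by rewrite ler_piMl// subr_ge0.
by apply/andP; split; lra.
Qed.

(** A segment without boundary points lies either in the interior, where the mean value theorem
    applies, or outside of [A], where [h] is zero. *)
Lemma horizontal_lipschitz A h (L : R) m t (s1 s2 : R) : regular_on A h ->
  (forall z, interior A z ->
     exists2 d : R, is_derive z ((1, 0) : plane) h d & `|d| <= L) ->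
  0 <= L -> s1 <= s2 ->
  (forall s, s1 <= s <= s2 -> ~ boundary A (s - m * t, t)) ->
  `|h (s2 - m * t, t) - h (s1 - m * t, t)| <= L * (s2 - s1).
Proof.
move=> rh HL L0 s12 nb; have [_ h0 _ _] := rh.
have same := horizontal_sideP s12 nb.
have [A1|nA1] := pselect (A (s1 - m * t, t)); last first.
  have nA2 : ~ A (s2 - m * t, t) by move=> /(same s2); rewrite s12 lexx => /(_ isT).
  by rewrite !h0// subrr normr0 mulr_ge0// subr_ge0.
have iA s : s1 <= s <= s2 -> interior A (s - m * t, t).
  move=> s12'; have As : A (s - m * t, t) by apply/(same s).
  apply: contrapT => ni; apply: (nb s s12'); split => //; exact: subset_closure.
have D s : s1 <= s <= s2 -> is_derive s 1 (fun x => h (x - m * t, t))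
    ('D_1 (fun x => h (x - m * t, t)) s) /\ `|'D_1 (fun x => h (x - m * t, t)) s| <= L.
  move=> /iA /HL [d /is_derive_line [dd dE] dL].
  by rewrite dE; split => //; split.
have [||c cs ->] := @MVT_segment R (fun x => h (x - m * t, t))
  (fun s => 'D_1 (fun x => h (x - m * t, t)) s) s1 s2 s12.
- move=> x /[!in_itv]/= /andP[h1 h2].
  have xs : s1 <= x <= s2 by rewrite !ltW.
  by have [] := D x xs.
- apply: derivable_within_continuous => x /[!in_itv]/= xs.
  by have [[]] := D x xs.
rewrite normrM [X in _ * X]ger0_norm ?subr_ge0// ler_wpM2r ?subr_ge0//.
by rewrite in_itv/= in cs; have [] := D c cs.
Qed.

(** The quotient is a forward minus a backward difference quotient, and both tend to the same
    derivative. *)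
Lemma second_diff_cvg0 A h (L : R) m s t (eps : nat -> R) : regular_on A h ->
  (forall z, interior A z ->
     exists2 d : R, is_derive z ((1, 0) : plane) h d & `|d| <= L) ->
  ~ boundary A (s - m * t, t) ->
  (forall n, 0 < eps n) -> eps n @[n --> \oo] --> 0 ->
  (eps n)^-1 * second_diff h m s (eps n) t @[n --> \oo] --> 0.
Proof.
move=> rh HL nb eps0 ceps; have [_ h0 _ _] := rh.
suff [d hd] : exists d : R, is_derive s 1 (fun x => h (x - m * t, t)) d.
  have [dd dE] := hd.
  pose q (k : R) := k^-1 *: (((fun x => h (x - m * t, t)) \o shift s) (k *: 1) - h (s - m * t, t)).
  have cq : q k @[k --> 0^'] --> d by rewrite -dE; exact: dd.
  have c1 : q (eps n) @[n --> \oo] --> d.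
    by move/cvgr_dnbhsP : cq; apply; split => // n; rewrite gt_eqF.
  have c2 : q (- eps n) @[n --> \oo] --> d.
    move/cvgr_dnbhsP : cq; apply; split => [n|]; first by rewrite lt_eqF// oppr_lt0.
    by rewrite -oppr0; exact: cvgN.
  have -> : (fun n => (eps n)^-1 * second_diff h m s (eps n) t) =
      (fun n => q (eps n) - q (- eps n)).
    apply/funext => n; rewrite /q /second_diff /= /GRing.scale /= invrN !mulr1.
    rewrite [eps n + s]addrC [- eps n + s]addrC; ring.
  by rewrite -(subrr d); exact: cvgB.
have [As|nAs] := pselect (A (s - m * t, t)).
  have iA : interior A (s - m * t, t).
    apply: contrapT => ni; apply: nb; split => //; exact: subset_closure.
  have [d hd _] := HL _ iA; exists d; exact: is_derive_line.
exists 0; have clA := regular_on_closed rh.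
have cg : (fun x : R => (x - m * t, t) : plane) x @[x --> s] --> ((s - m * t, t) : plane).
  have h1 : x - m * t @[x --> s] --> s - m * t by apply: cvgB; [exact: cvg_id|exact: cvg_cst].
  have h2 : t @[x --> s] --> t by exact: cvg_cst.
  exact: (cvg_pair h1 h2).
have dcst : is_derive s 1 (cst 0 : R -> R) 0 by exact: is_derive_cst.
apply: near_eq_is_derive dcst.
have no := open_nbhs_nbhs (conj (closed_openC clA) nAs).
have : \forall x \near s, (~` A) (x - m * t, t) by exact: (cg _ no).
by apply: filterS => x /h0 ->.
Qed.

End Horizontal.

(** * Splitting a line into windows around its crossings *)

Section LineJump.
Context {R : realType}.
Local Notation plane := (R * R)%type.
Local Notation mu := (@lebesgue_measure R).
Variables (V : finType) (v : V -> plane) (nx : V -> V) (A : set plane) (m : R).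
Hypothesis pA : polygonal v nx A.
Hypothesis transv : forall i, slope m (v (nx i) - v i) != 0.
Variable h : plane -> R.
Hypothesis rh : regular_on A h.
Variable s0 : R.
Implicit Types (i j : V) (w y z : plane) (s t u tau : R) (n : nat).

Local Notation ratio := (side_ratio v nx m).
Local Notation height := (height v nx m).

(** Bounds the speed of every crossing: when the level moves by at most [e], all crossings stay
    within [window_radius * e] of their heights at [s0]. The [1] makes it positive. *)
Definition window_radius : R := 1 + \sum_i `|ratio i|.
Local Notation C := window_radius.

(** The sides are prolonged to full lines, which adds harmless heights off the boundary. Duplicates,
    as at a vertex, are removed because the windows are summed over this list. *)
Definition crossings : seq R := undup [seq height i s0 | i <- enum V].

Lemma ratio_le i : `|ratio i| <= C.
Proof.
rewrite /window_radius (bigD1 i)//= addrCA lerDl addr_ge0// sumr_ge0//.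
Qed.

Lemma window_radius_ge0 : 0 <= C.
Proof. by rewrite addr_ge0// sumr_ge0. Qed.

Lemma height_crossing i : height i s0 \in crossings.
Proof. by rewrite mem_undup; apply/mapP; exists i; rewrite ?mem_enum. Qed.

Variable eps : nat -> R.
Hypothesis eps0 : forall n, 0 < eps n.
Hypothesis ceps : eps n @[n --> \oo] --> 0.
Hypothesis eps_sep : forall n tau tau', tau \in crossings -> tau' \in crossings ->
  tau != tau' -> 2 * C * eps n < `|tau - tau'|.

Local Notation D n := (second_diff h m s0 (eps n)).

Definition window n tau : set R := `[tau - C * eps n, tau + C * eps n]%classic.

(** By [eps_sep] the windows are disjoint, so that this is the indicator of the complement of their
    union. *)
Definition off_windows n t : R := 1 - \sum_(tau <- crossings) \1_(window n tau) t.

Lemma windowE n tau t : window n tau t <-> `|t - tau| <= C * eps n.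
Proof.
rewrite /window /= in_itv/= ler_norml; split => /andP[h1 h2]; apply/andP; split; lra.
Qed.

Lemma off_windowsP n t : off_windows n t = 0 \/
  (off_windows n t = 1 /\ forall tau, tau \in crossings -> ~ window n tau t).
Proof.
have [[tau [tauC tw]]|H] := pselect (exists tau, tau \in crossings /\ window n tau t).
  left; rewrite /off_windows (bigD1_seq tau)//= ?undup_uniq//.
  rewrite {1}/indic mem_set//= big_seq_cond big1 ?addr0 ?subrr//.
  move=> tau' /andP[tauC' tt']; rewrite /indic memNset//.
  move=> /windowE w'; move/windowE : tw => w1.
  have := eps_sep n tauC' tauC tt'; apply/negP; rewrite -leNgt.
  have -> : tau' - tau = (t - tau) - (t - tau') by ring.
  by apply: (le_trans (ler_normB _ _)); lra.
right; split; last by move=> tau tauC tw; apply: H; exists tau.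
rewrite /off_windows big_seq big1 ?subr0// => tau tauC.
by rewrite /indic memNset// => tw; apply: H; exists tau.
Qed.

Lemma off_windows_boundary n t : (forall tau, tau \in crossings -> ~ window n tau t) ->
  forall s, `|s - s0| <= eps n -> ~ boundary A (s - m * t, t).
Proof.
move=> H s ss0 bz.
have [i ti] : exists i, t = height i s.
  by have [i ti] := boundary_height pA transv bz; exists i; rewrite slope_line in ti.
apply: (H (height i s0)); first exact: height_crossing.
apply/windowE; rewrite {1}ti height_sub normrM mulrC.
by apply: ler_pM => //; exact: ratio_le.
Qed.

(** Outside the windows no boundary point is met between the levels [s0 - eps n] and [s0 + eps n],
    so that the Lipschitz bound dominates the quotient by [2 * L], while pointwise it tends to zero
    away from the crossings. *)
Lemma off_windows_cvg :
  \int[mu]_t ((eps n)^-1 * D n t * off_windows n t) @[n --> \oo] --> 0.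
Proof.
have [_ _ _ [L0 HL0]] := rh.
pose L : R := Num.max L0 0.
have L_ge0 : 0 <= L by rewrite le_max lexx orbT.
have HL z : interior A z -> exists2 d : R, is_derive z ((1, 0) : plane) h d & `|d| <= L.
  by move=> /HL0 [d hd dL]; exists d => //; rewrite le_max dL.
have bh := regular_on_bounded_supp2 rh; have [mh [B [S hBS]]] := bh.
have bD n : bounded_supp (D n) by exact: bounded_supp_second_diff.
have -> : 0 = \int[mu]_t (fun=> 0 : R) t.
  by rewrite Rintegral_cst// mul0r.
have mI n tau : measurable_fun setT (\1_(window n tau) : R -> R).
  by apply: measurable_indic; exact: measurable_itv.
apply: (@dominated_Rintegral _ _ _ (fun t => 2 * L * \1_(`[- S, S]%classic : set R) t)
   [set` crossings]).
- by apply: finite_set_countable; exact: finite_seq.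
- move=> n; apply: measurable_funM.
    by apply: measurable_funM => //; have [] := bD n.
  apply: measurable_funB => //; exact: measurable_sum.
- by [].
- by apply: bounded_suppM; [exact: cst_continuous|exact: bounded_supp_indic].
- move=> n t; have [->|[-> off]] := off_windowsP n t.
    by rewrite mulr0 normr0 mulr_ge0// mulr_ge0.
  rewrite mulr1.
  have [tS|St] := leP `|t| S; last first.
    have h0 s : h (s - m * t, t) = 0.
      by apply: contrapT => /(proj2 (hBS _)) [_ /=]; rewrite leNgt St.
    by rewrite /second_diff !h0 mulr0 addr0 subrr mulr0 normr0 mulr_ge0// mulr_ge0.
  have -> : \1_(`[- S, S]%classic : set R) t = 1 :> R.
    by rewrite /indic mem_set//= in_itv/= -ler_norml.
  rewrite mulr1 normrM gtr0_norm ?invr_gt0// mulrC ler_pdivrMr//.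
  have nb := off_windows_boundary off; have e0 := eps0 n.
  have l1 : `|h (s0 + eps n - m * t, t) - h (s0 - m * t, t)| <= L * eps n.
    have -> : L * eps n = L * (s0 + eps n - s0) by ring.
    apply: (horizontal_lipschitz rh HL) => //; first by rewrite lerDl ltW.
    move=> s /andP[h1 h2]; apply: nb; rewrite ler_norml; apply/andP; split; lra.
  have l2 : `|h (s0 - m * t, t) - h (s0 - eps n - m * t, t)| <= L * eps n.
    have -> : L * eps n = L * (s0 - (s0 - eps n)) by ring.
    apply: (horizontal_lipschitz rh HL) => //; first by rewrite gerDl oppr_le0 ltW.
    move=> s /andP[h1 h2]; apply: nb; rewrite ler_norml; apply/andP; split; lra.
  rewrite /second_diff.
  set a := h (s0 + _ - _, t) in l1 *; set b := h (s0 - eps n - _, t) in l2 *.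
  set c := h _ in l1 l2 *.
  have -> : a + b - 2 * c = (a - c) - (c - b) by ring.
  by apply: (le_trans (ler_normB _ _)); lra.
- move=> t tC.
  have nb : ~ boundary A (s0 - m * t, t).
    move=> bz; apply: tC.
    have [i ti] := boundary_height pA transv bz; rewrite slope_line /= in ti.
    by rewrite /= ti; exact: height_crossing.
  have := second_diff_cvg0 rh HL nb eps0 ceps.
  have bounded : forall n, `|off_windows n t| <= 1.
    by move=> n; have [->|[-> _]] := off_windowsP n t; rewrite ?normr0 ?normr1.
  move=> /cvgr0Pnorm_lt H; apply/cvgr0Pnorm_lt => e e0.
  apply: filterS (H e e0) => n; apply: le_lt_trans.
  by rewrite normrM ler_piMr.
Qed.

Lemma second_difference_split n :
  (eps n)^-1 * (line_integral h m (s0 + eps n) + line_integral h m (s0 - eps n) -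
     2 * line_integral h m s0) =
  \int[mu]_t ((eps n)^-1 * D n t * off_windows n t) +
  \sum_(tau <- crossings) (eps n)^-1 * \int[mu]_t (D n t * \1_(window n tau) t).
Proof.
have bh := regular_on_bounded_supp2 rh.
have bD : bounded_supp (D n) by exact: bounded_supp_second_diff.
have bl s := bounded_supp_line m s bh.
have bsZ (k : R) g : bounded_supp g -> bounded_supp (fun x => k * g x).
  by apply: bounded_suppM; exact: cst_continuous.
have bDI tau : bounded_supp (fun t => D n t * \1_(window n tau) t).
  exact: bounded_supp_mul_indic.
have -> : line_integral h m (s0 + eps n) + line_integral h m (s0 - eps n) -
     2 * line_integral h m s0 = \int[mu]_t D n t.
  rewrite /second_diff RintegralB//; last 2 first.
  - by apply: integrable_bounded_supp1; exact: bounded_suppD.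
  - by apply: integrable_bounded_supp1; exact: bsZ.
  rewrite RintegralD//; try exact: integrable_bounded_supp1.
  by rewrite RintegralZl//; exact: integrable_bounded_supp1.
have sumE (r : seq R) : bounded_supp (fun t => D n t * \sum_(tau <- r) \1_(window n tau) t) /\
    \int[mu]_t (D n t * \sum_(tau <- r) \1_(window n tau) t) =
    \sum_(tau <- r) \int[mu]_t (D n t * \1_(window n tau) t).
  elim: r => [|tau r [br IH]].
    have E0 : (fun t => D n t * \sum_(tau <- [::]) \1_(window n tau) t) = (fun=> 0).
      by apply/funext => t; rewrite big_nil mulr0.
    split; first by rewrite E0; split => //; exists 0, 0 => x; rewrite normr0.
    by rewrite big_nil E0 Rintegral_cst// mul0r.
  have Ec : (fun t => D n t * \sum_(tau <- tau :: r) \1_(window n tau) t) =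
     (fun t => D n t * \1_(window n tau) t + D n t * \sum_(tau <- r) \1_(window n tau) t).
    by apply/funext => t; rewrite big_cons mulrDr.
  split; first by rewrite Ec; exact: bounded_suppD.
  by rewrite big_cons Ec RintegralD ?IH//; exact: integrable_bounded_supp1.
have [bs sE] := sumE crossings.
rewrite -mulr_sumr -sE.
have -> : \int[mu]_t ((eps n)^-1 * D n t * off_windows n t) =
    (eps n)^-1 * \int[mu]_t (D n t - D n t * \sum_(tau <- crossings) \1_(window n tau) t).
  rewrite -RintegralZl//.
    by apply: eq_Rintegral => t _; rewrite /off_windows; ring.
  by apply: integrable_bounded_supp1; apply: bounded_suppD => //; exact: bounded_suppN.
rewrite -mulrDr RintegralB//; try exact: integrable_bounded_supp1.
by rewrite subrK.
Qed.

Lemma second_difference_cvg (kappa : R -> R) :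
  (forall tau, tau \in crossings ->
    (eps n)^-1 * \int[mu]_t (D n t * \1_(window n tau) t) @[n --> \oo] --> kappa tau) ->
  (eps n)^-1 * (line_integral h m (s0 + eps n) + line_integral h m (s0 - eps n) -
     2 * line_integral h m s0) @[n --> \oo] --> \sum_(tau <- crossings) kappa tau.
Proof.
move=> H.
have -> : (fun n => (eps n)^-1 * (line_integral h m (s0 + eps n) +
     line_integral h m (s0 - eps n) - 2 * line_integral h m s0)) =
   (fun n => \int[mu]_t ((eps n)^-1 * D n t * off_windows n t) +
  \sum_(tau <- crossings) (eps n)^-1 * \int[mu]_t (D n t * \1_(window n tau) t)).
  by apply/funext => n; exact: second_difference_split.
rewrite -[X in _ --> X]add0r; apply: cvgD; first exact: off_windows_cvg.
elim: crossings H => [|tau r IH] H.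
  have -> : (fun n => \sum_(tau <- [::]) (eps n)^-1 *
      \int[mu]_t (D n t * \1_(window n tau) t)) = (fun=> 0).
    by apply/funext => n; rewrite big_nil.
  by rewrite big_nil; exact: cvg_cst.
have -> : (fun n => \sum_(tau <- tau :: r) (eps n)^-1 *
      \int[mu]_t (D n t * \1_(window n tau) t)) =
   (fun n => (eps n)^-1 * \int[mu]_t (D n t * \1_(window n tau) t) +
     \sum_(tau <- r) (eps n)^-1 * \int[mu]_t (D n t * \1_(window n tau) t)).
  by apply/funext => n; rewrite big_cons.
rewrite big_cons; apply: cvgD; first by apply: H; rewrite mem_head.
by apply: IH => tau' tr; apply: H; rewrite inE tr orbT.
Qed.

End LineJump.

(** * The contribution of a single window *)

Section VertexJump.
Context {R : realType}.
Local Notation plane := (R * R)%type.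
Local Notation mu := (@lebesgue_measure R).
Variables (V : finType) (v : V -> plane) (nx : V -> V) (A : set plane) (m : R).
Hypothesis pA : polygonal v nx A.
Hypothesis transv : forall i, slope m (v (nx i) - v i) != 0.
Variable h : plane -> R.
Hypothesis rh : regular_on A h.
Variables (s0 : R) (eps : nat -> R).
Hypothesis eps0 : forall n, 0 < eps n.
Hypothesis ceps : eps n @[n --> \oo] --> 0.
Implicit Types (i j : V) (w y z d : plane) (s t u tau : R) (n : nat) (sg : bool).

Local Notation C := (window_radius v nx m).
Local Notation D n := (second_diff h m s0 (eps n)).
Local Notation window := (window v nx m eps).
Local Notation window_integral tau :=
  (fun n => (eps n)^-1 * \int[mu]_t (D n t * \1_(window n tau) t)).

Lemma cross_wdir d s u : slope m d != 0 ->
  cross d (wdir m s u) = slope m d * (u - s * (d.2 / slope m d)).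
Proof.
move=> d0; have -> : slope m d * (u - s * (d.2 / slope m d)) = slope m d * u - s * d.2.
  by field.
by rewrite /cross /wdir /slope /=; ring.
Qed.

Lemma crossZr d w t : cross d (t *: w) = t * cross d w.
Proof. by rewrite /cross !planeE; ring. Qed.

Lemma side_ratioE i : (v (nx i) - v i).2 / slope m (v (nx i) - v i) = side_ratio v nx m i.
Proof. by []. Qed.

(** On an open side the tangent cone is a half-plane, whose section ends at a point linear in the
    level and has zero second difference. Off the boundary the section does not depend on the
    level. *)
Lemma nonvertex_jump tau : (forall i, (s0 - m * tau, tau) <> v i) ->
  window_integral tau n @[n --> \oo] --> 0.
Proof.
set y := (s0 - m * tau, tau) => nv.
have C0 := window_radius_ge0 v nx m.
have [by_|nb] := pselect (boundary A y).
- have [_ _ _ _ [_ bE]] := pA.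
  move: (by_); rewrite bE => -[i _ [t /= /[!in_itv]/= /andP[t0 t1] yE]].
  pose d := v (nx i) - v i.
  have t01 : 0 < t < 1.
    apply/andP; split; rewrite lt_neqAle ?t0 ?t1 andbT; apply/eqP => te.
      by apply: (nv i); rewrite -yE -te scale0r addr0.
    by apply: (nv (nx i)); rewrite -yE te scale1r addrC subrK.
  have [sg [r r0 Hr]] := open_side_cells pA i t01.
  have d0 : slope m d != 0 by exact: transv.
  pose q : R := side_ratio v nx m i.
  have qC : - C <= q <= C by rewrite -ler_norml ratio_le.
  have rat s u : cross d (wdir m s u) = slope m d * (u - s * q) by exact: cross_wdir.
  have sq s : s = 1 \/ s = -1 \/ s = 0 -> - C <= s * q <= C.
    by move: qC C0 => /andP[h1 h2] h3 [|[|]] ->; apply/andP; split; lra.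
  (* The half-plane to the left of [d] cuts the line above or below [s * q] according to the sign of
     [slope m d]; [C] truncates the ray. *)
  pose xs s : R := if 0 < slope m d then s * q else - C.
  pose ys s : R := if 0 < slope m d then C else s * q.
  have := @local_jump R A h m s0 tau C [set w | 0 < cross d w]
    [set w | cross d w < 0] sg xs ys eps rh _ _ _ C0 _ eps0 ceps.
  have -> : (ys 1 - xs 1) + (ys (-1) - xs (-1)) - 2 * (ys 0 - xs 0) = 0.
    by rewrite /xs /ys; case: ifP => _; ring.
  rewrite mulr0; apply.
  + by move=> k w k0 /=; rewrite crossZr; exact: mulr_gt0.
  + by move=> k w k0 /=; rewrite crossZr pmulr_rlt0.
  + by exists r => // w /Hr[_]; rewrite /= yE.
  + move=> s /sq /andP[s1 s2]; rewrite /xs /ys; case: ifP => dp; split => //.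
    * move=> u uC u1 u2; rewrite /= !rat; case: ifP => [/andP[h1 h2]|/negbT].
        by rewrite mulr_gt0// subr_gt0.
      rewrite negb_and -!leNgt => /orP[h1|h1].
        by rewrite pmulr_rlt0// subr_lt0 lt_neqAle u1.
      by move: uC => /andP[_ uC]; move: u2; rewrite eq_le uC h1.
    * have dn : slope m d < 0 by rewrite lt_neqAle d0 leNgt dp.
      move=> u uC u1 u2; rewrite /= !rat; case: ifP => [/andP[h1 h2]|/negbT].
        by rewrite nmulr_rgt0// subr_lt0.
      rewrite negb_and -!leNgt => /orP[h1|h1].
        by move: uC => /andP[uC _]; move: u1; rewrite eq_le uC h1.
      by rewrite nmulr_rlt0// subr_gt0 lt_neqAle eq_sym u2.
- have [sg Hsg] : exists sg : bool, exists2 r : R, 0 < r & forall w, box r w -> (A (y + w) <-> sg).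
    have clA := regular_on_closed rh.
    have [Ay|nAy] := pselect (A y).
      have : nbhs y (interior A).
        apply: open_nbhs_nbhs; split; first exact: open_interior.
        by apply: contrapT => ni; apply: nb; split => //; exact: subset_closure.
      move=> /nbhs_boxP[r r0 H]; exists true, r => // w wr; split => // _.
      by apply: interior_subset; exact: H.
    have := open_nbhs_nbhs (conj (closed_openC clA) nAy).
    by move=> /nbhs_boxP[r r0 H]; exists false, r => // w /H /=; split.
  have := @local_jump R A h m s0 tau C setT set0 sg (fun=> - C) (fun=> C) eps rh _ _ _ C0 _ eps0 ceps.
  have -> : (C - - C) + (C - - C) - 2 * (C - - C) = 0 by ring.
  rewrite mulr0; apply=> //.
  + by move: Hsg => [r r0 H]; exists r => // w /H; split.
  + move=> s _; split; rewrite ?lexx//; first by lra.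
    move=> u /andP[u1 u2] u3 u4; rewrite lt_neqAle eq_sym u3 u1 lt_neqAle u4 u2.
    by [].
Qed.

Lemma coord1Z d1 d2 w t : coord1 d1 d2 (t *: w) = t * coord1 d1 d2 w.
Proof. by rewrite /coord1 /cross !planeE; ring. Qed.

Lemma coord2Z d1 d2 w t : coord2 d1 d2 (t *: w) = t * coord2 d1 d2 w.
Proof. by rewrite /coord2 /cross !planeE; ring. Qed.

(** If the two sides project to the same direction, the wedge meets one of the levels [1] and [-1]
    in an interval of length [|r2 - r1|] and the other not at all. If they project to opposite
    directions, every section is a ray, and truncation at [C] leaves the second difference
    [- |r2 - r1|]. Both cases agree with the formula, because [r2 - r1] is [cross d1 d2] over the
    product of the projections. *)
Lemma vertex_jump i j sg : nx j = i -> s0 = slope m (v i) ->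
  let d1 := v (nx i) - v i in let d2 := v j - v i in
  local_model A (v i) (wedge d1 d2) (cowedge d1 d2) sg ->
  window_integral (v i).2 n @[n --> \oo] -->
    h (v i) * (if sg then 1 else -1) *
      (`|cross d1 d2| / (slope m d1 * slope m d2)).
Proof.
move=> ji s0E d1 d2 mod.
have C0 := window_radius_ge0 v nx m.
set tau := (v i).2.
have yE : (s0 - m * tau, tau) = v i.
  by apply: planeP; rewrite /= ?s0E /slope /tau; ring.
have cr0 : cross d1 d2 != 0 by exact: (vertex_cross pA ji).
have p1 : slope m d1 != 0 by exact: transv.
have d2E : d2 = - (v (nx j) - v j) by rewrite ji /d2 opprB.
have p2 : slope m d2 != 0 by rewrite d2E slopeN oppr_eq0; exact: transv.
pose r1 : R := d1.2 / slope m d1; pose r2 : R := d2.2 / slope m d2.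
have r1C : - C <= r1 <= C by rewrite -ler_norml /r1 /d1 side_ratioE ratio_le.
have r2C : - C <= r2 <= C.
  rewrite -ler_norml /r2 d2E slopeN invrN !planeE mulrNN.
  exact: (ratio_le v nx m j).
set cr := cross d1 d2.
(* At level [s] the wedge is cut out by [0 < a2 * (s * r2 - u)] and [0 < a1 * (u - s * r1)]; the
   four sign patterns of [a1] and [a2] are the cases below. *)
pose a1 : R := slope m d1 / cr; pose a2 : R := slope m d2 / cr.
have c1E s u : coord1 d1 d2 (wdir m s u) = a2 * (s * r2 - u).
  rewrite /coord1 (_ : cross (wdir m s u) d2 = - cross d2 (wdir m s u)); last first.
    by rewrite /cross; ring.
  by rewrite cross_wdir// -/r2 /a2 -/cr; ring.
have c2E s u : coord2 d1 d2 (wdir m s u) = a1 * (u - s * r1).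
  by rewrite /coord2 cross_wdir// -/r1 /a1 -/cr; ring.
have a10 : a1 != 0 by rewrite /a1 mulf_neq0 ?invr_eq0.
have a20 : a2 != 0 by rewrite /a2 mulf_neq0 ?invr_eq0.
have rr : r2 - r1 = cr / (slope m d1 * slope m d2).
  rewrite /r1 /r2 /cr /cross; rewrite /slope in p1 p2 *; field.
  by rewrite p1 p2.
have srC s : s = 1 \/ s = -1 \/ s = 0 -> (- C <= s * r1 <= C) /\ (- C <= s * r2 <= C).
  move: r1C r2C C0 => /andP[h1 h2] /andP[h3 h4] h5.
  by move=> [|[|]] ->; split; apply/andP; split; lra.
have aa : a1 * a2 = (slope m d1 * slope m d2) / cr ^+ 2 by rewrite /a1 /a2; field.
have cr2 : 0 < cr ^+ 2 by rewrite lt_def sqr_ge0 sqrf_eq0 cr0.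
(* the section of the wedge at level [s] is the interval [xs s, ys s] *)
pose mn s : R := Num.min (s * r1) (s * r2).
pose mx s : R := Num.max (s * r1) (s * r2).
pose xs s : R := if 0 < a1 then (if 0 < a2 then s * r1 else mx s)
                 else (if 0 < a2 then - C else s * r2).
pose ys s : R := if 0 < a1 then (if 0 < a2 then mx s else C)
                 else (if 0 < a2 then mn s else mx s).
have mxC s : s = 1 \/ s = -1 \/ s = 0 -> - C <= mx s <= C.
  by move=> /srC[/andP[h1 h2] /andP[h3 h4]]; rewrite /mx le_max ge_max h1 h2 h4.
have mnC s : s = 1 \/ s = -1 \/ s = 0 -> - C <= mn s <= C.
  by move=> /srC[/andP[h1 h2] /andP[h3 h4]]; rewrite /mn ge_min le_min h1 h2 h3.
have := @local_jump R A h m s0 tau C (wedge d1 d2) (cowedge d1 d2) sg xs ys eps rh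
  _ _ _ C0 _ eps0 ceps.
rewrite yE.
rewrite (_ : (ys 1 - xs 1) + (ys (-1) - xs (-1)) - 2 * (ys 0 - xs 0) =
   `|cr| / (slope m d1 * slope m d2)); last first.
  have mx0 : mx 0 = 0 by rewrite /mx !mul0r maxxx.
  have mn0 : mn 0 = 0 by rewrite /mn !mul0r minxx.
  have mxs : mx 1 + mx (-1) = `|r2 - r1|.
    rewrite /mx !mul1r !mulN1r; case: (leP r1 r2) => r12.
      by rewrite max_l ?lerN2// ger0_norm ?subr_ge0.
    by rewrite max_r ?lerN2 ?(ltW r12)// ltr0_norm ?subr_lt0// opprB.
  have mns : mn 1 + mn (-1) = - `|r2 - r1|.
    rewrite /mn !mul1r !mulN1r; case: (leP r1 r2) => r12.
      by rewrite min_r ?lerN2// ger0_norm ?subr_ge0// opprB.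
    by rewrite min_l ?lerN2 ?(ltW r12)// ltr0_norm ?subr_lt0// opprK.
  have P0 : slope m d1 * slope m d2 != 0 by rewrite mulf_neq0.
  have Ppos : 0 < a1 * a2 -> `|cr| / (slope m d1 * slope m d2) = `|r2 - r1|.
    rewrite aa pmulr_lgt0 ?invr_gt0// => P1.
    by rewrite rr normrM normfV (gtr0_norm P1).
  have Pneg : a1 * a2 < 0 -> `|cr| / (slope m d1 * slope m d2) = - `|r2 - r1|.
    rewrite aa pmulr_llt0 ?invr_gt0// => P1.
    by rewrite rr normrM normfV (ltr0_norm P1) invrN mulrN opprK.
  rewrite /xs /ys mx0 mn0 !mul0r.
  have lt0N (a : R) : a != 0 -> (0 < a) = false -> a < 0.
    by move=> an0 /negbT; rewrite -leNgt lt_neqAle an0.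
  case: ifP => A1; case: ifP => A2.
  - have aa0 : 0 < a1 * a2 by exact: mulr_gt0.
    by rewrite (Ppos aa0) -mxs; ring.
  - have aa0 : a1 * a2 < 0 by rewrite pmulr_rlt0//; exact: lt0N A2.
    by rewrite (Pneg aa0) -mxs; ring.
  - have aa0 : a1 * a2 < 0 by rewrite pmulr_llt0//; exact: lt0N A1.
    by rewrite (Pneg aa0) -mns; ring.
  - have aa0 : 0 < a1 * a2 by rewrite nmulr_rgt0; [exact: lt0N A2|exact: lt0N A1].
    by rewrite (Ppos aa0) -mxs; ring.
apply.
- move=> k w k0 [h1 h2]; split; rewrite ?coord1Z ?coord2Z mulr_gt0//.
- move=> k w k0 [h1|h2]; [left|right]; rewrite ?coord1Z ?coord2Z pmulr_rlt0//.
- exact: mod.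
- move=> s ss; have [/andP[s1 s2] /andP[s3 s4]] := srC s ss.
  have /andP[s5 s6] := mxC s ss; have /andP[s7 s8] := mnC s ss.
  have mx1 : s * r1 <= mx s by rewrite le_max lexx.
  have mx2 : s * r2 <= mx s by rewrite le_max lexx orbT.
  have mn1 : mn s <= s * r1 by rewrite ge_min lexx.
  have mn2 : mn s <= s * r2 by rewrite ge_min lexx orbT.
  have mxE u : u < mx s -> u < s * r1 \/ u < s * r2 by rewrite lt_max => /orP.
  have mnE u : mn s < u -> s * r1 < u \/ s * r2 < u by rewrite gt_min => /orP.
  have lt0N (a : R) : a != 0 -> (0 < a) = false -> a < 0.
    by move=> an0 /negbT; rewrite -leNgt lt_neqAle an0.
  have W u : 0 < a2 * (s * r2 - u) -> 0 < a1 * (u - s * r1) -> wedge d1 d2 (wdir m s u).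
    by move=> h1 h2; split; rewrite ?c1E ?c2E.
  have CW1 u : a2 * (s * r2 - u) < 0 -> cowedge d1 d2 (wdir m s u).
    by move=> h1; left; rewrite c1E.
  have CW2 u : a1 * (u - s * r1) < 0 -> cowedge d1 d2 (wdir m s u).
    by move=> h1; right; rewrite c2E.
  rewrite /xs /ys; case: ifP => A1; case: ifP => A2; split => //.
  + move=> u /andP[u1 u2] ux uy; case: ifP => [/andP[h1 h2]|/negbT].
      apply: W; rewrite pmulr_rgt0// subr_gt0//.
      by case: (mxE u h2) => // /(lt_trans h1); rewrite ltxx.
    rewrite negb_and -!leNgt => /orP[h1|h1].
      by apply: CW2; rewrite pmulr_rlt0// subr_lt0 lt_neqAle ux.
    apply: CW1; rewrite pmulr_rlt0// subr_lt0.
    by apply: (le_lt_trans mx2); rewrite lt_neqAle eq_sym uy.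
  + have {}A2 := lt0N _ a20 A2.
    move=> u /andP[u1 u2] ux uy; case: ifP => [/andP[h1 h2]|/negbT].
      apply: W; [rewrite nmulr_rgt0// subr_lt0|rewrite pmulr_rgt0// subr_gt0].
        exact: le_lt_trans mx2 h1.
      exact: le_lt_trans mx1 h1.
    rewrite negb_and -!leNgt => /orP[h1|h1]; last by move: uy; rewrite eq_le u2 h1.
    have /mxE[k|k] : u < mx s by rewrite lt_neqAle ux.
      by apply: CW2; rewrite pmulr_rlt0// subr_lt0.
    by apply: CW1; rewrite nmulr_rlt0// subr_gt0.
  + have {}A1 := lt0N _ a10 A1.
    move=> u /andP[u1 u2] ux uy; case: ifP => [/andP[h1 h2]|/negbT].
      apply: W; [rewrite pmulr_rgt0// subr_gt0|rewrite nmulr_rgt0// subr_lt0].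
        exact: lt_le_trans h2 mn2.
      exact: lt_le_trans h2 mn1.
    rewrite negb_and -!leNgt => /orP[h1|h1]; first by move: ux; rewrite eq_le u1 h1.
    have /mnE[k|k] : mn s < u by rewrite lt_neqAle eq_sym uy.
      by apply: CW2; rewrite nmulr_rlt0// subr_gt0.
    by apply: CW1; rewrite pmulr_rlt0// subr_lt0.
  + have {}A1 := lt0N _ a10 A1; have {}A2 := lt0N _ a20 A2.
    move=> u /andP[u1 u2] ux uy; case: ifP => [/andP[h1 h2]|/negbT].
      apply: W; rewrite ?nmulr_rgt0// ?subr_lt0//.
      by case: (mxE u h2) => // /(lt_trans h1); rewrite ltxx.
    rewrite negb_and -!leNgt => /orP[h1|h1].
      by apply: CW1; rewrite nmulr_rlt0// subr_gt0 lt_neqAle ux.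
    apply: CW2; rewrite nmulr_rlt0// subr_gt0.
    by apply: (le_lt_trans mx1); rewrite lt_neqAle eq_sym uy.
Qed.

End VertexJump.

Section VertexLimit.
Context {R : realType}.
Local Notation plane := (R * R)%type.
Variables (V : finType) (v : V -> plane) (nx : V -> V) (A : set plane) (m : R).
Hypothesis pA : polygonal v nx A.
Hypothesis transv : forall i, slope m (v (nx i) - v i) != 0.
Hypothesis slope_inj : forall i j, slope m (v i) = slope m (v j) -> i = j.
Implicit Types (i j : V) (e : R).

Lemma separated_crossings s0 : exists2 e0 : R, 0 < e0 &
  forall e tau tau', 0 < e <= e0 ->
    tau \in crossings v nx m s0 -> tau' \in crossings v nx m s0 ->
    tau != tau' -> 2 * window_radius v nx m * e < `|tau - tau'|.
Proof.
set C := window_radius v nx m.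
have C0 : 0 < C by rewrite /C /window_radius ltr_pwDl// sumr_ge0.
have : \forall e \near (0 : R)^'+, forall ij : V * V,
    height v nx m ij.1 s0 != height v nx m ij.2 s0 ->
    2 * C * e < `|height v nx m ij.1 s0 - height v nx m ij.2 s0|.
  apply: (@filter_forall _ _ (fun (ij : V * V) e =>
    height v nx m ij.1 s0 != height v nx m ij.2 s0 ->
    2 * C * e < `|height v nx m ij.1 s0 - height v nx m ij.2 s0|) (0 : R)^'+) => -[i j] /=.
  have [->|hij] := eqVneq (height v nx m i s0) (height v nx m j s0).
    by near=> e.
  have c0 : 0 < `|height v nx m i s0 - height v nx m j s0| / (2 * C).
    by rewrite divr_gt0 ?mulr_gt0// normr_gt0 subr_eq0.
  have near_lt := nbhs_right_lt c0.
  by apply: filterS near_lt => e ec _; rewrite mulrC -ltr_pdivlMr ?mulr_gt0.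
move=> [e0 /= e00 H]; exists (e0 / 2); first by rewrite divr_gt0.
move=> e tau tau' /andP[e1 e2].
rewrite !mem_undup => /mapP[i _ ->] /mapP[j _ ->] hij.
apply: (H e _ _ (i, j)) => //.
by rewrite /= sub0r normrN gtr0_norm//; lra.
Unshelve. all: by end_near. Qed.

(** As projections separate vertices, [v i] is the only vertex on its line and every other crossing
    contributes zero. The threshold [e0] comes before the sequence, so that two sources can be
    compared along one sequence. *)
Lemma line_jump h i j (sg : bool) : regular_on A h -> nx j = i ->
  let d1 := v (nx i) - v i in let d2 := v j - v i in
  local_model A (v i) (wedge d1 d2) (cowedge d1 d2) sg ->
  exists2 e0 : R, 0 < e0 & forall eps : nat -> R,
    (forall n, 0 < eps n <= e0) -> eps n @[n --> \oo] --> 0 ->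
    let s0 := slope m (v i) in
    (eps n)^-1 * (line_integral h m (s0 + eps n) + line_integral h m (s0 - eps n) -
     2 * line_integral h m s0) @[n --> \oo] -->
    h (v i) * (if sg then 1 else -1) *
      (`|cross d1 d2| / (slope m d1 * slope m d2)).
Proof.
move=> rh ji d1 d2 mod; pose s0 := slope m (v i).
have [e0 e00 sep] := separated_crossings s0.
exists e0 => // eps heps ceps /=; rewrite -/s0.
have eps0 n : 0 < eps n by case/andP: (heps n).
have eps_sep n tau tau' := sep (eps n) tau tau' (heps n).
set K := h (v i) * _ * _.
pose kappa tau := if tau == (v i).2 then K else 0.
have -> : K = \sum_(tau <- crossings v nx m s0) kappa tau.
  have inc : (v i).2 \in crossings v nx m s0.
    have <- : height v nx m i s0 = (v i).2 by rewrite /height subrr mul0r addr0.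
    exact: height_crossing.
  rewrite (bigD1_seq (v i).2)//= ?undup_uniq// {1}/kappa eqxx big1 ?addr0//.
  by move=> tau /negPf tn; rewrite /kappa tn.
apply: (second_difference_cvg pA transv rh eps0 ceps eps_sep) => tau tauC.
rewrite /kappa; case: eqVneq => [->|tn].
  exact: (vertex_jump pA transv rh eps0 ceps ji erefl mod).
apply: (nonvertex_jump pA transv rh eps0 ceps) => k kE.
have ki : k = i by apply: slope_inj; rewrite -kE slope_line.
by move/eqP: tn; apply; rewrite -ki -kE.
Qed.

End VertexLimit.

(** * Sides and support from the corners *)

Section Lines.
Context {R : realType}.
Local Notation plane := (R * R)%type.
Implicit Types (d e : plane) (m : R).

Lemma quadratic_eq0 (a b c m1 m2 m3 : R) : m1 != m2 -> m2 != m3 -> m1 != m3 ->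
  a + b * m1 + c * m1 ^+ 2 = 0 -> a + b * m2 + c * m2 ^+ 2 = 0 ->
  a + b * m3 + c * m3 ^+ 2 = 0 -> [/\ a = 0, b = 0 & c = 0].
Proof.
move=> n12 n23 n13 E1 E2 E3.
have F12 : b + c * (m1 + m2) = 0.
  have d : m1 - m2 != 0 by rewrite subr_eq0.
  apply: (mulfI d); rewrite mulr0.
  transitivity ((a + b * m1 + c * m1 ^+ 2) - (a + b * m2 + c * m2 ^+ 2)); first by ring.
  by rewrite E1 E2 subrr.
have F13 : b + c * (m1 + m3) = 0.
  have d : m1 - m3 != 0 by rewrite subr_eq0.
  apply: (mulfI d); rewrite mulr0.
  transitivity ((a + b * m1 + c * m1 ^+ 2) - (a + b * m3 + c * m3 ^+ 2)); first by ring.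
  by rewrite E1 E3 subrr.
have c0 : c = 0.
  have d : m2 - m3 != 0 by rewrite subr_eq0.
  apply: (mulfI d); rewrite mulr0.
  transitivity ((b + c * (m1 + m2)) - (b + c * (m1 + m3))); first by ring.
  by rewrite F12 F13 subrr.
have b0 : b = 0 by move: F12; rewrite c0 mul0r addr0.
by split => //; move: E1; rewrite b0 c0 !mul0r !addr0.
Qed.

(** After clearing denominators, two products of linear forms in [(1, m)] agree at three values of
    [m], hence as quadratic forms. Evaluating at a vector orthogonal to [e1] kills one side, so that
    a factor of the other vanishes there: [d1] or [d2] is parallel to [e1]. Likewise for [e2]. *)
Lemma lines_determined (alpha beta : R) d1 d2 e1 e2 m1 m2 m3 : beta != 0 ->
  m1 != m2 -> m2 != m3 -> m1 != m3 ->
  (forall m, m = m1 \/ m = m2 \/ m = m3 ->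
     [/\ slope m d1 != 0, slope m d2 != 0, slope m e1 != 0 & slope m e2 != 0] /\
     alpha / (slope m d1 * slope m d2) = beta / (slope m e1 * slope m e2)) ->
  (cross d1 e1 = 0 \/ cross d2 e1 = 0) /\ (cross d1 e2 = 0 \/ cross d2 e2 = 0).
Proof.
move=> b0 n12 n23 n13 H.
pose qa := alpha * (e1.1 * e2.1) - beta * (d1.1 * d2.1).
pose qb := alpha * (e1.1 * e2.2 + e1.2 * e2.1) - beta * (d1.1 * d2.2 + d1.2 * d2.1).
pose qc := alpha * (e1.2 * e2.2) - beta * (d1.2 * d2.2).
have Q m : m = m1 \/ m = m2 \/ m = m3 -> qa + qb * m + qc * m ^+ 2 = 0.
  move=> /H[[h1 h2 h3 h4]] /eqP.
  rewrite eqr_div ?mulf_neq0// -subr_eq0 => /eqP E.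
  by rewrite -[RHS]E /qa /qb /qc /slope; ring.
have [a0 bb0 c0] := quadratic_eq0 n12 n23 n13 (Q _ (or_introl erefl))
  (Q _ (or_intror (or_introl erefl))) (Q _ (or_intror (or_intror erefl))).
(* The difference of the two forms, with coefficients [qa], [qb], [qc], is evaluated at
   [(e.2, - e.1)]. *)
have key (e : plane) : (e1.1 * e.2 - e1.2 * e.1) * (e2.1 * e.2 - e2.2 * e.1) = 0 ->
    cross d1 e = 0 \/ cross d2 e = 0.
  move=> E; have : beta * (cross d1 e * cross d2 e) = 0.
    transitivity (alpha * ((e1.1 * e.2 - e1.2 * e.1) * (e2.1 * e.2 - e2.2 * e.1)) -
      (qa * e.2 ^+ 2 - qb * (e.1 * e.2) + qc * e.1 ^+ 2)).
      by rewrite /qa /qb /qc /cross; ring.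
    by rewrite E a0 bb0 c0; ring.
  move=> /eqP; rewrite !mulf_eq0 (negPf b0) /= => /orP[/eqP ->|/eqP ->]; first by left.
  by right.
split; apply: key; first by rewrite (_ : _ - _ = 0) ?mul0r//; ring.
by rewrite [X in _ * X](_ : _ - _ = 0) ?mulr0//; ring.
Qed.

End Lines.

(** * Pairing the corners along a line *)

Section Matching.
Context {R : realType}.
Local Notation plane := (R * R)%type.
Implicit Types (x y z d : plane).

(* [S x y] stands for: [x] and [y] are the ends of a side. *)
Definition joins (N : nat) (P : 'I_N -> plane) (S : plane -> plane -> Prop) : Prop :=
  [/\ forall x y, S x y -> S y x,
      forall x y, S x y -> x <> y /\ range P x,
      forall x y z (t : R), S x y -> range P z -> z = x + t *: (y - x) -> ~ 0 < t < 1 &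
      forall x y y', S x y -> S x y' -> cross (y - x) (y' - x) = 0 -> y = y'].

(* Along a line, the sides pair off the corners consecutively; the first corner
   at which the two pairings could differ leads to a contradiction. *)
Lemma joins_sub (N : nat) (P : 'I_N -> plane) (S S' : plane -> plane -> Prop) d :
  joins P S -> joins P S' ->
  (forall x y, S x y -> exists2 y', S' x y' & cross (y - x) (y' - x) = 0) ->
  (forall x y, S' x y -> exists2 y', S x y' & cross (y - x) (y' - x) = 0) ->
  forall k x, (#|[pred n | (dot (P n) d < dot x d)%R]| < k)%N ->
    forall y (c : R), y - x = c *: d -> (S x y -> S' x y) /\ (S' x y -> S x y).
Proof.
move=> jS jS' SS' S'S; elim=> [//|k IH] x xk.
have step T T' : joins P T -> joins P T' ->
    (forall x y, T x y -> exists2 y', T' x y' & cross (y - x) (y' - x) = 0) ->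
    (forall x y (c : R), (#|[pred n | (dot (P n) d < dot x d)%R]| < k)%N ->
       y - x = c *: d -> (T x y -> T' x y) /\ (T' x y -> T x y)) ->
    forall y (c : R), y - x = c *: d -> T x y -> T' x y.
  move=> [symT neT midT uniT] [symT' neT' midT' uniT'] TT' IHT y c yE Txy.
  have d0 : d <> 0.
    move=> d0; have [+ _] := neT _ _ Txy; apply.
    by apply/esym/eqP; rewrite -subr_eq0 yE d0 scaler0.
  have dd : 0 < dot d d.
    rewrite /dot -!expr2 lt_def addr_ge0 ?sqr_ge0// andbT paddr_eq0 ?sqr_ge0//.
    rewrite !sqrf_eq0; apply/negP => /andP[/eqP h1 /eqP h2]; apply: d0.
    exact: planeP.
  (* The corner [z] is counted among those before [x] but not among those before itself, which makes
     the measure decrease. *)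
  have lower z (b : R) : z - x = b *: d -> b < 0 -> range P z ->
      (#|[pred n | (dot (P n) d < dot z d)%R]| < k)%N.
    move=> zE b0 [n _ Pn].
    have zx : dot z d < dot x d.
      have -> : z = x + b *: d by rewrite -zE addrC subrK.
      rewrite (_ : dot _ d = dot x d + b * dot d d); last by rewrite /dot !planeE; ring.
      by rewrite gtrDl pmulr_llt0.
    rewrite -ltnS; apply: leq_ltn_trans xk; apply: proper_card; apply/properP; split.
      by apply/fintype.subsetP => l; rewrite !inE => /lt_trans; apply.
    by exists n; rewrite !inE Pn ?ltxx.
  have cn0 (z : plane) (b : R) : z - x = b *: d -> z <> x -> b != 0.
    move=> zE zx; apply/eqP => b0; apply: zx; apply/eqP.
    by rewrite -subr_eq0 zE b0 scale0r.
  have c0 : c != 0 by apply: (cn0 y) => //; apply: nesym; have [] := neT _ _ Txy.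
  have [yx Py] := neT _ _ (symT _ _ Txy).
  have xyE (z : plane) (b : R) : z - x = b *: d -> x - z = (- b) *: d.
    by move=> zE; rewrite -opprB zE scaleNr.
  have [cneg|cpos|c00] := ltgtP c 0; last by rewrite c00 eqxx in c0.
    apply: symT'; have [H _] := IHT y x (- c) (lower y c yE cneg Py) (xyE _ _ yE).
    by apply: H; exact: symT.
  have [y' T'xy' cr] := TT' _ _ Txy.
  have [y'x Py'] := neT' _ _ (symT' _ _ T'xy').
  pose c' : R := dot (y' - x) d / dot d d.
  have y'E : y' - x = c' *: d.
    have crd : cross d (y' - x) = 0.
      apply: (mulfI c0); rewrite mulr0; transitivity (cross (c *: d) (y' - x)).
        by rewrite /cross !planeE; ring.
      by rewrite -yE.
    move: crd; rewrite /c' /cross /dot; move: (y' - x) => q crd.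
    have dd' : d.1 * d.1 + d.2 * d.2 != 0 by rewrite gt_eqF.
    apply: planeP; rewrite !planeE; apply: (mulIf dd'); rewrite mulrAC divfK//;
      apply/eqP; rewrite -subr_eq0; apply/eqP.
      transitivity (- d.2 * (d.1 * q.2 - d.2 * q.1)); first by ring.
      by rewrite crd mulr0.
    transitivity (d.1 * (d.1 * q.2 - d.2 * q.1)); first by ring.
    by rewrite crd mulr0.
  have c'0 : c' != 0 by exact: (cn0 y').
  have [c'neg|c'pos|c'00] := ltgtP c' 0; last by rewrite c'00 eqxx in c'0.
    have [_ H] := IHT y' x (- c') (lower y' c' y'E c'neg Py') (xyE _ _ y'E).
    have Txy' : T x y' by apply: symT; apply: H; exact: symT'.
    by rewrite (uniT _ _ _ Txy Txy' cr).
  have rel (z z' : plane) (b b' : R) : z - x = b *: d -> z' - x = b' *: d -> b' != 0 ->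
      z = x + (b / b') *: (z' - x).
    move=> zE z'E b'0; rewrite z'E scalerA divfK// -zE addrC subrK //.
  (* Both ends now lie beyond [x] on one ray; if they differed, the nearer one would be a corner
     inside the other side. *)
  have [cc'|cc'|cc'] := ltgtP c c'.
  - exfalso; apply: (midT' _ _ _ (c / c') T'xy' Py (rel _ _ _ _ yE y'E c'0)).
    by rewrite divr_gt0//= ltr_pdivrMr// mul1r.
  - exfalso; apply: (midT _ _ _ (c' / c) Txy Py' (rel _ _ _ _ y'E yE c0)).
    by rewrite divr_gt0//= ltr_pdivrMr// mul1r.
  - have -> : y = y' by apply: (addIr (- x)); rewrite yE y'E cc'.
    exact: T'xy'.
move=> y c yE; split.
  apply: (step S S' jS jS' SS') yE => x' y' c' x'k y'E; exact: IH y'E.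
apply: (step S' S jS' jS S'S) yE => x' y' c' x'k y'E.
by have [H1 H2] := IH _ x'k _ _ y'E; split.
Qed.

End Matching.

Section SideRelation.
Context {R : realType}.
Local Notation plane := (R * R)%type.
Implicit Types (A B : set plane) (x y z d w : plane) (m r s t a : R).

(** Orientation is forgotten, because two sets with the same sides may list them in opposite
    directions. *)
Definition side_rel (V : finType) (v : V -> plane) (nx : V -> V) x y : Prop :=
  exists i, (x = v i /\ y = v (nx i)) \/ (y = v i /\ x = v (nx i)).

Section OnePolygon.
Variables (V : finType) (v : V -> plane) (nx : V -> V) (A : set plane).
Hypothesis pA : polygonal v nx A.

Let v_inj : injective v. Proof. by case: pA => _ _ []. Qed.
Let nx_inj : injective nx. Proof. by case: pA => _ _ []. Qed.

Lemma side_rel_vertex i j y : nx j = i -> side_rel v nx (v i) y ->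
  y = v (nx i) \/ y = v j.
Proof.
move=> ji [k [[/v_inj <- ->]|[-> /v_inj E]]]; first by left.
by right; congr v; apply: nx_inj; rewrite ji.
Qed.

Lemma side_rel_cells x y a : side_rel v nx x y -> 0 < a < 1 ->
  let P := x + a *: (y - x) in
  exists sg : bool, exists2 r : R, 0 < r & forall w, box r w ->
    (boundary A (P + w) -> cross (y - x) w = 0) /\
    ((0 < cross (y - x) w -> (A (P + w) <-> sg)) /\
    (cross (y - x) w < 0 -> (A (P + w) <-> ~~ sg))).
Proof.
move=> [i [[-> ->]|[-> ->]]] a01; first exact: (open_side_cells pA i a01).
have a01' : 0 < 1 - a < 1 by move: a01 => /andP[a0 a1]; rewrite subr_gt0 a1 ltrBlDr ltrDl.
have [sg [r r0 H]] := open_side_cells pA i a01'.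
have PE : v (nx i) + a *: (v i - v (nx i)) = v i + (1 - a) *: (v (nx i) - v i).
  by apply: planeP; rewrite !planeE; ring.
exists (~~ sg), r => // w wr /=.
have crN : cross (v i - v (nx i)) w = - cross (v (nx i) - v i) w.
  by rewrite /cross !planeE; ring.
rewrite /= PE crN oppr_gt0 oppr_lt0 negbK; have [h0 [h1 h2]] := H w wr.
split; first by move=> /h0 ->; rewrite oppr0.
by split.
Qed.

Lemma side_rel_not_corner x y a : side_rel v nx x y -> 0 < a < 1 ->
  ~ corners A (x + a *: (y - x)).
Proof.
move=> [i [[-> ->]|[-> ->]]] a01; first exact: (open_side_not_corner pA a01).
have a01' : 0 < 1 - a < 1 by move: a01 => /andP[a0 a1]; rewrite subr_gt0 a1 ltrBlDr ltrDl.
have -> : v (nx i) + a *: (v i - v (nx i)) = v i + (1 - a) *: (v (nx i) - v i).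
  by apply: planeP; rewrite !planeE; ring.
exact: (open_side_not_corner pA a01').
Qed.

Lemma side_relC x y : side_rel v nx x y -> side_rel v nx y x.
Proof. by move=> [i [H|H]]; exists i; [right|left]. Qed.

Lemma side_rel_neq x y : side_rel v nx x y -> x <> y.
Proof.
have H i : v i <> v (nx i).
  by move=> E; have := side_neq pA i; rewrite -E subrr eqxx.
by move=> [i [[-> ->]|[-> ->]]]; [exact: H|exact: nesym (H i)].
Qed.

Lemma side_rel_joins (N : nat) (P : 'I_N -> plane) : range v = range P ->
  joins P (side_rel v nx).
Proof.
move=> vP; split.
- exact: side_relC.
- move=> x y xy; split; first exact: side_rel_neq xy.
  by rewrite -vP; case: xy => i [[-> _]|[_ ->]]; [exists i|exists (nx i)].
- move=> x y z t xy; rewrite -vP -(polygonal_corners pA) => cz zE t01.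
  by apply: (side_rel_not_corner xy t01); rewrite -zE.
- move=> x y y' xy xy' cr.
  have [i xi] : exists i, x = v i.
    by case: xy => i [[-> _]|[_ ->]]; [exists i|exists (nx i)].
  have [j ji] := nx_surj pA i.
  have c0 := vertex_cross pA ji.
  rewrite xi in xy xy' cr.
  have [Y|Y] := side_rel_vertex ji xy; have [Y'|Y'] := side_rel_vertex ji xy';
    rewrite Y Y' //; rewrite Y Y' in cr.
    by rewrite cr eqxx in c0.
  by rewrite crossC cr oppr0 eqxx in c0.
Qed.

Lemma boundary_side_rel z : boundary A z <->
  exists x y, side_rel v nx x y /\ segment x y z.
Proof.
have [_ _ _ _ [_ ->]] := pA; split.
  by move=> [i _ iz]; exists (v i), (v (nx i)); split => //; exists i; left.
move=> [x [y [[i [[-> ->]|[-> ->]]] xyz]]]; exists i => //.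
by rewrite segmentC.
Qed.

Lemma edges_side_rel : edges A =
  [set e | exists x y, side_rel v nx x y /\ e = segment x y].
Proof.
rewrite (polygonal_edges pA); apply/seteqP; split => e.
  by move=> [i ->]; exists (v i), (v (nx i)); split => //; exists i; left.
move=> [x [y [[i [[-> ->]|[-> ->]]] ->]]]; exists i => //.
by rewrite segmentC.
Qed.

End OnePolygon.

Lemma wedgeC d1 d2 w : wedge d1 d2 w -> wedge d2 d1 w.
Proof.
move=> [h1 h2]; split.
  by move: h2; rewrite /coord1 /coord2 [cross d2 d1]crossC [cross w d1]crossC invrN mulrNN.
by move: h1; rewrite /coord1 /coord2 [cross d2 d1]crossC [cross d2 w]crossC invrN mulrNN.
Qed.

(** * Two polygonal sets with the same sides *)

Section TwoPolygons.
Variables (V : finType) (v : V -> plane) (nx : V -> V) (A : set plane).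
Variables (V' : finType) (v' : V' -> plane) (nx' : V' -> V') (B : set plane).
Hypotheses (pA : polygonal v nx A) (pB : polygonal v' nx' B).
Hypotheses (cpA : compact A) (cpB : compact B).
Hypothesis same : forall x y, side_rel v nx x y <-> side_rel v' nx' x y.
Variable m : R.
Hypothesis transv : forall i, slope m (v (nx i) - v i) != 0.

Let clA : closed A. Proof. by case: pA. Qed.
Let clB : closed B. Proof. by case: pB. Qed.

Lemma same_boundaryP z : boundary A z <-> boundary B z.
Proof.
rewrite (boundary_side_rel pA) (boundary_side_rel pB).
by split => -[x [y [/same xy xyz]]]; exists x, y.
Qed.

Lemma off_boundary_near (D : set plane) z : closed D -> ~ boundary D z ->
  exists b : bool, exists2 r : R, 0 < r & forall w, box r w ->
    ~ boundary D (z + w) /\ (D (z + w) <-> b).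
Proof.
move=> clD nb; have [Dz|nDz] := pselect (D z).
  have : nbhs z (interior D).
    apply: open_nbhs_nbhs; split; first exact: open_interior.
    by apply: contrapT => ni; apply: nb; split => //; exact: subset_closure.
  move=> /nbhs_boxP[r r0 H]; exists true, r => // w wr; have iw := H w wr.
  by split; [case|split => // _; exact: interior_subset].
have := open_nbhs_nbhs (conj (closed_openC clD) nDz).
move=> /nbhs_boxP[r r0 H]; exists false, r => // w wr; have nw := H w wr.
by split; [move/(boundary_sub clD)|split].
Qed.

Section Line.
Variable s : R.
Hypothesis avoid : forall i, slope m (v i) != s.
Let pt t : plane := (s - m * t, t).

Let pt_shift t t' : pt t' = pt t + (t' - t) *: (- m, 1).
Proof. by apply: planeP; rewrite !planeE /pt /=; ring. Qed.

(** Both [agree] and [differ] hold vacuously at boundary points, so that either can persist through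
    a crossing. *)
Let agree t := ~ boundary A (pt t) -> (A (pt t) <-> B (pt t)).
Let differ t := ~ boundary A (pt t) -> ~ (A (pt t) <-> B (pt t)).

(** Off the boundary both memberships are locally constant. By [avoid], the line crosses the
    boundary only inside open sides, and transversally, so that both memberships switch there and
    their comparison is unchanged. That crossings are isolated keeps the two alternatives from
    holding at once. *)
Lemma line_dichotomy t : exists2 r : R, 0 < r &
  (forall t', 0 < `|t' - t| < r -> ~ boundary A (pt t')) /\
  ((forall t', `|t' - t| < r -> agree t') \/ (forall t', `|t' - t| < r -> differ t')).
Proof.
have near_line r : 0 < r -> exists2 e : R, 0 < e &
    forall t', `|t' - t| < e -> box r ((t' - t) *: (- m, 1)).
  move=> r0; have [e e0 he] := box_small (- m, 1) r0; exists e => // t' te.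
  have [h|h] := leP 0 (t' - t).
    by apply: he; rewrite h -(ger0_norm h).
  have -> : (t' - t) *: ((- m, 1) : plane) = - ((- (t' - t)) *: (- m, 1)).
    by rewrite scaleNr opprK.
  by apply: boxN; apply: he; rewrite oppr_ge0 (ltW h) -(ltr0_norm h).
have [bz|nb] := pselect (boundary A (pt t)); last first.
  have nb' : ~ boundary B (pt t) by move/same_boundaryP.
  have [b [r r0 H]] := off_boundary_near clA nb.
  have [b' [r' r'0 H']] := off_boundary_near clB nb'.
  have rr0 : 0 < Num.min r r' by rewrite lt_min r0.
  have [e e0 he] := near_line _ rr0.
  exists e => //; split.
    move=> t' /andP[_ /he tr]; rewrite (pt_shift t).
    have tr1 : box r ((t' - t) *: (- m, 1)) by apply: box_le tr; rewrite ge_min lexx.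
    by have [] := H _ tr1.
  have bb' t' : `|t' - t| < e -> (A (pt t') <-> b) /\ (B (pt t') <-> b').
    move=> /he tr; rewrite (pt_shift t).
    have tr1 : box r ((t' - t) *: (- m, 1)) by apply: box_le tr; rewrite ge_min lexx.
    have tr2 : box r' ((t' - t) *: (- m, 1)) by apply: box_le tr; rewrite ge_min lexx orbT.
    by have [_ h1] := H _ tr1; have [_ h2] := H' _ tr2.
  have [bE|bE] := eqVneq b b'; [left|right] => t' /bb' [h1 h2] _.
    by rewrite h1 h2 bE.
  by rewrite h1 h2; case: (b) (b') bE => -[] // _ [h3 h4];
      first [by have := h3 isT | by have := h4 isT].
have [_ _ _ _ [_ bE]] := pA.
have [i _ [a /= /[!in_itv]/= /andP[a0 a1] aE]] :
  (\bigcup_i segment (v i) (v (nx i))) (pt t) by rewrite -bE.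
have sa : slope m (v i + a *: (v (nx i) - v i)) = s by rewrite aE slope_line.
have a01 : 0 < a < 1.
  apply/andP; split; rewrite lt_neqAle ?a0 ?a1 andbT; apply/eqP => ae.
    by move: (avoid i); rewrite -sa -ae scale0r addr0 eqxx.
  by move: (avoid (nx i)); rewrite -sa ae scale1r addrC subrK eqxx.
have sA : side_rel v nx (v i) (v (nx i)) by exists i; left.
have sB : side_rel v' nx' (v i) (v (nx i)) by apply/same.
have [b [r r0 H]] := side_rel_cells pA sA a01.
have [b' [r' r'0 H']] := side_rel_cells pB sB a01.
rewrite /= aE in H H'.
have rr0 : 0 < Num.min r r' by rewrite lt_min r0.
have [e e0 he] := near_line _ rr0.
set d := v (nx i) - v i in H H'.
have cr t' : cross d ((t' - t) *: (- m, 1)) = (t' - t) * slope m d.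
  by rewrite /cross /slope !planeE /=; ring.
exists e => //.
have bb' t' : `|t' - t| < e -> t' != t -> ~ boundary A (pt t') /\
    exists c : bool, (A (pt t') <-> (c == b)) /\ (B (pt t') <-> (c == b')).
  move=> /he tr tt'; rewrite (pt_shift t).
  have tr1 : box r ((t' - t) *: (- m, 1)) by apply: box_le tr; rewrite ge_min lexx.
  have tr2 : box r' ((t' - t) *: (- m, 1)) by apply: box_le tr; rewrite ge_min lexx orbT.
  have cr0 : cross d ((t' - t) *: (- m, 1)) != 0.
    by rewrite cr mulf_neq0 ?subr_eq0//; exact: transv.
  have [h0 [h1 h2]] := H _ tr1; have [_ [h1' h2']] := H' _ tr2.
  split; first by move/h0 => E; rewrite E eqxx in cr0.
  have [lt0|gt0|E] := ltgtP (cross d ((t' - t) *: (- m, 1))) 0.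
  - by exists false; rewrite (h2 lt0) (h2' lt0); case: (b); case: (b').
  - by exists true; rewrite (h1 gt0) (h1' gt0); case: (b); case: (b').
  - by rewrite E eqxx in cr0.
split.
  move=> t' /andP[t0 te]; have tt' : t' != t by rewrite -subr_eq0 -normr_gt0.
  by case: (bb' t' te tt').
have [bb|bb] := eqVneq b b'; [left|right] => t' te; rewrite /agree /differ => nb.
  have tt' : t' != t by apply/eqP => E; apply: nb; rewrite E.
  have [_ [c [h1 h2]]] := bb' t' te tt'.
  by rewrite h1 h2 bb.
have tt' : t' != t by apply/eqP => E; apply: nb; rewrite E.
have [_ [c [-> ->]]] := bb' t' te tt'.
by case: c; case: (b) (b') bb => -[] //= _ [h3 h4];
  first [by have := h3 isT | by have := h4 isT].
Qed.

(** By the dichotomy the interiors of [agree] and [differ] are complementary open sets of the line,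
    and far away both points lie outside the compact sets. *)
Lemma agree_line t : agree t.
Proof.
have near_int (X : set R) u r : 0 < r -> (forall u', `|u' - u| < r -> X u') -> interior X u.
  move=> r0 H; apply/nbhs_ballP; exists r => // u' uu'; apply: H.
  by rewrite distrC.
suff TE : interior agree = [set: R].
  have it : interior agree t by rewrite TE.
  exact: interior_subset it.
have cR : connected [set: R] by apply/connected_intervalP => x y _ _ c _; exact: I.
apply: cR.
- have [SA [_ HA]] := compact_bounded cpA; have [SB [_ HB]] := compact_bounded cpB.
  pose S := Num.max (SA + 1) (SB + 1).
  have A2 z : A z -> `|z.2| <= SA + 1.
    by move=> Az; apply: (proj2 (norm_planeP (HA _ _ z Az))); rewrite ltrDl.
  have B2 z : B z -> `|z.2| <= SB + 1.
    by move=> Bz; apply: (proj2 (norm_planeP (HB _ _ z Bz))); rewrite ltrDl.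
  exists (`|S| + 1); apply: (near_int _ _ 1) => // u' u1 _.
  have uS : S < u'.
    move: u1; rewrite ltr_norml => /andP[u1 _].
    by have := ler_norm S; lra.
  have uS' : S < `|u'| by exact: lt_le_trans uS (ler_norm _).
  split => [/A2|/B2] /=.
    by move=> h; move: uS'; rewrite gt_max ltNge h.
  by move=> h; move: uS'; rewrite gt_max [X in _ && X]ltNge h andbF.
- by exists (interior agree); [exact: open_interior|rewrite setTI].
- exists (~` interior differ); first by apply: open_closedC; exact: open_interior.
  rewrite setTI; apply/seteqP; split => u.
    move=> ia id_; have [r r0 [off _]] := line_dichotomy u.
    have hn : nbhs u (agree `&` differ) by exact: filterI.
    move/nbhs_ballP : hn => [e /= e0 H].
    pose k := Num.min e r / 2.
    have k0 : 0 < Num.min e r by rewrite lt_min e0.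
    have kk : 0 < k by rewrite divr_gt0.
    have : k < Num.min e r by rewrite /k; lra.
    rewrite lt_min => /andP[ke kr].
    have nb : ~ boundary A (pt (u + k)).
      by apply: off; rewrite addrC addKr gtr0_norm// kk.
    have [] : (agree `&` differ) (u + k).
      by apply: H; rewrite /ball/= opprD addNKr normrN gtr0_norm.
    by move=> /(_ nb) h1 /(_ nb); apply.
  move=> nd; have [r r0 [_ [h|h]]] := line_dichotomy u; first exact: near_int h.
  by exfalso; apply: nd; exact: near_int h.
Qed.

End Line.

Lemma same_inside z : (forall i, slope m (v i) != slope m z) -> ~ boundary A z ->
  A z <-> B z.
Proof.
move=> av nb.
have zE : (slope m z - m * z.2, z.2) = z by apply: planeP; rewrite /slope /=; ring.
by have := @agree_line (slope m z) av z.2; rewrite /= zE; apply.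
Qed.

(** Compares both sets at one point of the wedge near the vertex whose line avoids all vertices. *)
Lemma same_vertex_sign i d1 d2 (sg sg' : bool) : cross d1 d2 != 0 ->
  slope m d2 != 0 ->
  (forall k, slope m (v k) = slope m (v i) -> k = i) ->
  (exists2 r : R, 0 < r & forall w, box r w -> wedge d1 d2 w -> (A (v i + w) <-> sg)) ->
  (exists2 r : R, 0 < r & forall w, box r w -> wedge d1 d2 w -> (B (v i + w) <-> sg')) ->
  sg = sg'.
Proof.
move=> c0 p2 slope_inj [r r0 HA] [r' r'0 HB].
(* Since [slope m d2] is not zero, at most one of [k = 1] and [k = 2] fails. *)
have [k [k0 sk]] : exists k : R, 0 < k /\ slope m (d1 + k *: d2) != 0.
  have [E|E] := eqVneq (slope m (d1 + d2)) 0; last by exists 1; rewrite scale1r.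
  exists 2; split => //; have -> : d1 + (2 : R) *: d2 = (d1 + d2) + d2.
    by apply: planeP; rewrite !planeE; ring.
  by rewrite slopeD E add0r.
set w0 := d1 + k *: d2 in sk.
have w0W e : 0 < e -> wedge d1 d2 (e *: w0).
  move=> e0; split; rewrite ?coord1Z ?coord2Z mulr_gt0//.
    rewrite /w0 coord1_lin /coord1 divff// (_ : cross d2 d2 = 0) ?mul0r ?mulr0 ?addr0//.
    by rewrite /cross; ring.
  rewrite /w0 coord2_lin /coord2 divff// (_ : cross d1 d1 = 0) ?mul0r ?add0r ?mulr1//.
  by rewrite /cross; ring.
have [e e0 he] := box_small w0 r0; have [e' e'0 he'] := box_small w0 r'0.
have : \forall q \near (0 : R)^'+, forall l : V, slope m (v l) != slope m (v i + q *: w0).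
  apply: (@filter_forall _ _ (fun (l : V) q => slope m (v l) != slope m (v i + q *: w0)) (0 : R)^'+) => l.
  have [E|E] := eqVneq (slope m (v l)) (slope m (v i)).
    have near_gt := @nbhs_right_gt R 0.
    apply: filterS near_gt => q q0; rewrite E slopeD slopeZ -subr_eq0 opprD addNKr oppr_eq0.
    by rewrite mulf_neq0// gt_eqF.
  pose q0 : R := (slope m (v l) - slope m (v i)) / slope m w0.
  have q0n : q0 != 0 by rewrite mulf_neq0 ?subr_eq0 ?invr_eq0.
  have q0p : 0 < `|q0| by rewrite normr_gt0.
  have near_lt := nbhs_right_lt q0p.
  have near_gt := @nbhs_right_gt R 0.
  apply: filterS2 near_lt near_gt => q ql qp.
  apply/eqP => H; move: ql; rewrite /q0 H slopeD slopeZ [_ + _ - _]addrC addKr mulfK//.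
  by rewrite gtr0_norm// ltxx.
move=> [q0 /= q00 H].
pose q := Num.min q0 (Num.min e e') / 2.
have qm : 0 < Num.min q0 (Num.min e e') by rewrite !lt_min q00 e0.
have qp : 0 < q by rewrite divr_gt0.
have : q < Num.min q0 (Num.min e e') by rewrite /q; lra.
rewrite !lt_min => /and3P[qq0 qe qe'].
have av := H q _ qp; rewrite /= sub0r normrN gtr0_norm// in av.
have bA : box r (q *: w0) by apply: he; rewrite ltW.
have bB : box r' (q *: w0) by apply: he'; rewrite ltW.
have {}HA := HA _ bA (w0W q qp); have {}HB := HB _ bB (w0W q qp).
have AB : A (v i + q *: w0) <-> B (v i + q *: w0).
  have [bz|nb] := pselect (boundary A (v i + q *: w0)).
    split => _; first by apply: (boundary_sub clB); apply/same_boundaryP.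
    exact: boundary_sub bz.
  by apply: same_inside => // l; exact: av.
apply/idP/idP; first by move/HA/AB/HB.
by move/HB/AB/HA.
Qed.

End TwoPolygons.

End SideRelation.

(** * Comparison of two sources *)

Section Generic.
Context {R : realType}.
Local Notation plane := (R * R)%type.
Variables (N : nat) (P : 'I_N -> plane).

(** The only bad [m] for a pair of corners with difference [d] is [- d.1 / d.2]; the sum exceeds the
    absolute value of each. Pairs with [d.2 = 0] have no bad [m], and the division by zero
    contributes [0]. *)
Definition slope_bound : R :=
  \sum_a \sum_b `|(P a - P b).1 / (P a - P b).2|.

Lemma slope_generic m a b : slope_bound < m -> P a != P b -> slope m (P a - P b) != 0.
Proof.
move=> Bm Pab; set d := P a - P b; apply/eqP => E.
have B0 : 0 <= slope_bound by rewrite sumr_ge0// => *; rewrite sumr_ge0.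
have d1 : d.1 = - (m * d.2) by apply/eqP; rewrite -subr_eq0 opprK; apply/eqP.
have d2 : d.2 != 0.
  apply: contraNneq Pab => d20; rewrite -subr_eq0 -/d; apply/eqP.
  by apply: planeP => //; rewrite d1 d20 mulr0 oppr0.
have : m <= slope_bound.
  have -> : m = `|d.1 / d.2|.
    rewrite d1 mulNr mulfK// normrN ger0_norm// ltW//; exact: le_lt_trans Bm.
  rewrite /slope_bound (bigD1 a)//= (bigD1 b)//= -addrA lerDl.
  by rewrite addr_ge0// ?sumr_ge0// => *; rewrite sumr_ge0.
by rewrite leNgt Bm.
Qed.

Definition direction m : plane := ((Num.sqrt (1 + m ^+ 2))^-1, (Num.sqrt (1 + m ^+ 2))^-1 * m).

Lemma sqrt1m_gt0 m : 0 < Num.sqrt (1 + m ^+ 2 : R).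
Proof. by rewrite sqrtr_gt0 ltr_pwDl// sqr_ge0. Qed.

Lemma direction_circle m : circle (direction m).
Proof.
rewrite /circle /= /enorm /direction.
have m0 : (0 : R) <= 1 + m ^+ 2 by rewrite addr_ge0// sqr_ge0.
rewrite (_ : dot _ _ = 1) ?sqrtr1//.
have s0 : Num.sqrt (1 + m ^+ 2) != 0 by rewrite gt_eqF// sqrt1m_gt0.
rewrite /dot /=.
transitivity ((1 + m ^+ 2) / Num.sqrt (1 + m ^+ 2) ^+ 2); first by field.
by rewrite sqr_sqrtr// divff// gt_eqF// ltr_pwDl// sqr_ge0.
Qed.

Section Vertices.
Variables (V : finType) (v : V -> plane) (nx : V -> V) (A : set plane) (m : R).
Hypotheses (pA : polygonal v nx A) (vP : range v = range P) (Bm : slope_bound < m).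

Lemma vertex_slope_inj i j : slope m (v i) = slope m (v j) -> i = j.
Proof.
have [_ _ [v_inj _] _ _] := pA.
have [a _ Pa] : range P (v i) by rewrite -vP; exists i.
have [b _ Pb] : range P (v j) by rewrite -vP; exists j.
move=> E; apply: v_inj; rewrite -Pa -Pb; apply/eqP; apply: contraT => ab.
by have := slope_generic Bm ab; rewrite Pa Pb slopeD slopeN E subrr eqxx.
Qed.

Lemma vertex_transversal i j : v i != v j -> slope m (v i - v j) != 0.
Proof.
move=> ij; rewrite slopeD slopeN subr_eq0; apply: contraNneq ij.
by move/vertex_slope_inj => ->.
Qed.

Lemma side_transversal i : slope m (v (nx i) - v i) != 0.
Proof. by apply: vertex_transversal; rewrite -subr_eq0; exact: side_neq pA i. Qed.

End Vertices.

End Generic.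

Section Comparison.
Context {R : realType}.
Local Notation plane := (R * R)%type.
Implicit Types (m : R) (f g : plane -> R[i]).
Variables (N : nat) (P : 'I_N -> plane).

Section TwoSources.
Variables (V : finType) (v : V -> plane) (nx : V -> V) (A : set plane).
Variables (V' : finType) (v' : V' -> plane) (nx' : V' -> V') (B : set plane).
Hypotheses (pA : polygonal v nx A) (pB : polygonal v' nx' B).
Hypotheses (vP : range v = range P) (vP' : range v' = range P).

(** Both sides are limits of one and the same sequence of second differences, with steps below the
    thresholds of both sources. *)
Lemma jump_eq m h h' i j i' j' (sg sg' : bool) : slope_bound P < m ->
  regular_on A h -> regular_on B h' ->
  line_integral h m = line_integral h' m ->
  nx j = i -> nx' j' = i' -> v i = v' i' ->
  let d1 := v (nx i) - v i in let d2 := v j - v i in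
  let e1 := v' (nx' i') - v' i' in let e2 := v' j' - v' i' in
  local_model A (v i) (wedge d1 d2) (cowedge d1 d2) sg ->
  local_model B (v' i') (wedge e1 e2) (cowedge e1 e2) sg' ->
  h (v i) * (if sg then 1 else -1) * (`|cross d1 d2| / (slope m d1 * slope m d2)) =
  h' (v i) * (if sg' then 1 else -1) * (`|cross e1 e2| / (slope m e1 * slope m e2)).
Proof.
move=> Bm rh rh' E ji ji' ii' d1 d2 e1 e2 mod mod'.
have [a a0 Ha] := line_jump pA (side_transversal pA vP Bm)
  (vertex_slope_inj pA vP Bm) rh ji mod.
have [b b0 Hb] := line_jump pB (side_transversal pB vP' Bm)
  (vertex_slope_inj pB vP' Bm) rh' ji' mod'.
pose c : R := Num.min a b; have c0 : 0 < c by rewrite lt_min a0.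
pose eps n : R := c * n.+1%:R^-1.
have ceps : eps n @[n --> \oo] --> 0.
  by rewrite -[X in _ --> X](mulr0 c); apply: cvgMl_tmp; exact: cvg_harmonic.
have epsc n : 0 < eps n <= c.
  by rewrite mulr_gt0 ?invr_gt0//= ler_piMr ?(ltW c0)// invf_le1// ler1n.
have epsa n : 0 < eps n <= a.
  by have /andP[-> /le_trans] := epsc n; apply; rewrite ge_min lexx.
have epsb n : 0 < eps n <= b.
  by have /andP[-> /le_trans] := epsc n; apply; rewrite ge_min lexx orbT.
have {}Ha := Ha eps epsa ceps; have {}Hb := Hb eps epsb ceps.
have -> : h' (v i) = h' (v' i') by rewrite ii'.
rewrite /= -E -[slope m (v' i')](congr1 (slope m) ii') in Hb.
exact: (cvg_unique _ Ha Hb).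
Qed.

Lemma side_relP :
  (forall x y, side_rel v nx x y ->
     exists2 y', side_rel v' nx' x y' & cross (y - x) (y' - x) = 0) ->
  (forall x y, side_rel v' nx' x y ->
     exists2 y', side_rel v nx x y' & cross (y - x) (y' - x) = 0) ->
  forall x y, side_rel v nx x y <-> side_rel v' nx' x y.
Proof.
move=> H H' x y.
(* The direction is [y - x] itself, with coefficient [1], and the induction bound is one more than
   the number of corners before [x]. *)
have [h1 h2] := joins_sub (side_rel_joins pA vP) (side_rel_joins pB vP') H H'
  (ltnSn _) (esym (scale1r (y - x))).
by split.
Qed.

(** With equal sides the geometric factors agree, being symmetric in the two sides at the vertex,
    and the support fixes the sign; what remains of the jump identity for a single [m] is the
    value. *)
Lemma same_value m h h' i : slope_bound P < m -> compact A -> compact B ->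
  (forall x y, side_rel v nx x y <-> side_rel v' nx' x y) ->
  regular_on A h -> regular_on B h' ->
  line_integral h m = line_integral h' m -> h (v i) = h' (v i).
Proof.
move=> Bm cpA cpB same rh rh' E.
have [i' _ ii'] : range v' (v i) by rewrite vP' -vP; exists i.
have [j ji] := nx_surj pA i; have [j' ji'] := nx_surj pB i'.
have [sg mod] := vertex_cells pA ji; have [sg' mod'] := vertex_cells pB ji'.
have cr := vertex_cross pA ji; have cr' := vertex_cross pB ji'.
have J := jump_eq Bm rh rh' E ji ji' (esym ii') mod mod'.
set d1 := v (nx i) - v i in cr mod J; set d2 := v j - v i in cr mod J.
set e1 := v' (nx' i') - v' i' in cr' mod' J; set e2 := v' j' - v' i' in cr' mod' J.
have p1 : slope m d1 != 0 by exact: (side_transversal pA vP Bm).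
have p2 : slope m d2 != 0.
  have := side_transversal pA vP Bm j; rewrite ji -[v i - v j]opprB slopeN oppr_eq0.
  by [].
have R1 : side_rel v nx (v i) (v' (nx' i')).
  by apply/same; rewrite -ii'; exists i'; left.
have R2 : side_rel v nx (v i) (v' j').
  by apply/same; rewrite -ii'; exists j'; right; rewrite ji'.
have perm : (e1 = d1 /\ e2 = d2) \/ (e1 = d2 /\ e2 = d1).
  have cross0 (d : plane) : cross d d = 0 by rewrite /cross; ring.
  rewrite /e1 /e2 /d1 /d2 ii' in cr' *.
  have [E1|E1] := side_rel_vertex pA ji R1; have [E2|E2] := side_rel_vertex pA ji R2;
    rewrite E1 E2 in cr' *; [by rewrite cross0 eqxx in cr'|by left|by right|
    by rewrite cross0 eqxx in cr'].
have K0 : `|cross d1 d2| / (slope m d1 * slope m d2) != 0.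
  by rewrite mulf_neq0 ?normr_eq0// invr_eq0 mulf_neq0.
have KE : `|cross e1 e2| / (slope m e1 * slope m e2) =
    `|cross d1 d2| / (slope m d1 * slope m d2).
  case: perm => -[-> ->] //.
  by rewrite crossC normrN [slope m d2 * _]mulrC.
have sgE : sg = sg'.
  apply: (same_vertex_sign pA pB cpA cpB same (side_transversal pA vP Bm) (i := i) cr p2).
  - by move=> k /(vertex_slope_inj pA vP Bm).
  - by have [r r0 H] := mod; exists r => // w /H[].
  - have [r r0 H] := mod'; exists r => // w /H[H1 _] ww; rewrite -ii'; apply: H1.
    by case: perm => -[-> ->] //; exact: wedgeC.
move: J; rewrite KE sgE => /(mulIf K0).
by apply: mulIf; case: (sg'); rewrite ?oppr_eq0 oner_eq0.
Qed.

Variables (f g : plane -> R[i]) (m1 m2 m3 : R).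
Hypotheses (n12 : m1 != m2) (n23 : m2 != m3) (n13 : m1 != m3).
Hypothesis Bm : forall m, m = m1 \/ m = m2 \/ m = m3 -> slope_bound P < m.
Hypotheses (rfr : regular_on A (fun z => complex.Re (f z)))
  (rfi : regular_on A (fun z => complex.Im (f z)))
  (rgr : regular_on B (fun z => complex.Re (g z)))
  (rgi : regular_on B (fun z => complex.Im (g z))).
Hypothesis g0 : forall z, boundary B z -> g z != 0.
Hypothesis lineE : forall m, m = m1 \/ m = m2 \/ m = m3 ->
  line_integral (fun z => complex.Re (f z)) m = line_integral (fun z => complex.Re (g z)) m /\
  line_integral (fun z => complex.Im (f z)) m = line_integral (fun z => complex.Im (g z)) m.

(** The identity of quadratic forms is used for whichever of the real and imaginary parts of [g] is
    nonzero at the corner. It gives parallel lines only; the far ends of the sides may still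
    differ. *)
Lemma sides_parallel x y : side_rel v' nx' x y ->
  exists2 y', side_rel v nx x y' & cross (y - x) (y' - x) = 0.
Proof.
move=> xy.
have [i' xi'] : exists i', x = v' i'.
  by case: xy => i' [[-> _]|[_ ->]]; [exists i'|exists (nx' i')].
have [i _ xi] : range v x by rewrite vP -vP' xi'; exists i'.
have [j ji] := nx_surj pA i; have [j' ji'] := nx_surj pB i'.
have ii' : v i = v' i' by rewrite xi -xi'.
have [sg mod] := vertex_cells pA ji; have [sg' mod'] := vertex_cells pB ji'.
have cr' := vertex_cross pB ji'.
pose d1 := v (nx i) - v i; pose d2 := v j - v i.
pose e1 := v' (nx' i') - v' i'; pose e2 := v' j' - v' i'.
have sl m : m = m1 \/ m = m2 \/ m = m3 ->
    [/\ slope m d1 != 0, slope m d2 != 0, slope m e1 != 0 & slope m e2 != 0].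
  move=> /Bm Bmm; split.
  - exact: (side_transversal pA vP Bmm).
  - have := side_transversal pA vP Bmm j; rewrite ji -[v i - v j]opprB slopeN oppr_eq0.
    by [].
  - exact: (side_transversal pB vP' Bmm).
  - have := side_transversal pB vP' Bmm j'; rewrite ji' -[v' i' - v' j']opprB slopeN oppr_eq0.
    by [].
have gx : g (v i) != 0.
  by apply: g0; rewrite ii'; apply: (side_boundary pB (i := i')); exact: segment_l.
have comp h h' : regular_on A h -> regular_on B h' ->
    (forall m, m = m1 \/ m = m2 \/ m = m3 -> line_integral h m = line_integral h' m) ->
    h' (v i) != 0 ->
    (cross d1 e1 = 0 \/ cross d2 e1 = 0) /\ (cross d1 e2 = 0 \/ cross d2 e2 = 0).
  move=> rh rh' E h'0.
  apply: (@lines_determined R (h (v i) * (if sg then 1 else -1) * `|cross d1 d2|)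
    (h' (v i) * (if sg' then 1 else -1) * `|cross e1 e2|) d1 d2 e1 e2 m1 m2 m3) => //.
    rewrite !mulf_neq0// ?normr_eq0//; case: (sg'); rewrite ?oppr_eq0 oner_eq0//.
  move=> m mm; split; first exact: sl.
  by rewrite -!mulrA mulrA [RHS]mulrA; apply: (jump_eq (Bm mm) rh rh' (E m mm) ji ji' ii').
have [H1 H2] : (cross d1 e1 = 0 \/ cross d2 e1 = 0) /\ (cross d1 e2 = 0 \/ cross d2 e2 = 0).
  have [re0|re0] := eqVneq (complex.Re (g (v i))) 0; last first.
    by apply: (comp _ _ rfr rgr) => // m /lineE[].
  have im0 : complex.Im (g (v i)) != 0.
    by apply: contraNneq gx => im0; rewrite eq_complex re0 im0 eqxx.
  by apply: (comp _ _ rfi rgi) => // m /lineE[].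
have S1 : side_rel v nx x (v (nx i)) by exists i; left.
have S2 : side_rel v nx x (v j) by exists j; right; rewrite ji.
have par (a b : plane) : cross b a = 0 -> cross a b = 0.
  by move=> ab; rewrite crossC ab oppr0.
rewrite xi' in xy; have [->|->] := side_rel_vertex pB ji' xy.
- by case: H1 => E; [exists (v (nx i))|exists (v j)] => //; apply: par;
    move: E; rewrite /d1 /d2 /e1 xi -xi'.
- by case: H2 => E; [exists (v (nx i))|exists (v j)] => //; apply: par;
    move: E; rewrite /d1 /d2 /e2 xi -xi'.
Qed.

End TwoSources.

End Comparison.

Theorem theorem3p5 (R : realType) (f : R * R -> R[i]) (M : nat)
    (Om : 'I_M -> set (R * R)) (kmin kmax : R) (N : nat) (P : 'I_N -> R * R) :
  polygonal_source f Om ->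
  0 < kmin -> kmin < kmax ->
  injective P -> corners (supp f) = range P ->
  exists (T : nat) (xhat : 'I_T -> R * R),
    (forall i, circle (xhat i)) /\
    forall (g : R * R -> R[i]) (M' : nat) (Om' : 'I_M' -> set (R * R)),
      polygonal_source g Om' ->
      corners (supp g) = range P ->
      (forall i (k : R), kmin < k -> k < kmax ->
         far_field g (xhat i) k = far_field f (xhat i) k /\
         far_field g (- xhat i) k = far_field f (- xhat i) k) ->
      edges (supp g) = edges (supp f) /\
      forall n, g (P n) = f (P n).
Proof.
move=> sf _ kk _ cf.
(* Three distinct values above the bound, fixed by the corners before any competitor [g] is
   given. *)
pose mm (k : nat) : R := slope_bound P + 1 + k%:R.
have mmB k : slope_bound P < mm k by rewrite /mm -addrA ltrDl ltr_pwDl.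
have mm_neq k l : k != l -> mm k != mm l.
  by move=> kl; apply/eqP => /addrI /eqP; rewrite eqr_nat (negPf kl).
exists 3%N, (fun i => direction (mm i)); split.
  by move=> i; exact: direction_circle.
move=> g M' Om' sg cg ff.
have [[V [v [nx pA]]] rfr rfi f0] := polygonal_source_supp sf.
have [[V' [v' [nx' pB]]] rgr rgi g0] := polygonal_source_supp sg.
have vP : range v = range P by rewrite -(polygonal_corners pA).
have vP' : range v' = range P by rewrite -(polygonal_corners pB).
have lineE (k : nat) : (k < 3)%N ->
    line_integral (fun z => complex.Re (f z)) (mm k) =
      line_integral (fun z => complex.Re (g z)) (mm k) /\
    line_integral (fun z => complex.Im (f z)) (mm k) =
      line_integral (fun z => complex.Im (g z)) (mm k).
  move=> k3.
  have tA := side_transversal pA vP (mmB k).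
  have tB := side_transversal pB vP' (mmB k).
  have c0 : 0 < (Num.sqrt (1 + mm k ^+ 2))^-1 by rewrite invr_gt0 sqrt1m_gt0.
  have H := line_integral_unique c0 kk (regular_on_bounded_supp2 rfr)
    (regular_on_bounded_supp2 rfi) (regular_on_bounded_supp2 rgr)
    (regular_on_bounded_supp2 rgi) (line_integral_continuous pA tA rfr)
    (line_integral_continuous pA tA rfi) (line_integral_continuous pB tB rgr)
    (line_integral_continuous pB tB rgi)
    (fun q q1 q2 => proj1 (ff (Ordinal k3) q q1 q2)).
  by split; apply/funext => s; case: (H s).
have n01 := mm_neq 0%N 1%N isT; have n12 := mm_neq 1%N 2%N isT.
have n02 := mm_neq 0%N 2%N isT.
have Bm m : m = mm 0%N \/ m = mm 1%N \/ m = mm 2%N -> slope_bound P < m.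
  by move=> [|[|]] ->.
have lineE' m : m = mm 0%N \/ m = mm 1%N \/ m = mm 2%N ->
    line_integral (fun z => complex.Re (f z)) m =
      line_integral (fun z => complex.Re (g z)) m /\
    line_integral (fun z => complex.Im (f z)) m =
      line_integral (fun z => complex.Im (g z)) m.
  by move=> [|[|]] ->; exact: lineE.
have gf := sides_parallel pA pB vP vP' n01 n12 n02 Bm rfr rfi rgr rgi g0 lineE'.
(* The roles are exchanged: now it is [f] that must not vanish at the corners. *)
have fg := sides_parallel pB pA vP' vP n01 n12 n02 Bm rgr rgi rfr rfi f0
  (fun m mE => conj (esym (proj1 (lineE' m mE))) (esym (proj2 (lineE' m mE)))).
have same := side_relP pA pB vP vP' fg gf.
split.
  rewrite (edges_side_rel pA) (edges_side_rel pB); apply/seteqP.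
  by split => e [x [y [/same xy ->]]]; exists x, y.
move=> n; have [i _ vi] : range v (P n) by rewrite vP; exists n.
have cpA : compact (supp f) by case: rfr.
have cpB : compact (supp g) by case: rgr.
have [lr li] := lineE 0%N isT.
have er := same_value pA pB vP vP' i (mmB 0%N) cpA cpB same rfr rgr lr.
have ei := same_value pA pB vP vP' i (mmB 0%N) cpA cpB same rfi rgi li.
by apply/eqP; rewrite eq_complex -vi er ei !eqxx.
Qed.
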